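(* For every $\tau\in\mathbb H_n$, the theta series $\Xi(\tau,Z)=\sum_{X\in h+L^n}\psi(\tau,X,Z)$ (an $(n-1)$-form in $Z\in M=\Gamma\backslash B$ with values in the antiholomorphic cotangent space of $\mathbb H_n$ at $\tau$) is rapidly decreasing on $M$.
   Context: Setting. Let $V$ be a $\mathbb Q$-vector space of dimension $m=p+1$ with a non-degenerate symmetric bilinear form $(\,,)$ of signature $(p,1)$. Let $L\subset V$ be a $\mathbb Z$-lattice of full rank with $L\subset L^{\#}$ (dual lattice), $G=SO(V)$, $G_0(\mathbb R)$ the identity component of $G(\mathbb R)$, $\Gamma$ a neat subgroup of finite index in the stabilizer of $L$ in $G_0(\mathbb R)$, acting trivially on $L^{\#}/L$. $B$ is one component of $\{Z\in V(\mathbb R):(Z,Z)=-1\}$, $T_Z(B)=Z^\perp$. $M=\Gamma\backslash B$ has finite volume and is assumed non-compact. Fix $1\le n\le p$ and $h\in(L^{\#})^n$. Cusp coordinates. Let $\ell_0,\dots,\ell_r$ represent the $\Gamma$-orbits of rational isotropic lines, $u_j$ the primitive generator of $\ell_j\cap L$ with $(u_j,Z)<0$ on $B$, $g_j\in G(\mathbb Q)\cap G_0(\mathbb R)$ with $g_ju_0=u_j$, $g_0=1$; $u_0'$ rational isotropic with $(u_0,u_0')=-\frac12$; $W=\{u_0,u_0'\}^\perp$; $Z(t,b)=(t+t^{-1}(b,b))u_0+t^{-1}b+t^{-1}u_0'$ for $t>0,b\in W(\mathbb R)$. A form on $M$ is rapidly decreasing if for each cusp $j$ its coefficients in the coordinates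 $(t,b)\mapsto g_jZ(t,b)$, with respect to the frame $dt/t,\ db_i/t$ ($b_i$ linear coordinates on $W(\mathbb R)$), are $O(t^{-k})$ as $t\to\infty$ for every $k$, uniformly for $b$ in compact sets. The form $\psi$. Let $Z_0=u_0+u_0'\in B$, $e_1=u_0-u_0'$, $e_2,\dots,e_p$ an orthonormal basis of $W(\mathbb R)$, $e_{p+1}=Z_0$; let $x_{ij}$ be the coordinates of $X=(x_1,\dots,x_n)\in V(\mathbb R)^n$ in this basis ($x_j=\sum_ix_{ij}e_i$), and $\omega_1,\dots,\omega_p$ the basis of $T_{Z_0}(B)^*=(Z_0^\perp)^*$ dual to $e_1,\dots,e_p$. Let $\varphi_0(X)=\exp(-\pi\sum_{i,j}x_{ij}^2)$. For $1\le j,k\le n$ put $$A_{jk}(X)=(-1)^{k-1}\sum_{1\le\alpha_1<\dots<\alpha_{n-1}\le p}x_{mj}\,P^{(k)}_{\alpha_1,\dots,\alpha_{n-1}}(X)\,\varphi_0(X)\;\omega_{\alpha_1}\wedge\dots\wedge\omega_{\alpha_{n-1}},$$ where $P^{(k)}_{\alpha_1,\dots,\alpha_{n-1}}(X)$ is the minor of the coordinate matrix of $X$ with $k$-th column deleted, on rows $\alpha_1,\dots,\alpha_{n-1}$. Let $\nu_{jk}$ ($1\le j\le k\le n$) be the basis of the antiholomorphic cotangent space of $\mathbb H_n$ at $i1_n$ dual to the standard basis of $\mathrm{Sym}_n(\mathbb C)$. Then $$\psi(X)=i\,2^{n/2}\Big[\sum_jA_{jj}(X)\otimes\nu_{jj}+\tfrac34\sum_{j<k}(A_{jk}(X)+A_{kj}(X))\otimes\nu_{jk}\Big].$$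 It is extended to an $(n-1)$-form $\psi(X,Z)$ on $B$ by $G_0(\mathbb R)$-equivariance ($\psi(gX,gZ)=\psi(X,Z)$ in the sense of pullback of forms). For $\tau=u+iv\in\mathbb H_n$, $\psi(\tau,X,Z)$ is obtained from $\psi$ by replacing each coefficient $A(X,Z)$ by $e^{\pi i\,\mathrm{tr}(u(X,X))}A(Xv^{1/2},Z)$ (the action of the Weil representation) and $\nu_{jk}$ by its translate to $\tau$ under $\begin{pmatrix}v^{1/2}&uv^{-1/2}\\0&v^{-1/2}\end{pmatrix}\in Sp(n,\mathbb R)$. *)

(* Defs.v *)
From HB Require Import structures.
From mathcomp Require Import all_boot all_order all_algebra.
From mathcomp Require Import complex.
From mathcomp Require Import all_classical all_reals all_analysis.
Import Order.TTheory GRing.Theory Num.Theory.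
Import numFieldNormedType.Exports.
Set Implicit Arguments.
Unset Strict Implicit.
Unset Printing Implicit Defensive.
Local Open Scope classical_set_scope.
Local Open Scope ring_scope.
Local Open Scope complex_scope.

(* V = rat^m and V(R) = R^m, column vectors, m = p + 1; the form is given by its
   Gram matrix Q.  An n-tuple X of vectors is the m x n matrix of its columns,
   so that gX is g *m X, X v^{1/2} is X *m v^{1/2} and (X,X) is X^T Q X. *)

Definition toR {R : realType} {a b : nat} (A : 'M[rat]_(a, b)) : 'M[R]_(a, b) :=
  map_mx (@ratr R) A.

Definition bil {F : fieldType} {m : nat} (Q : 'M[F]_m) (x y : 'cV[F]_m) : F :=
  (x^T *m Q *m y) 0 0.

Definition has_signature_p1 (R : realType) {p : nat} (Q : 'M[rat]_p.+1) : Prop :=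
  exists2 P : 'M[R]_p.+1, P \in unitmx &
    P^T *m toR Q *m P =
      diag_mx (\row_(j < p.+1) (if j == ord_max then -1 else 1)).

Definition is_lattice {m : nat} (L : set 'cV[rat]_m) : Prop :=
  exists2 A : 'M[rat]_m, A \in unitmx &
    L = [set A *m map_mx intr c | c in [set: 'cV[int]_m]].

Definition dual_lattice {m : nat} (Q : 'M[rat]_m) (L : set 'cV[rat]_m) :
    set 'cV[rat]_m :=
  [set x | forall y, L y -> bil Q x y \is a Num.int].

Definition lattice_coset {m n : nat} (L : set 'cV[rat]_m) (h : 'M[rat]_(m, n)) :
    set 'M[rat]_(m, n) :=
  [set X | forall j, L (col j (X - h))].

Definition SO {R : realType} {p : nat} (Q : 'M[rat]_p.+1) : set 'M[R]_p.+1 :=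
  [set g | g^T *m toR Q *m g = toR Q /\ \det g = 1].

Definition SO0 {R : realType} {p : nat} (Q : 'M[rat]_p.+1) : set 'M[R]_p.+1 :=
  connected_component (SO Q) 1%:M.

Definition hyperboloid {R : realType} {p : nat} (Q : 'M[rat]_p.+1) :
    set 'cV[R]_p.+1 :=
  [set Z | bil (toR Q) Z Z = -1].

Definition is_component {T : topologicalType} (A C : set T) : Prop :=
  exists2 x, A x & C = connected_component A x.

Definition tangent {R : realType} {p : nat} (Q : 'M[rat]_p.+1)
    (Z : 'cV[R]_p.+1) : set 'cV[R]_p.+1 :=
  [set v | bil (toR Q) Z v = 0].

Definition lattice_stabilizer {R : realType} {p : nat} (Q : 'M[rat]_p.+1)
    (L : set 'cV[rat]_p.+1) : set 'M[R]_p.+1 :=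
  [set g | SO0 Q g /\
           [set g *m x | x in [set toR y | y in L]] = [set toR y | y in L]].

Definition finite_index_subgroup {R : realType} {m : nat}
    (H G : set 'M[R]_m) : Prop :=
  [/\ H `<=` G,
      H 1%:M,
      forall g g', H g -> H g' -> H (g *m g'),
      forall g, H g -> H (invmx g) &
      exists s : seq 'M[R]_m,
        forall g, G g -> exists x c, [/\ H x, c \in s & g = x *m c]].

(* For every g in the group, the subgroup of C^* generated by the (complex)
   eigenvalues of g is torsion free. *)
Definition neat {R : realType} {m : nat} (H : set 'M[R]_m) : Prop :=
  forall g, H g -> forall s : seq (R[i] * int),
    all (fun a => eigenvalue (map_mx (real_complex R) g) a.1) s ->
    forall k : nat, (0 < k)%N ->
      (\prod_(a <- s) a.1 ^ a.2) ^+ k = 1 -> \prod_(a <- s) a.1 ^ a.2 = 1.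

Definition trivial_on_discriminant {R : realType} {p : nat} (Q : 'M[rat]_p.+1)
    (L : set 'cV[rat]_p.+1) (Gam : set 'M[R]_p.+1) : Prop :=
  forall g x, Gam g -> dual_lattice Q L x ->
    exists2 y, L y & g *m toR x - toR x = toR y.

(* The open subsets of Gam \ B are the images of the Gam-invariant sets U `&` B
   with U open in V(R); this is cover_compact for the quotient topology. *)
Definition quotient_compact {R : realType} {p : nat} (Gam : set 'M[R]_p.+1)
    (B : set 'cV[R]_p.+1) : Prop :=
  forall (I : choiceType) (D : set I) (U : I -> set 'cV[R]_p.+1),
    (forall i, D i -> open (U i) /\
       forall g Z, Gam g -> B Z -> U i Z -> U i (g *m Z)) ->
    B `<=` cover D U -> finite_subset_cover D U B.

(* Lebesgue outer measure in R^m, by countable covers with closed boxes. *)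
Definition finite_outer_volume {R : realType} {m : nat} (A : set 'cV[R]_m) : Prop :=
  exists a b : nat -> 'cV[R]_m,
    [/\ forall k i, a k i 0 <= b k i 0,
        A `<=` \bigcup_k [set x : 'cV[R]_m | forall i, a k i 0 <= x i 0 <= b k i 0] &
        (\sum_(0 <= k <oo) (\prod_i (b k i 0 - a k i 0))%:E < +oo)%E].

(* Up to a constant, the invariant volume of a subset F of B is the Lebesgue
   measure in V(R) of the cone over F with vertex 0. *)
Definition quotient_finite_volume {R : realType} {p : nat}
    (Gam : set 'M[R]_p.+1) (B : set 'cV[R]_p.+1) : Prop :=
  exists F : set 'cV[R]_p.+1,
    [/\ F `<=` B,
        forall Z, B Z -> exists g Z', [/\ Gam g, F Z' & Z = g *m Z'] &
        finite_outer_volume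
          [set x | exists s Z, [/\ 0 < s <= 1, F Z & x = s *: Z]]].

Definition primitive_in {m : nat} (L : set 'cV[rat]_m) (x : 'cV[rat]_m) : Prop :=
  [/\ L x, x != 0 & forall q : rat, L (q *: x) -> q \is a Num.int].

(* The line l_j is spanned by u j. *)
Definition cusp_representatives {R : realType} {p r : nat} (Q : 'M[rat]_p.+1)
    (L : set 'cV[rat]_p.+1) (B : set 'cV[R]_p.+1) (Gam : set 'M[R]_p.+1)
    (u : 'I_r.+1 -> 'cV[rat]_p.+1) : Prop :=
  [/\ forall j, bil Q (u j) (u j) = 0,
      forall j, primitive_in L (u j),
      forall j Z, B Z -> bil (toR Q) (toR (u j)) Z < 0 &
      forall x : 'cV[rat]_p.+1, x != 0 -> bil Q x x = 0 ->
        exists! j, exists g, exists q : rat,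
          Gam g /\ toR x = g *m toR (q *: u j)].

Definition Wspace {R : realType} {p : nat} (Q : 'M[rat]_p.+1)
    (u0 u0' : 'cV[rat]_p.+1) : set 'cV[R]_p.+1 :=
  [set b | bil (toR Q) (toR u0) b = 0 /\ bil (toR Q) (toR u0') b = 0].

Definition is_W_basis {R : realType} {p : nat} (Q : 'M[rat]_p.+1)
    (u0 u0' : 'cV[rat]_p.+1) (f : 'M[R]_(p.+1, p.-1)) : Prop :=
  (forall i, Wspace Q u0 u0' (col i f)) /\ \rank f = p.-1.

Definition Zcusp {R : realType} {p : nat} (Q : 'M[rat]_p.+1)
    (u0 u0' : 'cV[rat]_p.+1) (t : R) (b : 'cV[R]_p.+1) : 'cV[R]_p.+1 :=
  (t + t^-1 * bil (toR Q) b b) *: toR u0 + t^-1 *: b + t^-1 *: toR u0'.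

(* The frame dual to dt/t, db_i/t in the coordinates (t,b) |-> g Z(t,b), where
   b = sum_i b_i f_i and f_i is the i-th column of f: None stands for
   t d/dt and Some i for t d/db_i. *)
Definition cusp_frame {R : realType} {p : nat} (Q : 'M[rat]_p.+1)
    (u0 u0' : 'cV[rat]_p.+1) (f : 'M[R]_(p.+1, p.-1)) (g : 'M[R]_p.+1)
    (t : R) (b : 'cV[R]_p.+1) (c : option 'I_p.-1) : 'cV[R]_p.+1 :=
  t *: match c with
       | None => derive1 (fun s : R => g *m Zcusp Q u0 u0' s b) t
       | Some i => derive1 (fun s : R => g *m Zcusp Q u0 u0' t (b + s *: col i f)) 0
       end.

(* A k-form on B with values in the antiholomorphic cotangent space of H_n:
   a point Z of B, k tangent vectors at Z and a tangent vector
   H in Sym_n(C) of H_n are mapped to a complex number. *)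
Definition vform (R : realType) (p k n : nat) : Type :=
  'cV[R]_p.+1 -> ('I_k -> 'cV[R]_p.+1) -> 'M[R[i]]_n -> R[i].

(* The form on B is the pullback of a form on Gam \ B. *)
Definition quotient_form {R : realType} {p k n : nat} (Q : 'M[rat]_p.+1)
    (B : set 'cV[R]_p.+1) (Gam : set 'M[R]_p.+1) (w : vform R p k n) : Prop :=
  forall g Z vs H, Gam g -> B Z -> (forall a, tangent Q Z (vs a)) -> H^T = H ->
    w (g *m Z) (fun a => g *m vs a) H = w Z vs H.

Definition rapidly_decreasing {R : realType} {p r k n : nat} (Q : 'M[rat]_p.+1)
    (u0 u0' : 'cV[rat]_p.+1) (f : 'M[R]_(p.+1, p.-1))
    (g : 'I_r.+1 -> 'M[rat]_p.+1) (w : vform R p k n) : Prop :=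
  forall (j : 'I_r.+1) (c : 'I_k -> option 'I_p.-1) (H : 'M[R[i]]_n),
    H^T = H ->
  forall K : set 'cV[R]_p.+1, compact K -> K `<=` Wspace Q u0 u0' ->
  forall N : nat, exists C T : R, 0 < T /\
    forall t b, T <= t -> K b ->
      ComplexField.Normc.normc
        (w (toR (g j) *m Zcusp Q u0 u0' t b)
           (fun a => cusp_frame Q u0 u0' f (toR (g j)) t b (c a)) H)
      <= C * t ^- N.

(* The columns of E are e_1, ..., e_{p+1}; for 0 < i < p, column i is the
   i-th vector of an orthonormal basis of W(R). *)
Definition is_adapted_basis {R : realType} {p : nat} (Q : 'M[rat]_p.+1)
    (u0 u0' : 'cV[rat]_p.+1) (E : 'M[R]_p.+1) : Prop :=
  [/\ col ord0 E = toR (u0 - u0'),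
      col ord_max E = toR (u0 + u0'),
      forall i : 'I_p.+1, (0 < i < p)%N -> Wspace Q u0 u0' (col i E) &
      forall i j : 'I_p.+1, (0 < i < p)%N -> (0 < j < p)%N ->
        bil (toR Q) (col i E) (col j E) = (i == j)%:R].

Definition phi0 {R : realType} {p n : nat} (x : 'M[R]_(p.+1, n)) : R :=
  expR (- pi * \sum_i \sum_j x i j ^+ 2).

Definition increasing {k p : nat} (al : {ffun 'I_k -> 'I_p}) : bool :=
  [forall a : 'I_k, forall b : 'I_k, (a < b)%N ==> (al a < al b)%N].

(* Index i <= p - 1 of 'I_p as a row index of coordinate matrices; the last row
   (index ord_max) holds the coordinates x_{mj}. *)
Definition row_index {p : nat} (i : 'I_p) : 'I_p.+1 := widen_ord (leqnSn p) i.

Definition minorP {R : realType} {p n : nat} (k : 'I_n)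
    (al : {ffun 'I_n.-1 -> 'I_p}) (x : 'M[R]_(p.+1, n)) : R :=
  \det (\matrix_(a < n.-1, b < n.-1) col' k x (row_index (al a)) b).

(* (omega_{al_1} /\ ... /\ omega_{al_k})(vs) *)
Definition wedge_omega {R : realType} {p k : nat} (E : 'M[R]_p.+1)
    (al : {ffun 'I_k -> 'I_p}) (vs : 'I_k -> 'cV[R]_p.+1) : R :=
  \det (\matrix_(a < k, b < k) (invmx E *m vs b) (row_index (al a)) 0).

(* A_{jk}(X) at the base point Z_0; indices start at 0, whence the sign. *)
Definition A0 {R : realType} {p n : nat} (E : 'M[R]_p.+1) (j k : 'I_n)
    (X : 'M[R]_(p.+1, n)) (vs : 'I_n.-1 -> 'cV[R]_p.+1) : R :=
  let x := invmx E *m X in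
  (-1) ^+ k * \sum_(al : {ffun 'I_n.-1 -> 'I_p} | increasing al)
    x ord_max j * minorP k al x * phi0 x * wedge_omega E al vs.

(* Some g in G_0(R) with g Z_0 = Z, Z_0 being the last column of E. *)
Definition transporter {R : realType} {p : nat} (Q : 'M[rat]_p.+1)
    (E : 'M[R]_p.+1) (Z : 'cV[R]_p.+1) : 'M[R]_p.+1 :=
  xget 1%:M [set g | SO0 Q g /\ g *m col ord_max E = Z].

(* A_{jk}(X, Z), the G_0(R)-equivariant extension of A0; the choice of g is
   immaterial, since A0 is invariant under the stabilizer of Z_0. *)
Definition A_at {R : realType} {p n : nat} (Q : 'M[rat]_p.+1) (E : 'M[R]_p.+1)
    (j k : 'I_n) (X : 'M[R]_(p.+1, n)) (Z : 'cV[R]_p.+1)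
    (vs : 'I_n.-1 -> 'cV[R]_p.+1) : R :=
  let g := transporter Q E Z in
  A0 E j k (invmx g *m X) (fun a => invmx g *m vs a).

Definition posdef {R : realType} {n : nat} (v : 'M[R]_n) : Prop :=
  v^T = v /\ forall x : 'cV[R]_n, x != 0 -> 0 < (x^T *m v *m x) 0 0.

Definition reM {R : realType} {n : nat} (tau : 'M[R[i]]_n) : 'M[R]_n :=
  map_mx (@complex.Re R) tau.

Definition imM {R : realType} {n : nat} (tau : 'M[R[i]]_n) : 'M[R]_n :=
  map_mx (@complex.Im R) tau.

Definition siegel {R : realType} {n : nat} : set 'M[R[i]]_n :=
  [set tau | tau^T = tau /\ posdef (imM tau)].

Definition sqrtmx {R : realType} {n : nat} (v : 'M[R]_n) : 'M[R]_n :=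
  xget 0 [set r | posdef r /\ r *m r = v].

(* nu_{jk}(H) is the conjugate of the (j,k) entry of H: dual to the basis
   E_{jj}, E_{jk} + E_{kj} (j < k) of Sym_n(C), conjugate-linear in H. *)
Definition nu {R : realType} {n : nat} (j k : 'I_n) (H : 'M[R[i]]_n) : R[i] :=
  (H j k)^*.

(* The symplectic matrix with blocks v^{1/2}, u v^{-1/2}, 0, v^{-1/2} acts on
   H_n by z |-> v^{1/2} z v^{1/2} + u and maps i to tau; a cotangent vector is
   translated by composing it with the inverse of the differential
   H |-> v^{1/2} H v^{1/2}. *)
Definition nu_at {R : realType} {n : nat} (tau : 'M[R[i]]_n) (j k : 'I_n)
    (H : 'M[R[i]]_n) : R[i] :=
  let r' := map_mx (real_complex R) (invmx (sqrtmx (imM tau))) in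
  nu j k (r' *m H *m r').

Definition cis {R : realType} (x : R) : R[i] := cos x +i* sin x.

Definition psi {R : realType} {p n : nat} (Q : 'M[rat]_p.+1) (E : 'M[R]_p.+1)
    (tau : 'M[R[i]]_n) (X : 'M[R]_(p.+1, n)) : vform R p n.-1 n :=
  fun Z vs H =>
  let a j k : R[i] :=
    cis (pi * \tr (reM tau *m (X^T *m toR Q *m X))) *
    (A_at Q E j k (X *m sqrtmx (imM tau)) Z vs)%:C in
  'i * (2 `^ (n%:R / 2))%:C *
  (\sum_(j < n) a j j * nu_at tau j j H +
   3 / 4 * \sum_(j < n) \sum_(k < n | (j < k)%N) (a j k + a k j) * nu_at tau j k H).

Definition csummable {R : realType} {T : choiceType} (D : set T)
    (F : T -> R[i]) : Prop :=
  summable D (fun x => (complex.Re (F x))%:E) /\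
  summable D (fun x => (complex.Im (F x))%:E).

Definition rsum {R : realType} {T : choiceType} (D : set T) (F : T -> R) : R :=
  fine (\esum_(x in D) (Num.max (F x) 0)%:E
        - \esum_(x in D) (Num.max (- F x) 0)%:E)%E.

Definition csum {R : realType} {T : choiceType} (D : set T)
    (F : T -> R[i]) : R[i] :=
  rsum D (fun x => complex.Re (F x)) +i* rsum D (fun x => complex.Im (F x)).

Definition theta {R : realType} {p n : nat} (Q : 'M[rat]_p.+1)
    (L : set 'cV[rat]_p.+1) (h : 'M[rat]_(p.+1, n)) (E : 'M[R]_p.+1)
    (tau : 'M[R[i]]_n) : vform R p n.-1 n :=
  fun Z vs H => csum (lattice_coset L h) (fun X => psi Q E tau (toR X) Z vs H).

(* Main.v *)
(** By Cauchy-Binet, in the coordinates y = E^-1 g^-1 X v^{1/2} attached to any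
    isometry g with g Z_0 = Z the form is a fixed function of y: a polynomial
    times exp (- pi |y|^2).  Hence the choice of g is immaterial, the theta series
    is Gamma-invariant, and its terms are dominated by a negative power of 1 + |X|,
    which is summable over the coset h + L^n.

    At the cusp u_j take g = g_j n(b) a(t); in the frame dt/t, db_i/t the tangent
    vectors then have constant coordinates, |X| = O(t |y|), and the terms with
    (u_j, X) <> 0 satisfy t = O(|y|), so they contribute O(t^-N).  On the remaining
    terms y_1 = y_m, and there the form is a divergence sum_i D_i H_i along fixed
    directions, because the symmetrisation A_jk + A_kj kills the derivative of the
    determinant.  The translation of X by u_j in its i-th column preserves the coset
    and moves y by D_i / t, so the sums tau_k of the k-th derivatives satisfy, by
    Taylor expansion with step 1 / t, a triangular system
    sum_(k >= 1) t^-k tau_(i+k) / k! = O(t^(i-N)), which forces tau_1 to be smaller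
    than every power of 1 / t. *)

Require Import Defs.
From HB Require Import structures.
From mathcomp Require Import all_boot all_order all_algebra.
From mathcomp Require Import fingroup perm complex.
From mathcomp Require Import all_classical all_reals all_analysis.
From mathcomp Require Import ring lra zify.
Import Order.TTheory GRing.Theory Num.Theory.
Import numFieldNormedType.Exports.
Set Implicit Arguments.
Unset Strict Implicit.
Unset Printing Implicit Defensive.
Local Open Scope classical_set_scope.
Local Open Scope ring_scope.
Local Open Scope complex_scope.

(** * Sums dominated by a summable weight *)

(** Termwise bounds lose ground at the cusp: since [|X|] is only [O(t |y|)], a summable negative
    power of [1 + |X|] costs a factor [t ^+ l]. Both sources of decay are therefore run with [N + l]
    powers instead of [N]. Poisson summation along u_j would show the main term to be the integral
    of a derivative, hence zero. The elementary substitute used here is that a sum over the coset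
    equals the sum of its translates by one step; expanding their difference in powers of the step
    [1 / t] relates the sums of successive derivatives. The factor exp(pi i tr(u (X,X))) does not
    disturb this: when (u_j, X) = 0, moving X along the isotropic vector u_j leaves (X,X) unchanged.
    It enters as a multiplier of modulus at most 1 that is invariant under the translations, and the
    estimates are stated for real sums with such a multiplier. Constants are always chosen before
    [t], [b] and the coordinates [y], because uniformity in them is the claim. *)

Lemma max0B (R : realType) (x : R) : Num.max x 0 - Num.max (- x) 0 = x.
Proof.
by rewrite /Order.max; case: ltP => ?; case: ltP => ?; lra.
Qed.

Lemma ge0_esumZl (R : realType) (T : choiceType) (D : set T) (k : R)
    (a : T -> R) : 0 <= k -> (forall x, 0 <= a x) ->
  (\esum_(x in D) (k * a x)%:E = k%:E * \esum_(x in D) (a x)%:E)%E.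
Proof.
move=> k0 a0; have [->|kn0] := eqVneq k 0.
  by rewrite mul0e esum1// => x _; rewrite mul0r.
rewrite /esum -ereal_supZl//; last first.
  apply/set0P; exists 0%E; exists set0; first exact: fsets_set0.
  by rewrite fsbig_set0.
congr (ereal_sup _); apply/seteqP; split.
  move=> _ [A AD <-]; exists (\sum_(x \in A) (a x)%:E)%E; first by exists A.
  by rewrite ge0_mule_fsumr// => x; rewrite lee_fin.
move=> _ [_ [A AD <-] <-]; exists A => //.
by rewrite ge0_mule_fsumr// => x; rewrite lee_fin.
Qed.

Section WeightedSums.
Variables (R : realType) (T : choiceType) (D : set T) (w : T -> R).
Hypothesis w_ge0 : forall x, 0 <= w x.
Hypothesis w_sum : (\esum_(x in D) (w x)%:E < +oo)%E.

Definition dominated (F : T -> R) (C : R) := forall x, D x -> `|F x| <= C * w x.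

Definition nnsum (a : T -> R) : R := fine (\esum_(x in D) (a x)%:E).

Lemma esum_dom_fin (a : T -> R) (C : R) : 0 <= C ->
  (forall x, D x -> 0 <= a x <= C * w x) ->
  (\esum_(x in D) (a x)%:E \is a fin_num)%E.
Proof.
move=> C0 ha; rewrite ge0_fin_numE; last first.
  by apply: esum_ge0 => x /ha /andP[]; rewrite lee_fin.
apply: (@le_lt_trans _ _ (\esum_(x in D) (C * w x)%:E)%E).
  by apply: le_esum => x /ha /andP[]; rewrite lee_fin.
by rewrite ge0_esumZl// lte_mul_pinfty// lee_fin.
Qed.

Lemma nnsum_dom (a : T -> R) (C : R) : 0 <= C ->
  (forall x, D x -> 0 <= a x <= C * w x) -> 0 <= nnsum a <= C * nnsum w.
Proof.
move=> C0 ha; have fa := esum_dom_fin C0 ha.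
have fw : (\esum_(x in D) (w x)%:E \is a fin_num)%E.
  by rewrite ge0_fin_numE// esum_ge0// => x _; rewrite lee_fin.
rewrite /nnsum -lee_fin fineK// -lee_fin EFinM !fineK// -ge0_esumZl//.
rewrite esum_ge0/=; last by move=> x /ha /andP[]; rewrite lee_fin.
by apply: le_esum => x /ha /andP[]; rewrite lee_fin.
Qed.

Lemma nnsumD (a b : T -> R) (C : R) : 0 <= C ->
  (forall x, D x -> 0 <= a x <= C * w x) ->
  (forall x, D x -> 0 <= b x <= C * w x) ->
  nnsum (fun x => a x + b x) = nnsum a + nnsum b.
Proof.
move=> C0 ha hb; rewrite /nnsum -fineD; try exact: (esum_dom_fin C0).
congr fine; rewrite -esumD//.
- by move=> x /ha /andP[]; rewrite lee_fin.
- by move=> x /hb /andP[]; rewrite lee_fin.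
Qed.

Lemma eq_nnsum (a b : T -> R) : (forall x, D x -> a x = b x) ->
  nnsum a = nnsum b.
Proof. by move=> e; congr fine; apply: eq_esum => x /e ->. Qed.

Let pos (F : T -> R) x := Num.max (F x) 0.
Let neg (F : T -> R) x := Num.max (- F x) 0.

Lemma eq_rsum (F G : T -> R) : (forall x, D x -> F x = G x) ->
  rsum D F = rsum D G.
Proof.
by move=> e; rewrite /rsum; congr (fine (_ - _)%E);
  apply: eq_esum => x /e ->.
Qed.

Lemma pos_dom F C : dominated F C -> forall x, D x -> 0 <= pos F x <= C * w x.
Proof.
move=> d x /d; rewrite ler_norml => /andP[h1 h2]; rewrite /pos le_max lexx orbT.
rewrite ge_max h2/=; lra.
Qed.

Lemma dominatedN F C : dominated F C -> dominated (fun x => - F x) C.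
Proof. by move=> d x Dx; rewrite normrN; exact: d. Qed.

Lemma neg_dom F C : dominated F C -> forall x, D x -> 0 <= neg F x <= C * w x.
Proof. by move=> d; exact: (pos_dom (dominatedN d)). Qed.

Lemma rsumE F C : 0 <= C -> dominated F C ->
  rsum D F = nnsum (pos F) - nnsum (neg F).
Proof.
move=> C0 d; rewrite /rsum fineB//.
  exact: (esum_dom_fin C0 (pos_dom d)).
exact: (esum_dom_fin C0 (neg_dom d)).
Qed.

(** Positive parts are not additive, so linearity needs [rsum] to be computable from any dominated
    decomposition into a difference of nonnegative functions; adding the two negative parts
    crosswise leaves an identity of nonnegative sums. *)
Lemma rsum_diff F C (a b : T -> R) : 0 <= C -> dominated F C ->
  (forall x, D x -> 0 <= a x <= C * w x) ->
  (forall x, D x -> 0 <= b x <= C * w x) ->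
  (forall x, D x -> F x = a x - b x) ->
  rsum D F = nnsum a - nnsum b.
Proof.
move=> C0 d ha hb e; rewrite (rsumE C0 d).
apply/eqP; rewrite subr_eq addrAC -subr_eq opprK; apply/eqP.
rewrite -(nnsumD C0 (pos_dom d) hb) -(nnsumD C0 ha (neg_dom d)).
by apply: eq_nnsum => x /e; move: (max0B (F x)); rewrite /pos /neg; lra.
Qed.

Lemma rsumD F G C : 0 <= C -> dominated F C -> dominated G C ->
  rsum D (fun x => F x + G x) = rsum D F + rsum D G.
Proof.
move=> C0 dF dG; rewrite (rsumE C0 dF) (rsumE C0 dG).
have C2 : 0 <= C + C by lra.
have up (a b : T -> R) : (forall x, D x -> 0 <= a x <= C * w x) ->
  (forall x, D x -> 0 <= b x <= C * w x) ->
  forall x, D x -> 0 <= a x + b x <= (C + C) * w x.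
  by move=> ha hb x Dx; move: (ha x Dx) (hb x Dx); rewrite mulrDl; lra.
rewrite (@rsum_diff _ (C + C) (fun x => pos F x + pos G x)
  (fun x => neg F x + neg G x))//.
- rewrite (nnsumD C0 (pos_dom dF) (pos_dom dG)).
  by rewrite (nnsumD C0 (neg_dom dF) (neg_dom dG)); ring.
- move=> x Dx; rewrite (le_trans (ler_normD _ _))// mulrDl.
  by rewrite lerD// ?dF ?dG.
- exact: up (pos_dom dF) (pos_dom dG).
- exact: up (neg_dom dF) (neg_dom dG).
- by move=> x Dx; move: (max0B (F x)) (max0B (G x)); rewrite /pos /neg; lra.
Qed.

Lemma rsumN (F : T -> R) : rsum D (fun x => - F x) = - rsum D F.
Proof.
rewrite /rsum -fineN; under [X in (_ - X)%E]eq_esum => x _ do rewrite opprK.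
set A := (\esum_(_ in _) (Num.max (- _) _)%:E)%E.
set B := (\esum_(_ in _) _)%E.
have : (0 <= A)%E by apply: esum_ge0 => x _; rewrite lee_fin le_max lexx orbT.
have : (0 <= B)%E by apply: esum_ge0 => x _; rewrite lee_fin le_max lexx orbT.
(* No domination is assumed, so the sums may be infinite; [fine] then returns 0 on both sides. *)
by case: A => [a| |]; case: B => [b| |] //= _ _; ring.
Qed.

Lemma nnsumZ (a : T -> R) (k C : R) : 0 <= k -> 0 <= C ->
  (forall x, D x -> 0 <= a x <= C * w x) ->
  nnsum (fun x => k * a x) = k * nnsum a.
Proof.
move=> k0 C0 ha; have fa := esum_dom_fin C0 ha.
(* [ge0_esumZl] wants nonnegativity everywhere, while [a] has it on [D] only. *)
pose a' x := if x \in D then a x else 0.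
have a'0 x : 0 <= a' x.
  by rewrite /a'; case: ifPn => // /set_mem /ha /andP[].
have e x : D x -> a x = a' x by move=> Dx; rewrite /a' mem_set.
have -> : nnsum (fun x => k * a x) = nnsum (fun x => k * a' x).
  by apply: eq_nnsum => x /e ->.
rewrite (eq_nnsum e) /nnsum; rewrite -[k in RHS]/(fine k%:E) -fineM//; last first.
  by under eq_esum => x Dx do rewrite -e//.
by congr fine; exact: ge0_esumZl.
Qed.

Lemma rsumZ F C k : 0 <= C -> dominated F C ->
  rsum D (fun x => k * F x) = k * rsum D F.
Proof.
move=> C0 d; wlog k0 : k / 0 <= k => [hw|].
  have [/hw//|k0] := leP 0 k.
  rewrite -[in LHS](opprK k); under eq_rsum => x _ do rewrite mulNr.
  by rewrite rsumN hw ?mulNr ?opprK//; lra.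
rewrite (rsumE C0 d) mulrBr.
rewrite -(nnsumZ k0 C0 (pos_dom d)) -(nnsumZ k0 C0 (neg_dom d)).
have up (a : T -> R) : (forall x, D x -> 0 <= a x <= C * w x) ->
  forall x, D x -> 0 <= k * a x <= (k * C) * w x.
  by move=> ha x /ha /andP[h1 h2]; rewrite mulr_ge0//= -mulrA ler_wpM2l.
apply: (@rsum_diff _ (k * C)).
- exact: mulr_ge0.
- by move=> x Dx; rewrite normrM ger0_norm// -mulrA ler_wpM2l// d.
- exact: up (pos_dom d).
- exact: up (neg_dom d).
- move=> x _; rewrite -mulrBr; congr (_ * _).
  by rewrite max0B.
Qed.

Lemma rsum_dom F C : 0 <= C -> dominated F C -> `|rsum D F| <= C * nnsum w.
Proof.
move=> C0 d; rewrite (rsumE C0 d) ler_norml.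
have /andP[p0 p1] := nnsum_dom C0 (pos_dom d).
have /andP[q0 q1] := nnsum_dom C0 (neg_dom d).
by apply/andP; split; lra.
Qed.

Lemma rsum_reindex (e : T -> T) (F : T -> R) : set_bij D D e ->
  rsum D (fun x => F (e x)) = rsum D F.
Proof.
move=> be; rewrite /rsum; congr (fine (_ - _)%E).
  by rewrite [RHS](reindex_esum D D e).
by rewrite [RHS](reindex_esum D D e).
Qed.

Lemma rsum0 : rsum D (fun=> 0) = 0 :> R.
Proof. by rewrite /rsum !esum1 ?subee// => *; rewrite ?oppr0 /Order.max ltxx. Qed.

Lemma rsum_sum (I : Type) (s : seq I) (F : I -> T -> R) (C : R) : 0 <= C ->
  (forall i, dominated (F i) C) ->
  rsum D (fun x => \sum_(i <- s) F i x) = \sum_(i <- s) rsum D (F i).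
Proof.
(* The induction must also carry a domination bound for the partial sums, with a constant that grows
   with the list. *)
move=> C0 d; suff [] : (exists2 K, 0 <= K &
    dominated (fun x => \sum_(i <- s) F i x) K) /\
  rsum D (fun x => \sum_(i <- s) F i x) = \sum_(i <- s) rsum D (F i) by [].
elim: s => [|i s [[K K0 dK] IH]].
  split; first by exists 0 => // x _; rewrite big_nil normr0 mul0r.
  by rewrite big_nil; under eq_rsum do rewrite big_nil; exact: rsum0.
split.
  exists (C + K); first exact: addr_ge0.
  move=> x Dx; rewrite big_cons mulrDl (le_trans (ler_normD _ _))//.
  by rewrite lerD// ?d ?dK.
rewrite big_cons; under eq_rsum do rewrite big_cons.
rewrite -IH; apply: (@rsumD _ _ (C + K)); first exact: addr_ge0.
  by move=> x Dx; rewrite (le_trans (d i x Dx))// ler_wpM2r// lerDl.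
by move=> x Dx; rewrite (le_trans (dK x Dx))// ler_wpM2r// lerDr.
Qed.

Lemma summable_dom (F : T -> R) (C : R) : 0 <= C -> dominated F C ->
  summable D (fun x => (F x)%:E).
Proof.
move=> C0 d; have := esum_dom_fin (a := fun x => `|F x|) C0.
rewrite summableE; apply => x Dx; rewrite normr_ge0/=; exact: d.
Qed.

End WeightedSums.

(** * Entrywise norms, polynomial growth and Gaussian decay *)

Section EntryNorm.
Variable R : realType.

Definition n1 {m n : nat} (A : 'M[R]_(m, n)) : R := \sum_i \sum_j `|A i j|.

Lemma n1_ge0 m n (A : 'M[R]_(m, n)) : 0 <= n1 A.
Proof. by apply: sumr_ge0 => i _; apply: sumr_ge0. Qed.

Lemma n1_entry m n (A : 'M[R]_(m, n)) i j : `|A i j| <= n1 A.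
Proof.
rewrite /n1 (bigD1 i)//= (bigD1 j)//= -addrA lerDl addr_ge0//.
  exact: sumr_ge0.
by apply: sumr_ge0 => i' _; apply: sumr_ge0.
Qed.

Lemma n1D m n (A B : 'M[R]_(m, n)) : n1 (A + B) <= n1 A + n1 B.
Proof.
rewrite /n1 -big_split; apply: ler_sum => i _; rewrite -big_split.
by apply: ler_sum => j _; rewrite mxE ler_normD.
Qed.

Lemma n1Z m n (k : R) (A : 'M[R]_(m, n)) : n1 (k *: A) = `|k| * n1 A.
Proof.
rewrite /n1 mulr_sumr; apply: eq_bigr => i _; rewrite mulr_sumr.
by apply: eq_bigr => j _; rewrite mxE normrM.
Qed.

Lemma n1_mul m k n (A : 'M[R]_(m, k)) (B : 'M[R]_(k, n)) :
  n1 (A *m B) <= n1 A * n1 B.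
Proof.
rewrite {1 2}/n1 mulr_suml; apply: ler_sum => i _.
apply: (@le_trans _ _ (\sum_j \sum_l `|A i l| * `|B l j|)).
  apply: ler_sum => j _; rewrite mxE (le_trans (ler_norm_sum _ _ _))//.
  by apply: ler_sum => l _; rewrite normrM.
rewrite exchange_big mulr_suml /=; apply: ler_sum => l _.
rewrite -mulr_sumr ler_wpM2l// /n1 (bigD1 l)//= lerDl.
by apply: sumr_ge0 => i' _; apply: sumr_ge0.
Qed.

End EntryNorm.

(** * Functions of polynomial growth relative to a scale [s] *)

Section PolynomialGrowth.
Variables (R : realType) (I : Type) (s : I -> R).
Hypothesis s_ge1 : forall i, 1 <= s i.

Definition tame (F : I -> R) :=
  exists C K, 0 <= C /\ forall i, `|F i| <= C * s i ^+ K.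

Lemma tame_cst c : tame (fun=> c).
Proof. by exists `|c|, 0%N; split => // i; rewrite expr0 mulr1. Qed.

Lemma tame_ext F G : F =1 G -> tame F -> tame G.
Proof. by move=> e [C [K [C0 h]]]; exists C, K; split => // i; rewrite -e. Qed.

Lemma tameD F G : tame F -> tame G -> tame (fun i => F i + G i).
Proof.
move=> [C [K [C0 hF]]] [C' [K' [C'0 hG]]]; exists (C + C'), (K + K')%N.
split=> [|i]; first exact: addr_ge0.
rewrite (le_trans (ler_normD _ _))// mulrDl lerD//.
  by rewrite (le_trans (hF i))// ler_wpM2l// ler_weXn2l// leq_addr.
by rewrite (le_trans (hG i))// ler_wpM2l// ler_weXn2l// leq_addl.
Qed.

Lemma tameM F G : tame F -> tame G -> tame (fun i => F i * G i).
Proof.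
move=> [C [K [C0 hF]]] [C' [K' [C'0 hG]]]; exists (C * C'), (K + K')%N.
split=> [|i]; first exact: mulr_ge0.
by rewrite normrM exprD mulrACA ler_pM.
Qed.

Lemma tame_sum (J : Type) (t : seq J) (P : pred J) (F : J -> I -> R) :
  (forall j, tame (F j)) -> tame (fun i => \sum_(j <- t | P j) F j i).
Proof.
move=> h; elim: t => [|j t IH].
  by apply: tame_ext (tame_cst 0) => i; rewrite big_nil.
have [Pj|nPj] := boolP (P j).
  by apply: tame_ext (tameD (h j) IH) => i; rewrite big_cons Pj.
by apply: tame_ext IH => i; rewrite big_cons (negbTE nPj).
Qed.

Lemma tame_prod (J : Type) (t : seq J) (P : pred J) (F : J -> I -> R) :
  (forall j, tame (F j)) -> tame (fun i => \prod_(j <- t | P j) F j i).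
Proof.
move=> h; elim: t => [|j t IH].
  by apply: tame_ext (tame_cst 1) => i; rewrite big_nil.
have [Pj|nPj] := boolP (P j).
  by apply: tame_ext (tameM (h j) IH) => i; rewrite big_cons Pj.
by apply: tame_ext IH => i; rewrite big_cons (negbTE nPj).
Qed.

Lemma tame_det n (A : I -> 'M[R]_n) : (forall a b, tame (fun i => A i a b)) ->
  tame (fun i => \det (A i)).
Proof.
move=> h; apply: tame_sum => sg; apply: tameM; first exact: tame_cst.
by apply: tame_prod => a; exact: h.
Qed.

(** Bounded degree together with tame coefficients is stable under products and derivatives, and it
    controls the values uniformly on [[0, 1]], the range of the step [1 / t]. *)
Definition tamep (P : I -> {poly R}) :=
  (exists d, forall i, (size (P i) <= d)%N) /\
  forall k, tame (fun i => (P i)`_k).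

Lemma tamepD P Q : tamep P -> tamep Q -> tamep (fun i => P i + Q i).
Proof.
move=> [[d hd] hP] [[e he] hQ]; split.
  exists (maxn d e) => i; rewrite (leq_trans (size_polyD _ _))// geq_max.
  by rewrite (leq_trans (hd i)) ?leq_maxl// (leq_trans (he i)) ?leq_maxr.
by move=> k; apply: tame_ext (tameD (hP k) (hQ k)) => i; rewrite coefD.
Qed.

Lemma tamepM P Q : tamep P -> tamep Q -> tamep (fun i => P i * Q i).
Proof.
move=> [[d hd] hP] [[e he] hQ]; split.
  exists (d + e)%N => i; rewrite (leq_trans (size_polyMleq _ _))//.
  by rewrite (leq_trans (leq_pred _))// leq_add.
move=> k; apply: (@tame_ext (fun i => \sum_(j < k.+1) (P i)`_j * (Q i)`_(k - j))).
  by move=> i; rewrite coefM.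
by apply: tame_sum => j; exact: tameM (hP _) (hQ _).
Qed.

Lemma tamep_deriv P : tamep P -> tamep (fun i => (P i)^`()).
Proof.
move=> [[d hd] hP]; split.
  exists d => i; case: (P i =P 0) => [->|/eqP n0].
    by rewrite deriv0 size_poly0.
  by rewrite (leq_trans _ (hd i))// ltnW// lt_size_deriv.
move=> k; apply: tame_ext (tameM (tame_cst k.+1%:R) (hP k.+1)) => i.
by rewrite coef_deriv mulr_natl.
Qed.

Lemma tamep_linear (F G : I -> R) : tame F -> tame G ->
  tamep (fun i => (F i)%:P + (G i) *: 'X).
Proof.
move=> hF hG; split.
  exists 2%N => i; rewrite (leq_trans (size_polyD _ _))// geq_max.
  rewrite (leq_trans (size_polyC_leq1 _))//=.
  by rewrite (leq_trans (size_scale_leq _ _))// size_polyX.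
move=> k; apply: tame_ext (tameD (tameM (tame_cst (k == 0)%:R) hF)
  (tameM (tame_cst (k == 1)%:R) hG)) => i.
rewrite coefD coefC coefZ coefX mulrC; congr (_ + _); last by rewrite mulrC.
by case: eqP => _; rewrite ?mulr1 ?mulr0.
Qed.

Lemma tamep_horner P : tamep P -> exists C K, 0 <= C /\
  forall i x, 0 <= x <= 1 -> `|(P i).[x]| <= C * s i ^+ K.
Proof.
move=> [[d hd] hP].
have [C [K [C0 h]]] : tame (fun i => \sum_(k < d) `|(P i)`_k|).
  apply: tame_sum => k; have [C [K [C0 h]]] := hP k.
  by exists C, K; split => // i; rewrite normr_id.
exists C, K; split => // i x /andP[x0 x1]; apply: le_trans (h i).
rewrite (horner_coef_wide _ (hd i)) (le_trans (ler_norm_sum _ _ _))//.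
rewrite ger0_norm; last exact: sumr_ge0.
apply: ler_sum => k _; rewrite normrM ler_piMr// normrX exprn_ile1//.
by rewrite ger0_norm.
Qed.

End PolynomialGrowth.

(** * Gaussians against polynomials *)

Section GaussianDecay.
Variable R : realType.

Lemma expRN_decay (l : nat) : exists2 C : R, 0 <= C &
  forall x, 0 <= x -> expR (- x) * (1 + x) ^+ l <= C.
Proof.
(* For [l >= 1], [expR x = expR (x / l) ^+ l >= (1 + x / l) ^+ l], and
   [1 + x <= l + x = l (1 + x / l)]. For [l = 0] the constant is 1. *)
exists (l%:R ^+ l) => [|x x0]; first by rewrite exprn_ge0.
case: l => [|l].
  by rewrite !expr0 mulr1 -expR0 ler_expR oppr_le0.
have l0 : 0 < l.+1%:R :> R by [].
rewrite expRN mulrC ler_pdivrMr ?expR_gt0//.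
have -> : expR x = expR (x / l.+1%:R) ^+ l.+1.
  by rewrite -expRM_natr divfK// gt_eqF.
rewrite -exprMn lerXn2r ?nnegrE ?addr_ge0 ?mulr_ge0 ?expR_ge0//.
apply: (@le_trans _ _ (l.+1%:R * (1 + x / l.+1%:R))).
  rewrite mulrDr mulr1 mulrCA divff ?gt_eqF// mulr1 lerD2r.
  by rewrite ler1n.
by rewrite ler_wpM2l ?expR_ge1Dx// ltW.
Qed.

Lemma phi0_decay p n (l : nat) : exists2 C : R, 0 <= C &
  forall y : 'M[R]_(p.+1, n), phi0 y * (1 + n1 y) ^+ l <= C.
Proof.
have [C C0 h] := expRN_decay l.
(* [d] is one plus the number of entries: [|a| <= 1 + a ^+ 2] in each entry gives
   [1 + n1 y <= d + S]. *)
pose d : R := 1 + \sum_(i < p.+1) \sum_(j < n) 1.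
have d1 : 1 <= d by rewrite lerDl; apply: sumr_ge0 => i _; apply: sumr_ge0.
exists (C * d ^+ l); first by rewrite mulr_ge0// exprn_ge0// (le_trans ler01).
move=> y; pose S := \sum_i \sum_j y i j ^+ 2.
have S0 : 0 <= S by apply: sumr_ge0 => i _; apply: sumr_ge0 => j _; exact: sqr_ge0.
have pi1 : 1 <= pi :> R by rewrite (le_trans _ (pi_ge2 R))// ler1n.
have nS : 1 + n1 y <= d * (1 + pi * S).
  apply: (@le_trans _ _ (d + S)).
    rewrite -addrA lerD2l -big_split; apply: ler_sum => i _ /=.
    rewrite -big_split; apply: ler_sum => j _ /=.
    by rewrite -real_normK ?num_real//; nra.
  by rewrite mulrDr mulr1 lerD2l mulrA ler_peMl//; nra.
have p0 : 0 <= 1 + pi * S by nra.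
have := h (pi * S) (mulr_ge0 (le_trans ler01 pi1) S0).
rewrite -mulNr -/(phi0 y) => {}h.
apply: (@le_trans _ _ (phi0 y * (d * (1 + pi * S)) ^+ l)).
  rewrite ler_wpM2l ?expR_ge0// lerXn2r// ?nnegrE.
    by rewrite addr_ge0// n1_ge0.
  by rewrite mulr_ge0// (le_trans ler01).
by rewrite exprMn mulrCA mulrC ler_wpM2r// exprn_ge0// (le_trans ler01).
Qed.

Lemma ge1_1Dn1 m n (y : 'M[R]_(m, n)) : 1 <= 1 + n1 y.
Proof. by rewrite lerDl n1_ge0. Qed.

Lemma tame_entry m n i j :
  tame (fun y : 'M[R]_(m, n) => 1 + n1 y) (fun y : 'M[R]_(m, n) => y i j).
Proof.
exists 1, 1%N; split => // y; rewrite mul1r expr1 (le_trans (n1_entry y i j))//.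
by rewrite lerDr.
Qed.

End GaussianDecay.

(** * Summability over a lattice coset *)

Lemma ler_sum_subseq (R : realType) (T : eqType) (s t : seq T) (g : T -> R) :
  (forall x, 0 <= g x) -> uniq s -> {subset s <= t} ->
  \sum_(x <- s) g x <= \sum_(x <- t) g x.
Proof.
move=> g0; elim: s t => [|x s IH] t /=.
  by move=> _ _; rewrite big_nil sumr_ge0.
move=> /andP[xs us] st; have xt : x \in t by apply: st; rewrite mem_head.
rewrite big_cons (perm_big _ (perm_to_rem xt)) big_cons lerD2l IH// => z zs.
have : z \in t by apply: st; rewrite inE zs orbT.
rewrite (perm_mem (perm_to_rem xt)) inE => /predU1P[zx|//].
by rewrite -zx zs in xs.
Qed.

Lemma sum_inv_sqr_bounded (R : realType) (K : nat) :
  \sum_(k < K.+1) (1 + (k%:R : R) ^+ 2)^-1 <= 3.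
Proof.
(* The sharper bound telescopes because [1 / (1 + x ^+ 2) <= 2 / (x (x + 1))] for positive [x]; at
   [K = 0] it is an equality. *)
suff: \sum_(k < K.+1) (1 + (k%:R : R) ^+ 2)^-1 <= 3 - 2 / K.+1%:R.
  by move/le_trans; apply; rewrite gerBl divr_ge0.
elim: K => [|K IH].
  by rewrite big_ord_recr big_ord0 /= add0r expr0n addr0 invr1; lra.
rewrite big_ord_recr /= (le_trans (lerD IH (lexx _)))//.
have k0 : 0 <= K%:R :> R by [].
rewrite -[K.+2%:R]natr1 -[K.+1%:R]natr1.
set x : R := K%:R in k0 *.
have a0 : 0 < x + 1 by lra.
have b0 : 0 < x + 1 + 1 by lra.
have c0 : 0 < 1 + (x + 1) ^+ 2 by nra.
rewrite -lerBrDl -subr_ge0.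
have -> : 3 - 2 / (x + 1 + 1) - (3 - 2 / (x + 1)) - (1 + (x + 1) ^+ 2)^-1 =
  ((x + 1) ^+ 2 - (x + 1) + 2) / ((x + 1) * (x + 1 + 1) * (1 + (x + 1) ^+ 2)).
  by field; rewrite !gt_eqF.
by rewrite divr_ge0//; [nra|rewrite !mulr_ge0// ltW].
Qed.

(** A sum of products over the entries factors into one-dimensional sums, each at most 6. *)
Lemma esum_int_matrix (R : realType) (m n : nat) :
  (\esum_(c in [set: 'M[int]_(m, n)])
     ((\prod_i \prod_j (1 + ((c i j)%:~R : R) ^+ 2)^-1)%:E) < +oo)%E.
Proof.
pose a (x : R) : R := (1 + x ^+ 2)^-1.
have a0 x : 0 <= a x by rewrite invr_ge0 addr_ge0// sqr_ge0.
apply: (@le_lt_trans _ _ (((6 : R) ^+ (m * n))%:E)); last exact: ltry.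
apply: ge_ereal_sup => _ [F [finF _] <-]; rewrite fsbig_finite// sumEFin lee_fin.
set s := finmap.enum_fset _.
pose K := (\max_(c <- s) \max_i \max_j `|c i j|)%N.
(* Integers as sign and absolute value. Zero is represented twice, which is harmless for an upper
   bound and explains 6 = 3 + 3. *)
pose J := (bool * 'I_K.+1)%type.
pose ph (z : J) : int := if z.1 then Posz z.2 else - Posz z.2.
pose Ph (f : {ffun 'I_m * 'I_n -> J}) : 'M[int]_(m, n) := \matrix_(i, j) ph (f (i, j)).
pose g (c : 'M[int]_(m, n)) : R := \prod_i \prod_j a (c i j)%:~R.
have g0 c : 0 <= g c by apply: prodr_ge0 => i _; apply: prodr_ge0.
apply: (@le_trans _ _ (\sum_(c <- [seq Ph f | f <- enum {ffun 'I_m * 'I_n -> J}]) g c)).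
  apply: ler_sum_subseq => //; first exact: finmap.fset_uniq.
  move=> c cs; have cK i j : (`|c i j| < K.+1)%N.
    rewrite ltnS (leq_trans _ (leq_bigmax_seq _ cs _))//.
    by rewrite (leq_trans _ (leq_bigmax i))// (leq_trans _ (leq_bigmax j)).
  apply/mapP; exists [ffun ij => (0 <= c ij.1 ij.2, Ordinal (cK ij.1 ij.2))].
    by rewrite mem_enum.
  apply/matrixP => i j; rewrite mxE ffunE /ph /=.
  by case: (c i j) => k //=; rewrite NegzE.
rewrite big_map big_enum /=.
have -> : \sum_(f in {ffun 'I_m * 'I_n -> J}) g (Ph f) =
    \sum_(f : {ffun 'I_m * 'I_n -> J}) \prod_ij a (ph (f ij))%:~R.
  apply: eq_bigr => f _; rewrite /g pair_big; apply: eq_bigr => -[i j] _.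
  by rewrite mxE.
rewrite -(bigA_distr_bigA (fun _ z => a (ph z)%:~R)) /=.
rewrite -[X in _ <= X]/(_ ^+ _) -[(m * n)%N](_ : #|{: 'I_m * 'I_n}| = _); last first.
  by rewrite card_prod !card_ord.
rewrite -prodr_const; apply: ler_prod => _ _.
rewrite sumr_ge0//= -(pair_bigA _ (fun b k => a (ph (b, k))%:~R)) /= big_bool /=.
have := sum_inv_sqr_bounded R K.
rewrite (_ : 6 = 3 + 3); last by ring.
move=> h; apply: lerD; apply: le_trans h; apply: ler_sum => k _;
  by rewrite /a /ph /= ?mulrNz ?sqrrN.
Qed.

(** In lattice coordinates [c], [1 + n1 c] is at most a constant times [1 + n1 X]. One factor
    [(1 + n1 c) ^+ 2] for each of the [m * n] entries dominates [1 + c_ij ^+ 2], whence the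
    exponent. *)
Lemma esum_lattice_coset (R : realType) (m n : nat) (L : set 'cV[rat]_m)
    (h : 'M[rat]_(m, n)) : is_lattice L ->
  (\esum_(X in lattice_coset L h)
     (((1 + n1 (toR X : 'M[R]_(m, n))) ^- (2 * (m * n)))%:E) < +oo)%E.
Proof.
move=> [A Au ->].
pose e (c : 'M[int]_(m, n)) := h + A *m map_mx intr c.
have intr_inj' : injective (intr : int -> rat) by exact: intr_inj.
have be : set_bij [set: 'M[int]_(m, n)]
    (lattice_coset [set A *m map_mx intr c | c in [set: 'cV[int]_m]] h) e.
  split.
  - move=> c _ j /=; exists (col j c) => //.
    rewrite /e addrC addKr; apply/matrixP => i k; rewrite !mxE.
    by apply: eq_bigr => l _; rewrite !mxE.
  - move=> c c' _ _ /addrI /(congr1 (mulmx (invmx A))); rewrite !mulKmx// => /matrixP e'.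
    by apply/matrixP => i j; have := e' i j; rewrite !mxE => /intr_inj'.
  - move=> X hX; have {}hX j := hX j.
    pose c j := s2val (cid2 (hX j)); have hc j := s2valP' (cid2 (hX j)).
    exists (\matrix_(i, j) c j i 0) => //.
    rewrite /e; apply/eqP; rewrite eq_sym addrC -subr_eq; apply/eqP/matrixP => i j.
    have /colP/(_ i) := hc j; rewrite [RHS]mxE => <-; rewrite !mxE.
    by apply: eq_bigr => l _; rewrite !mxE.
rewrite (reindex_esum _ _ _ _ be).
pose Ai : 'M[R]_m := toR (invmx A).
pose K : R := 1 + n1 Ai * (1 + n1 (toR h : 'M[R]_(m, n))).
have K0 : 0 <= K by rewrite !(addr_ge0, mulr_ge0, n1_ge0).
pose wc (c : 'M[int]_(m, n)) : R := \prod_i \prod_j (1 + ((c i j)%:~R : R) ^+ 2)^-1.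
have wc0 c : 0 <= wc c.
  apply: prodr_ge0 => i _; apply: prodr_ge0 => j _.
  by rewrite invr_ge0 addr_ge0// sqr_ge0.
apply: (@le_lt_trans _ _ (\esum_(c in [set: 'M[int]_(m, n)])
    (K ^+ (2 * (m * n)) * wc c)%:E)%E); last first.
  rewrite ge0_esumZl ?exprn_ge0// lte_mul_pinfty ?lee_fin ?exprn_ge0//.
  exact: esum_int_matrix.
apply: le_esum => c _; rewrite lee_fin.
set X := e c; pose cR : 'M[R]_(m, n) := map_mx intr c.
have cRE : cR = Ai *m (toR X - toR h).
  rewrite /Ai -[toR X - _](map_mxB (@ratr R)) -[_ *m _](map_mxM (@ratr R)).
  rewrite /X /e addrC addKr mulKmx//; apply/matrixP => i j.
  rewrite /cR !mxE; symmetry; exact: ratr_int.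
have le1 : 1 + n1 cR <= K * (1 + n1 (toR X : 'M[R]_(m, n))).
  have h1 : n1 cR <= n1 Ai * (n1 (toR X : 'M[R]_(m, n)) + n1 (toR h : 'M[R]_(m, n))).
    rewrite cRE (le_trans (n1_mul _ _))// ler_wpM2l ?n1_ge0//.
    by rewrite (le_trans (n1D _ _))// -scaleN1r n1Z normrN1 mul1r.
  move: h1 (n1_ge0 Ai) (n1_ge0 (toR X : 'M[R]_(m, n))) (n1_ge0 (toR h : 'M[R]_(m, n))).
  rewrite /K; move: (n1 cR) (n1 Ai) (n1 (toR X)) (n1 (toR h)) => x y z t h1 y0 z0 t0.
  by have := mulr_ge0 (mulr_ge0 y0 t0) z0; lra.
have p1 : 0 < 1 + n1 (toR X : 'M[R]_(m, n)) by rewrite ltr_pwDl// n1_ge0.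
rewrite -[leLHS]mul1r ler_pdivrMr ?exprn_gt0// mulrAC -exprMn.
apply: (@le_trans _ _ ((1 + n1 cR) ^+ (2 * (m * n)) * wc c)); last first.
  rewrite ler_wpM2r// lerXn2r// nnegrE ?addr_ge0 ?n1_ge0//.
  by rewrite mulr_ge0// ltW.
have -> : (1 + n1 cR) ^+ (2 * (m * n)) = \prod_(i < m) \prod_(j < n) (1 + n1 cR) ^+ 2.
  by rewrite !prodr_const !card_ord -!exprM; congr (_ ^+ _); nia.
have ge1M (x y : R) : 1 <= x -> 1 <= y -> 1 <= x * y by exact: mulr_ege1.
rewrite /wc -big_split /=; apply: (big_ind (fun x : R => 1 <= x)) => // i _.
rewrite -big_split /=; apply: (big_ind (fun x : R => 1 <= x)) => // j _.
have q0 : 0 < 1 + ((c i j)%:~R : R) ^+ 2 by rewrite ltr_pwDl// sqr_ge0.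
rewrite ler_pdivlMr// mul1r.
have := n1_entry cR i j; rewrite mxE => le2.
by rewrite -[X in _ + X <= _]real_normK ?num_real//; have := normr_ge0 ((c i j)%:~R : R); nra.
Qed.

(** * Sums of derivatives over a periodic family *)

Section Taylor.
Variable R : realType.

(** The remainder of [h 0] vanishes at 0 and its derivative is the remainder of [h 1] of one order
    less, so the mean value theorem drives an induction. *)
Lemma taylor_bound (N : nat) (h : nat -> R -> R) (M d : R) :
  (forall k (x : R), is_derive x 1 (h k) (h k.+1 x)) ->
  (forall x, 0 <= x <= d -> `|h N x| <= M) ->
  forall x, 0 <= x <= d ->
  `|h 0%N x - (\poly_(k < N) (h k 0 / k`!%:R)).[x]| <= x ^+ N * M.
Proof.
elim: N h => [|N IH] h hd hM x /andP[x0 xd].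
  rewrite expr0 mul1r poly_def big_ord0 horner0 subr0; apply: hM.
  by rewrite x0.
have {}IH := IH (fun k => h k.+1) (fun k => hd k.+1) hM.
set T := \poly_(k < N.+1) _.
have T' : T^`() = \poly_(k < N) (h k.+1 0 / k`!%:R).
  apply/polyP => k; rewrite coef_deriv !coef_poly ltnS.
  case: ltnP => _; last by rewrite mul0rn.
  rewrite -[LHS]mulr_natr factS natrM invfM -!mulrA; congr (_ * _).
  by rewrite mulrCA mulVf ?mulr1// pnatr_eq0.
pose g y := h 0%N y - T.[y].
pose dg y := h 1%N y - T^`().[y].
have gd (y : R) : is_derive y 1 g (dg y) by apply: is_deriveB.
have gc : continuous g.
  by move=> y; apply/differentiable_continuous/derivable1_diffP; apply: ex_derive.
have g0 : g 0 = 0.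
  by rewrite /g horner_coef0 coef_poly /= fact0 divr1 subrr.
have [c cx] := MVT_segment x0 (fun y _ => gd y) (continuous_subspaceT gc).
rewrite g0 !subr0 -[h 0%N x - _]/(g x) => ->.
have /andP[c0 cx'] : 0 <= c <= x by move: cx; rewrite in_itv.
rewrite normrM (ger0_norm x0) mulrC exprS -mulrA ler_wpM2l//.
apply: (@le_trans _ _ (c ^+ N * M)).
  by rewrite /dg T'; apply: IH; rewrite c0 (le_trans cx').
rewrite ler_wpM2r ?lerXn2r ?nnegrE//.
by apply: le_trans (hM c _); rewrite ?normr_ge0 ?c0 ?(le_trans cx').
Qed.

(** Descending induction from [tau N]: relation [j - 1] has leading term [d * tau j], and its later
    terms, already bounded, all carry the same power of [d]. Each division by [d] costs at most a
    factor [N + 1]. Nothing is claimed about [tau 0], which occurs in no relation. *)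
Lemma triangular_bound (N : nat) (A d : R) (tau : nat -> R) :
  0 < d -> 0 <= A -> `|tau N| <= A ->
  (forall i, (i < N)%N ->
    `|\sum_(1 <= k < N - i) d ^+ k / k`!%:R * tau (i + k)%N| <= A * d ^+ (N - i)) ->
  forall m j, (0 < j)%N -> (j + m = N)%N ->
  `|tau j| <= N.+1%:R ^+ m * (A * d ^+ m).
Proof.
move=> d0 A0 hN h; elim/ltn_ind => m IH j j0 jm.
case: m => [|m] in IH jm *.
  by rewrite !expr0 mul1r mulr1; rewrite addn0 in jm; rewrite jm.
case: j j0 jm => // i _ im.
have iN : (i < N)%N by lia.
have Ni : (N - i = m.+2)%N by lia.
have := h i iN; rewrite Ni big_ltn// expr1 divr1 addn1.
set S := \sum_(2 <= k < m.+2) _.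
have hS : `|S| <= \sum_(2 <= k < m.+2) N.+1%:R ^+ m * (A * d ^+ m.+2).
  rewrite (le_trans (ler_norm_sum _ _ _))//= big_nat_cond [leRHS]big_nat_cond.
  apply: ler_sum => k /andP[/andP[k2 km] _].
  have fk : 0 < (k`!%:R : R) by rewrite ltr0n fact_gt0.
  have k1 : (k`!%:R : R)^-1 <= 1 by rewrite invf_le1// ler1n fact_gt0.
  rewrite !normrM normfV (gtr0_norm fk) (gtr0_norm (exprn_gt0 k d0)).
  have mk : (m.+2 - k < m.+1)%N by lia.
  have ik : (0 < i + k)%N by lia.
  have ikN : (i + k + (m.+2 - k) = N)%N by lia.
  have := IH _ mk _ ik ikN => h1.
  apply: (@le_trans _ _ (d ^+ k * `|tau (i + k)%N|)).
    by rewrite ler_wpM2r// ler_piMr// exprn_ge0// ltW.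
  apply: (@le_trans _ _ (d ^+ k * (N.+1%:R ^+ (m.+2 - k) * (A * d ^+ (m.+2 - k))))).
    by rewrite ler_wpM2l// exprn_ge0// ltW.
  rewrite mulrCA [d ^+ k * _]mulrCA -exprD subnKC; last by lia.
  apply: ler_wpM2r; first by rewrite mulr_ge0// exprn_ge0// ltW.
  apply: ler_weXn2l; [by rewrite ler1n|lia].
rewrite sumr_const_nat subn2 /= in hS.
move=> hT.
have : d * `|tau i.+1| <= (A * d ^+ m.+2) * (1 + N.+1%:R ^+ m *+ m).
  rewrite -[d in leLHS](gtr0_norm d0) -normrM.
  have -> : d * tau i.+1 = (d * tau i.+1 + S) - S by rewrite addrK.
  rewrite (le_trans (ler_normB _ _))// mulrDr mulr1 lerD//.
  by rewrite (le_trans hS)// mulrnAr [X in _ <= X *+ _]mulrC.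
rewrite exprS mulrCA -[leRHS]mulrA ler_pM2l// => /le_trans; apply.
rewrite mulrC ler_wpM2r ?mulr_ge0 ?exprn_ge0 ?(ltW d0)//.
apply: (@le_trans _ _ (N.+1%:R ^+ m *+ m.+1)).
  by rewrite [leRHS]mulrS lerD2r exprn_ege1// ler1n.
rewrite exprS -mulr_natl ler_wpM2r ?exprn_ge0// ler_nat; lia.
Qed.

End Taylor.

(** * A polynomial times a Gaussian along a line *)

Section GaussianLine.
Variables (R : realType) (p n : nat) (Dm : 'M[R]_(p.+1, n)).
Variables (F G : 'M[R]_(p.+1, n) -> R).
Hypothesis F_shift : forall y (x : R), F (y + x *: Dm) = F y + x * G y.
Hypothesis G_shift : forall y (x : R), G (y + x *: Dm) = G y.
Let s (y : 'M[R]_(p.+1, n)) : R := 1 + n1 y.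
Hypothesis F_tame : tame s F.
Hypothesis G_tame : tame s G.

Let s_ge1 y : 1 <= s y. Proof. exact: ge1_1Dn1. Qed.

Definition gauss_exponent (y : 'M[R]_(p.+1, n)) : {poly R} :=
  (- pi) *: \sum_i \sum_j ((y i j)%:P + Dm i j *: 'X) ^+ 2.

(** [(P exp(e))' = (P' + P e') exp(e)]. Keeping the coefficient as a polynomial makes all
    derivatives explicit and their growth readable from the recursion. *)
Fixpoint gauss_coef (k : nat) (y : 'M[R]_(p.+1, n)) : {poly R} :=
  if k is k'.+1 then
    (gauss_coef k' y)^`() + gauss_coef k' y * (gauss_exponent y)^`()
  else (F y)%:P + G y *: 'X.

(* The k-th derivative of x |-> (F * phi0) (y + x Dm). *)
Definition gauss_deriv (k : nat) (y : 'M[R]_(p.+1, n)) (x : R) : R :=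
  (gauss_coef k y).[x] * expR (gauss_exponent y).[x].

Lemma gauss_exponentE y x :
  expR (gauss_exponent y).[x] = phi0 (y + x *: Dm).
Proof.
rewrite /phi0 /gauss_exponent hornerZ horner_sum; congr (expR (_ * _)).
apply: eq_bigr => i _; rewrite horner_sum; apply: eq_bigr => j _.
by rewrite horner_exp hornerD hornerC hornerZ hornerX !mxE mulrC.
Qed.

Lemma gauss_exponent_shift y x :
  gauss_exponent (y + x *: Dm) = gauss_exponent y \Po ('X + x%:P).
Proof.
rewrite /gauss_exponent comp_polyZ rmorph_sum; congr (_ *: _).
apply: eq_bigr => i _; rewrite rmorph_sum; apply: eq_bigr => j _.
rewrite rmorphXn /= comp_polyD comp_polyC comp_polyZ comp_polyX !mxE.
congr (_ ^+ 2); rewrite polyCD scalerDr [x * _]mulrC polyCM mul_polyC.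
by rewrite -!addrA; congr (_ + _); rewrite addrC.
Qed.

Lemma deriv_comp_XaddC (P : {poly R}) (x : R) :
  (P \Po ('X + x%:P))^`() = P^`() \Po ('X + x%:P).
Proof. by rewrite deriv_comp derivD derivX derivC addr0 mulr1. Qed.

Lemma gauss_coef_shift k y x :
  gauss_coef k (y + x *: Dm) = gauss_coef k y \Po ('X + x%:P).
Proof.
elim: k => [|k IH] /=.
  rewrite F_shift G_shift comp_polyD comp_polyC comp_polyZ comp_polyX.
  rewrite polyCD scalerDr [x * _]mulrC polyCM mul_polyC -!addrA.
  by congr (_ + _); rewrite addrC.
rewrite IH gauss_exponent_shift !deriv_comp_XaddC.
by rewrite -rmorphM /= -comp_polyD.
Qed.

(** Turns a translation of the coset, which moves [y] along [Dm], into evaluation of the same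
    one-variable function at another point. *)
Lemma gauss_deriv_shift k y x x' :
  gauss_deriv k (y + x *: Dm) x' = gauss_deriv k y (x' + x).
Proof.
rewrite /gauss_deriv gauss_coef_shift gauss_exponent_shift !horner_comp.
by rewrite !hornerE.
Qed.

Lemma is_derive_gauss k y (x : R) :
  is_derive x 1 (gauss_deriv k y) (gauss_deriv k.+1 y x).
Proof.
have d1 : is_derive x 1 (expR \o horner (gauss_exponent y))
   (expR (gauss_exponent y).[x] * (gauss_exponent y)^`().[x]).
  by apply: is_derive1_comp.
apply: (@is_derive_eq _ _ _ _ _ _ _ _ (is_deriveM (is_derive_poly (gauss_coef k y) x) d1)).
rewrite /gauss_deriv /= hornerD hornerM /= /GRing.scale /=; ring.
Qed.

Lemma gauss_exponent_deriv y : (gauss_exponent y)^`() =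
  (- 2 * pi * \sum_i \sum_j y i j * Dm i j)%:P +
  (- 2 * pi * \sum_i \sum_j Dm i j ^+ 2) *: 'X.
Proof.
rewrite /gauss_exponent derivZ raddf_sum /=.
have -> : \sum_i (\sum_j ((y i j)%:P + Dm i j *: 'X) ^+ 2)^`() =
  \sum_i \sum_j ((2 * (y i j * Dm i j))%:P + (2 * Dm i j ^+ 2) *: 'X).
  apply: eq_bigr => i _; rewrite raddf_sum; apply: eq_bigr => j _ /=.
  rewrite expr2 derivM derivD derivC derivZ derivX add0r -!mul_polyC.
  rewrite !polyCM polyC_natr.
  by ring.
have -> : \sum_i \sum_j ((2 * (y i j * Dm i j))%:P + (2 * Dm i j ^+ 2) *: 'X) =
   (2 * \sum_i \sum_j y i j * Dm i j)%:P + (2 * \sum_i \sum_j Dm i j ^+ 2) *: 'X.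
  rewrite !mulr_sumr rmorph_sum scaler_suml -big_split; apply: eq_bigr => i _ /=.
  by rewrite !mulr_sumr rmorph_sum scaler_suml -big_split.
rewrite scalerDr scalerA -mul_polyC -polyCM.
by congr (_%:P + _ *: _); ring.
Qed.

Lemma gauss_deriv1_0 y :
  gauss_deriv 1 y 0 =
  (G y - 2 * pi * F y * \sum_i \sum_j y i j * Dm i j) * phi0 y.
Proof.
rewrite /gauss_deriv gauss_exponentE scale0r addr0; congr (_ * _).
rewrite /= hornerD hornerM gauss_exponent_deriv derivD derivC derivZ derivX.
by rewrite !(hornerD, hornerC, hornerZ, hornerX, horner0) /=; ring.
Qed.

Lemma tamep_exponent_deriv : tamep s (fun y => (gauss_exponent y)^`()).
Proof.
under [X in tamep _ X]funext => y do rewrite gauss_exponent_deriv.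
apply: tamep_linear => //; last exact: tame_cst.
apply: tameM; first exact: tame_cst.
apply: tame_sum => // i; apply: tame_sum => // j.
by apply: tameM; [exact: tame_entry|exact: tame_cst].
Qed.

Lemma tamep_gauss_coef k : tamep s (gauss_coef k).
Proof.
elim: k => [|k IH]; first exact: tamep_linear.
apply: tamepD => //; first exact: tamep_deriv.
by apply: tamepM => //; exact: tamep_exponent_deriv.
Qed.

Lemma gauss_deriv_decay k l : exists2 C : R, 0 <= C &
  forall y x, 0 <= x <= 1 -> `|gauss_deriv k y x| <= C * s y ^- l.
Proof.
have [C [K [C0 hC]]] := tamep_horner s_ge1 (tamep_gauss_coef k).
have [C' C'0 hC'] := phi0_decay R p n (K + l).
pose d : R := 1 + n1 Dm.
have d0 : 0 <= d by rewrite addr_ge0// n1_ge0.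
exists (C * (C' * d ^+ (K + l))); first by rewrite !mulr_ge0// exprn_ge0.
move=> y x /andP[x0 x1]; have s0 : 0 < s y by exact: lt_le_trans (s_ge1 y).
(* For [x] in [[0, 1]] the points [y] and [y + x Dm] have comparable size, so the Gaussian at the
   second controls powers of [s y]. *)
have sy : s y <= d * (1 + n1 (y + x *: Dm)).
  have : n1 y <= n1 (y + x *: Dm) + n1 Dm.
    have {1}-> : y = (y + x *: Dm) + (- x) *: Dm by rewrite scaleNr addrK.
    by rewrite (le_trans (n1D _ _))// lerD2l n1Z normrN ger0_norm// ler_piMl// n1_ge0.
  rewrite /s /d; move: (n1_ge0 Dm) (n1_ge0 (y + x *: Dm)).
  by move: (n1 y) (n1 Dm) (n1 _) => a b c; nra.
rewrite /gauss_deriv normrM gauss_exponentE (ger0_norm (expR_ge0 _)).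
rewrite -[leLHS]mul1r ler_pdivlMr ?exprn_gt0// mul1r.
apply: (@le_trans _ _ (C * s y ^+ K * phi0 (y + x *: Dm) * s y ^+ l)).
  rewrite ler_wpM2r ?exprn_ge0 ?(ltW s0)// ler_wpM2r ?expR_ge0//.
  by apply: hC; rewrite x0.
rewrite -!mulrA ler_wpM2l// mulrCA -exprD.
apply: (@le_trans _ _ (phi0 (y + x *: Dm) * (d * (1 + n1 (y + x *: Dm))) ^+ (K + l))).
  rewrite ler_wpM2l ?expR_ge0// lerXn2r// nnegrE ?(ltW s0)//.
  by rewrite mulr_ge0// addr_ge0// n1_ge0.
rewrite exprMn mulrCA mulrC ler_wpM2r ?exprn_ge0//.
Qed.

Variables (T : choiceType) (D : set T) (w : T -> R).
Hypothesis w_ge0 : forall x, 0 <= w x.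
Hypothesis w_sum : (\esum_(x in D) (w x)%:E < +oo)%E.

(* Translation by S moves y by Dm / t, so summing the Taylor expansions of the
   k-th derivatives with step 1 / t gives a triangular system which forces the
   sum of the first derivatives to be smaller than any power of 1 / t. *)
Lemma periodic_sum_decay (N l : nat) (Cw : R) : 0 <= Cw -> exists2 C : R, 0 <= C &
  forall (t : R) (y : T -> 'M[R]_(p.+1, n)) (S : T -> T) (kap : T -> R),
    1 <= t -> set_bij D D S ->
    (forall X, D X -> s (y X) ^- l <= Cw * t ^+ l * w X) ->
    (forall X, D X -> y (S X) = y X + t^-1 *: Dm) ->
    (forall X, D X -> `|kap X| <= 1) ->
    (forall X, D X -> kap (S X) = kap X) ->
    `|rsum D (fun X => kap X * gauss_deriv 1 (y X) 0)| <= C * t ^- N.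
Proof.
(* The triangular system gains [d ^+ (M - 1)], that is [t ^- (N + l)], on [tau 1]; the surplus [l]
   pays for the factor [t ^+ l] in the bound [B]. *)
move=> Cw0; pose M := (N + l).+1.
have [C C0 hC] : exists2 C : R, 0 <= C & forall k y x, (k <= M)%N -> 0 <= x <= 1 ->
    `|gauss_deriv k y x| <= C * s y ^- l.
  elim: M => [|M [C C0 IH]].
    have [C C0 h] := gauss_deriv_decay 0 l; exists C => // k y x; rewrite leqn0 => /eqP ->.
    exact: h.
  have [C' C'0 h] := gauss_deriv_decay M.+1 l; exists (C + C').
    exact: addr_ge0.
  move=> k y x; rewrite leq_eqVlt ltnS => /predU1P[->|kM] x1; rewrite mulrDl.
    by rewrite (le_trans (h _ _ x1))// lerDr mulr_ge0// invr_ge0 exprn_ge0// (le_trans ler01).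
  by rewrite (le_trans (IH _ _ _ kM x1))// lerDl mulr_ge0// invr_ge0 exprn_ge0// (le_trans ler01).
have W0 : 0 <= nnsum D w.
  by rewrite fine_ge0// esum_ge0// => x _; rewrite lee_fin.
exists (M.+1%:R ^+ (N + l) * (C * Cw * nnsum D w)).
  by rewrite !mulr_ge0// exprn_ge0.
move=> t y S kap t1 bS hw yS k1 kS.
have t0 : 0 < t by exact: lt_le_trans t1.
pose d := t^-1; have d0 : 0 < d by rewrite invr_gt0.
have d1 : d <= 1 by rewrite invf_le1.
pose B := C * (Cw * t ^+ l).
have B0 : 0 <= B by rewrite !mulr_ge0// exprn_ge0// ltW.
have dom k x : (k <= M)%N -> 0 <= x <= 1 ->
    dominated D w (fun X => kap X * gauss_deriv k (y X) x) B.
  move=> kM x1 X DX; rewrite normrM -[leRHS]mul1r ler_pM//; first exact: k1.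
  rewrite (le_trans (hC _ _ _ kM x1))// /B -mulrA ler_wpM2l//; exact: hw.
have I0 : 0 <= (0 : R) <= 1 by rewrite lexx ler01.
have Id : 0 <= d <= 1 by rewrite (ltW d0).
pose tau k := rsum D (fun X => kap X * gauss_deriv k (y X) 0).
pose A := B * nnsum D w.
have A0 : 0 <= A by exact: mulr_ge0.
(* Here periodicity enters: reindexing by [S] moves every [y X] by [d Dm], so the sum at 0 equals
   the sum at [d]. *)
have tauS i : tau i = rsum D (fun X => kap X * gauss_deriv i (y X) d).
  rewrite /tau -(rsum_reindex _ bS); apply: eq_rsum => X DX.
  by rewrite kS// yS// gauss_deriv_shift add0r.
have tN : `|tau M| <= A by apply: (rsum_dom w_ge0 w_sum B0); exact: dom.
have rel i : (i < M)%N ->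
   `|\sum_(1 <= k < M - i) d ^+ k / k`!%:R * tau (i + k)%N| <= A * d ^+ (M - i).
  move=> iM.
  have Mi : (0 < M - i)%N by rewrite subn_gt0.
  (* Taylor remainder of the [i]-th derivative at step [d]. After summation its [k = 0] term cancels
     against the value at [d] by [tauS], which leaves the required relation up to sign. *)
  pose Rm X := kap X * (gauss_deriv i (y X) d -
    \sum_(k < M - i) d ^+ k / k`!%:R * gauss_deriv (i + k) (y X) 0).
  have domR : dominated D w Rm (B * d ^+ (M - i)).
    move=> X DX; rewrite normrM -[leRHS]mul1r ler_pM//; first exact: k1.
    have := @taylor_bound R (M - i) (fun k => gauss_deriv (i + k) (y X))
       (C * s (y X) ^- l) 1 _ _ d Id.
    have -> : (\poly_(k < M - i) (gauss_deriv (i + k) (y X) 0 / k`!%:R)).[d] =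
      \sum_(k < M - i) d ^+ k / k`!%:R * gauss_deriv (i + k) (y X) 0.
      rewrite poly_def horner_sum; apply: eq_bigr => k _.
      by rewrite hornerZ hornerXn; ring.
    rewrite addn0 => h; apply: le_trans (h _ _) _.
    - by move=> k x; rewrite addnS; exact: is_derive_gauss.
    - by move=> x x1; apply: hC => //; rewrite subnKC// ltnW.
    rewrite [leRHS]mulrAC [leRHS]mulrC ler_wpM2l ?exprn_ge0 ?(ltW d0)//.
    by rewrite /B -mulrA ler_wpM2l//; exact: hw.
  have Bd0 : 0 <= B * d ^+ (M - i) by rewrite mulr_ge0// exprn_ge0// ltW.
  have := rsum_dom w_ge0 w_sum Bd0 domR; rewrite mulrAC; apply: le_trans.
  rewrite -normrN le_eqVlt; apply/orP; left; apply/eqP; congr `|_|.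
  have domk k : (k <= M)%N -> dominated D w (fun X => kap X * gauss_deriv k (y X) 0) B.
    by move=> kM; exact: dom.
  pose cf k : R := - (d ^+ k / k`!%:R).
  have cf1 k : `|cf k| <= 1.
    rewrite normrN ger0_norm ?divr_ge0 ?exprn_ge0 ?(ltW d0)//.
    rewrite ler_pdivrMr ?ltr0n ?fact_gt0// mul1r.
    apply: (@le_trans _ _ (1 : R)); first by rewrite exprn_ile1// ltW.
    by rewrite ler1n fact_gt0.
  have ikM (k : 'I_(M - i)) : (i + k <= M)%N.
    by rewrite -[leqRHS](subnKC (ltnW iM)) leq_add2l ltnW.
  have domc (k : 'I_(M - i)) :
     dominated D w (fun X => cf k * (kap X * gauss_deriv (i + k) (y X) 0)) B.
    move=> X DX; rewrite normrM -[leRHS]mul1r ler_pM//.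
    exact: domk.
  have -> : rsum D Rm = tau i + \sum_(k < M - i) cf k * tau (i + k)%N.
    have -> : \sum_(k < M - i) cf k * tau (i + k)%N =
       \sum_(k < M - i) rsum D (fun X => cf k * (kap X * gauss_deriv (i + k) (y X) 0)).
      apply: eq_bigr => k _; rewrite (rsumZ w_ge0 w_sum _ B0)//.
      exact: domk.
    rewrite tauS -(rsum_sum w_ge0 w_sum _ B0 domc).
    have [K K0 dK] : exists2 K, 0 <= K & dominated D w
       (fun X => \sum_(k < M - i) cf k * (kap X * gauss_deriv (i + k) (y X) 0)) K.
      exists (\sum_(k < M - i) B); first exact: sumr_ge0.
      move=> X DX; rewrite (le_trans (ler_norm_sum _ _ _))// mulr_suml.
      by apply: ler_sum => k _; exact: domc.
    rewrite -(@rsumD _ _ _ _ w_ge0 w_sum _ _ (B + K)).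
    - apply: eq_rsum => X DX; rewrite /Rm mulrBr; congr (_ + _).
      rewrite mulr_sumr -sumrN; apply: eq_bigr => k _; rewrite /cf; ring.
    - exact: addr_ge0.
    - by move=> X DX; rewrite (le_trans (dom i d (ltnW iM) Id X DX))// ler_wpM2r// lerDl.
    - by move=> X DX; rewrite (le_trans (dK X DX))// ler_wpM2r// lerDr.
  rewrite -(big_mkord xpredT (fun k => cf k * tau (i + k)%N)) [X in tau i + X]big_ltn//.
  rewrite /cf expr0 fact0 divr1 addn0 mulN1r addrA subrr add0r -sumrN.
  by apply: eq_bigr => k _; rewrite mulNr.
have := @triangular_bound R M A d tau d0 A0 tN rel (N + l) 1 isT (add1n _).
move/le_trans; apply; rewrite -!mulrA ler_wpM2l ?exprn_ge0//.
rewrite ler_wpM2l// ler_wpM2l// mulrCA ler_wpM2l// /d exprVn exprD invfM.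
by rewrite mulrCA divff ?mulr1// expf_neq0// gt_eqF.
Qed.

End GaussianLine.

(** * The Cauchy-Binet formula *)

Section CauchyBinet.
Variables (R : comNzRingType) (p k : nat).
Implicit Types (A B : 'M[R]_(p, k)) (f : {ffun 'I_k -> 'I_p}).

Definition rowsel A f : 'M[R]_k := \matrix_(a, b) A (f a) b.

Lemma det_mul_rowsel A B : \det (A^T *m B) =
  \sum_(f : {ffun 'I_k -> 'I_p}) (\prod_a A (f a) a) * \det (rowsel B f).
Proof.
transitivity (\sum_(s : 'S_k) (-1) ^+ s *
    \sum_(f : {ffun 'I_k -> 'I_p}) \prod_a (A (f a) a * B (f a) (s a))).
  apply: eq_bigr => s _; congr (_ * _).
  rewrite -(bigA_distr_bigA (fun a i => A i a * B i (s a))) /=.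
  by apply: eq_bigr => a _; rewrite mxE; apply: eq_bigr => i _; rewrite mxE.
under eq_bigr do rewrite mulr_sumr.
rewrite exchange_big /=; apply: eq_bigr => f _.
rewrite /determinant mulr_sumr; apply: eq_bigr => s _.
rewrite big_split /= mulrCA; congr (_ * (_ * _)).
by apply: eq_bigr => a _; rewrite mxE.
Qed.

Lemma det_rowsel_eq0 A f : ~~ injectiveb f -> \det (rowsel A f) = 0.
Proof.
move=> /injectivePn [a [b ab fab]]; apply: (determinant_alternate ab) => j.
by rewrite !mxE fab.
Qed.

Definition permuted (q : {ffun 'I_k -> 'I_p} * 'S_k) : {ffun 'I_k -> 'I_p} :=
  [ffun a => q.1 (q.2 a)].

Lemma det_rowsel_permuted A q :
  \det (rowsel A (permuted q)) = (-1) ^+ q.2 * \det (rowsel A q.1).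
Proof.
rewrite -det_perm -det_mulmx -row_permE; congr (\det _).
by apply/matrixP => a b; rewrite !mxE ffunE.
Qed.

Definition ffrank f (a : 'I_k) : nat := #|[pred b : 'I_k | (f b < f a)%N]|.

(** Inverse of [permuted]: an injective [f] is an increasing function composed with the permutation
    that sends each index to its rank [ffrank]. A non-injective [f] drops out of the sum, since
    [rowsel] then has two equal rows. *)
Definition sorted_part f : {ffun 'I_k -> 'I_p} * 'S_k :=
  let s := odflt 1%g [pick s : 'S_k | [forall a, s a == ffrank f a :> nat]] in
  ([ffun c => f ((s^-1)%g c)], s).

Lemma ffrank_ltn f a b : (f a < f b)%N -> (ffrank f a < ffrank f b)%N.
Proof.
move=> ab; apply: proper_card; apply/properP; split.
  by apply/fintype.subsetP => c; rewrite !inE => /ltn_trans; apply.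
by exists a; rewrite !inE ?ltnn.
Qed.

Lemma sorted_partP f : injective f -> forall a, (sorted_part f).2 a = ffrank f a :> nat.
Proof.
move=> fi; rewrite /sorted_part /=; case: pickP => [s /forallP h a|/= nh].
  exact/eqP/h.
have rk a : (ffrank f a < k)%N.
  rewrite -[leqRHS]card_ord; apply: proper_card; apply/properP.
  by split; [exact/fintype.subsetP|exists a; rewrite !inE ?ltnn].
have ri : injective (fun a => Ordinal (rk a)).
  move=> a b /(congr1 val) /= e; apply: fi; apply: val_inj.
  by case: (ltngtP (f a) (f b)) => // /ffrank_ltn; rewrite e ltnn.
have /forallP[] := negbT (nh (perm ri)) => a.
by rewrite permE.
Qed.

Lemma permutedK f : injective f -> permuted (sorted_part f) = f.
Proof. by move=> fi; apply/ffunP => a; rewrite !ffunE permK. Qed.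

Lemma increasing_ltn f a b : increasing f -> (f a < f b)%N = (a < b)%N.
Proof.
move=> /forallP h.
have h' (c d : 'I_k) : (c < d)%N -> (f c < f d)%N by move: (forallP (h c) d) => /implyP.
apply/idP/idP; last exact: h'.
case: (ltngtP a b) => // [/h'|/val_inj ->]; last by rewrite ltnn.
by move=> /ltnW; rewrite leqNgt => /negbTE ->.
Qed.

Lemma increasing_inj f : increasing f -> injective f.
Proof.
move=> fi a b e; apply: val_inj; have := increasing_ltn a b fi.
have := increasing_ltn b a fi; rewrite e ltnn => /esym h1 /esym h2.
by case: ltngtP h1 h2.
Qed.

Lemma sorted_part_increasing f : injective f -> increasing (sorted_part f).1.
Proof.
move=> fi; apply/forallP => c; apply/forallP => d; apply/implyP => cd.
have hs := sorted_partP fi; move: hs; rewrite /sorted_part /=.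
set s := odflt _ _ => hs; rewrite !ffunE ltnNge; apply/negP => h.
have: (ffrank f (s^-1%g d) <= ffrank f (s^-1%g c))%N.
  apply: subset_leq_card; apply/fintype.subsetP => e; rewrite !inE => /leq_trans; exact.
by rewrite -!hs !permKV leqNgt cd.
Qed.

Lemma sorted_part_permuted q : increasing q.1 -> sorted_part (permuted q) = q.
Proof.
move=> qi; have pi : injective (permuted q).
  by move=> a b; rewrite !ffunE => /(increasing_inj qi) /perm_inj.
have e2 : (sorted_part (permuted q)).2 = q.2.
  apply/permP => a; apply: val_inj; rewrite /= sorted_partP// /ffrank.
  have ak : (q.2 a <= k)%N by exact: ltnW.
  rewrite -[RHS](card_ord (q.2 a)).
  have wi : injective (fun c => (q.2^-1)%g (widen_ord ak c)).
    by move=> c d /perm_inj /(congr1 val) /= /val_inj.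
  rewrite -(card_codom wi); apply: eq_card => b; rewrite !inE !ffunE increasing_ltn//.
  apply/idP/codomP => [h|[d ->]]; last by rewrite permKV /= ltn_ord.
  by exists (Ordinal h); apply: (@perm_inj _ q.2); rewrite permKV; apply: val_inj.
rewrite [LHS]surjective_pairing [RHS]surjective_pairing e2; congr (_, _).
apply/ffunP => c; move: e2; rewrite /sorted_part /=; set s := odflt _ _ => e2.
by rewrite !ffunE e2 permKV.
Qed.

(** Grouping the injective row choices by their increasing rearrangement only produces signs, and
    the sum over permutations rebuilds [\det (rowsel A f)]. *)
Lemma Cauchy_Binet A B : \det (A^T *m B) =
  \sum_(f | increasing f) \det (rowsel A f) * \det (rowsel B f).
Proof.
rewrite det_mul_rowsel (bigID (fun f => injectiveb f)) /= [X in _ + X]big1 ?addr0;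
  last by move=> f nf; rewrite det_rowsel_eq0// mulr0.
rewrite (reindex_onto permuted sorted_part) /=; last first.
  by move=> f /injectiveP; exact: permutedK.
have cond q : injectiveb (permuted q) && (sorted_part (permuted q) == q) = increasing q.1.
  apply/andP/idP => [[/injectiveP pi /eqP <-]|qi]; first exact: sorted_part_increasing.
  rewrite sorted_part_permuted//; split => //; apply/injectiveP => a b.
  by rewrite !ffunE => /(increasing_inj qi) /perm_inj.
rewrite (eq_bigl (fun q => increasing q.1 && true)); last by move=> q; rewrite cond andbT.
pose F f s := (\prod_a A (permuted (f, s) a) a) * \det (rowsel B (permuted (f, s))).
rewrite (eq_bigr (fun q => F q.1 q.2)); last by case.
rewrite -(pair_big_dep (fun f => increasing f) (fun _ _ => true)) /=.
apply: eq_bigr => f _; rewrite -[X in X * _]det_tr mulr_suml.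
apply: eq_bigr => s _; rewrite /F det_rowsel_permuted /= mulrCA mulrA; congr (_ * _ * _).
by apply: eq_bigr => a _; rewrite !mxE ffunE.
Qed.

End CauchyBinet.

(** * Determinants under a rank one perturbation *)

Section RankOne.
Variable R : comNzRingType.

(** This is minus [kap *m \adj N *m eta], so [det_rank1] is the matrix determinant lemma. The
    bordered form, unlike the adjugate, shows the alternation between [eta] and the columns of
    [N]. *)
Definition bord_det {n : nat} (kap : 'rV[R]_n) (eta : 'cV[R]_n) (N : 'M[R]_n) : R :=
  \det (block_mx (0 : 'M[R]_1) kap eta N).

Lemma det_rank1 n (N : 'M[R]_n) (eta : 'cV[R]_n) (kap : 'rV[R]_n) (x : R) :
  \det (N + x *: (eta *m kap)) = \det N - x * bord_det kap eta N.
Proof.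
have h1 : \det (block_mx (1%:M : 'M[R]_1) (- x *: kap) eta N) =
    \det (N + x *: (eta *m kap)).
  have h0 : \det (block_mx (1%:M : 'M[R]_1) (x *: kap) 0 (1%:M : 'M[R]_n)) = 1.
    by rewrite det_ublock !det1 mulr1.
  rewrite -[LHS]mulr1 -[X in _ * X = _]h0 -det_mulmx.
  have -> : block_mx 1%:M (- x *: kap) eta N *m block_mx 1%:M (x *: kap) 0 1%:M =
      block_mx (1%:M : 'M[R]_1) 0 eta (N + x *: (eta *m kap)).
    rewrite mulmx_block; congr block_mx.
    - by rewrite mulmx0 addr0 mulmx1.
    - by rewrite mul1mx mulmx1 scaleNr addrN.
    - by rewrite mulmx1 mulmx0 addr0.
    - by rewrite mulmx1 -scalemxAr addrC.
  by rewrite det_lblock det1 mul1r.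
have h2 : \det N = \det (block_mx (1%:M : 'M[R]_1) 0 eta N).
  by rewrite det_lblock det1 mul1r.
(* Linearity in the first row: [(1, - x kap)] is [(1, 0)] minus [x] times [(0, kap)]. *)
rewrite -h1 h2 -[X in _ = X - _]mul1r -mulNr /bord_det !block_mxEv.
apply: (determinant_multilinear (i0 := lshift n (0 : 'I_1))).
- rewrite !rowKu; apply/rowP => j; rewrite !mxE.
  by case: (fintype.split j) => l; rewrite !mxE; ring.
- apply/matrixP => i j; rewrite !mxE; case: splitP => // l.
  by move=> h; exfalso; have := ltn_ord l; rewrite -h /= /bump.
- apply/matrixP => i j; rewrite !mxE; case: splitP => // l.
  by move=> h; exfalso; have := ltn_ord l; rewrite -h /= /bump.
Qed.

(** The determinant is affine along the perturbation: reaching [x + 1] directly or through [x] must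
    give the same value, so the slopes agree. *)
Lemma bord_det_rank1 n (N : 'M[R]_n) (eta : 'cV[R]_n) (kap : 'rV[R]_n) (x : R) :
  bord_det kap eta (N + x *: (eta *m kap)) = bord_det kap eta N.
Proof.
have := det_rank1 N eta kap (x + 1); have := det_rank1 (N + x *: (eta *m kap)) eta kap 1.
rewrite scale1r scalerDl scale1r addrA det_rank1 => -> h.
have {h} : x * bord_det kap eta N + bord_det kap eta (N + x *: (eta *m kap)) =
  x * bord_det kap eta N + bord_det kap eta N.
  apply: oppr_inj; apply: (addrI (\det N)).
  by rewrite opprD addrA; rewrite mul1r in h; rewrite h mulrDl mul1r.
exact: addrI.
Qed.

Definition det2 {n : nat} (M : 'M[R]_(n.+2, n)) (a b : 'cV[R]_n.+2) : R :=
  \det (row_mx a (row_mx b M) : 'M[R]_n.+2).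

Lemma det2_linear n (M : 'M[R]_(n.+2, n)) (b : 'cV[R]_n.+2) k u v :
  det2 M (k *: u + v) b = k * det2 M u b + det2 M v b.
Proof.
have e w : det2 M w b = \sum_i w i 0 *
    cofactor (row_mx (0 : 'cV[R]_n.+2) (row_mx b M) : 'M[R]_n.+2) i (lshift n.+1 (0 : 'I_1)).
  rewrite /det2 (expand_det_col _ (lshift n.+1 (0 : 'I_1))).
  apply: eq_bigr => i _; rewrite row_mxEl /cofactor; congr (_ * (_ * \det (row' _ _))).
  apply/matrixP => i' j; rewrite !mxE; case: splitP => [l|//].
  by rewrite /= /bump leq0n add1n => /esym h; have := ltn_ord l; rewrite h.
rewrite !e mulr_sumr -big_split; apply: eq_bigr => i _ /=.
by rewrite !mxE; ring.
Qed.

Lemma det2_swap n (M : 'M[R]_(n.+2, n)) (a b : 'cV[R]_n.+2) :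
  det2 M a b = - det2 M b a.
Proof.
pose i0 : 'I_(n.+2) := ord0; pose i1 : 'I_(n.+2) := lift ord0 ord0.
have -> : det2 M a b = \det (xcol i0 i1 (row_mx b (row_mx a M) : 'M[R]_n.+2)).
  congr (\det _); apply/matrixP => i j; rewrite [RHS]mxE.
  case: (@split_ordP 1 n.+1 j) => [l ->|l ->].
    have -> : lshift n.+1 l = i0 by apply: val_inj; rewrite /= ord1.
    rewrite tpermL (_ : i1 = rshift 1 (lshift n (0 : 'I_1))); last exact: val_inj.
    rewrite (_ : i0 = lshift n.+1 (0 : 'I_1)); last exact: val_inj.
    etransitivity; first exact: row_mxEl.
    by symmetry; etransitivity; [exact: row_mxEr|exact: row_mxEl].
  case: (@split_ordP 1 n l) => [l' ->|l' ->].
    have -> : rshift 1 (lshift n l') = i1 by apply: val_inj; rewrite /= ord1.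
    rewrite tpermR (_ : i1 = rshift 1 (lshift n (0 : 'I_1))); last exact: val_inj.
    rewrite (_ : i0 = lshift n.+1 (0 : 'I_1)); last exact: val_inj.
    etransitivity; first by etransitivity; [exact: row_mxEr|exact: row_mxEl].
    by symmetry; exact: row_mxEl.
  rewrite tpermD//; etransitivity; first by etransitivity; exact: row_mxEr.
  by symmetry; etransitivity; exact: row_mxEr.
by rewrite xcolE det_mulmx det_perm odd_tperm /= mulrN1.
Qed.

(** With a zero in the border above [d], the columns [eta] and [d] stand side by side in one
    determinant and can be exchanged up to sign. *)
Lemma bord_det_row_mx n (kap : 'rV[R]_n) (eta d : 'cV[R]_n.+1) (M : 'M[R]_(n.+1, n)) :
  bord_det (row_mx (0 : 'M[R]_1) kap : 'rV[R]_n.+1) eta (row_mx d M : 'M[R]_n.+1) =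
  det2 (col_mx kap M : 'M[R]_(n.+2, n)) (col_mx (0 : 'M[R]_1) eta) (col_mx (0 : 'M[R]_1) d).
Proof.
rewrite /bord_det /det2 block_mxEh; congr (\det (row_mx _ _)).
exact: (block_mxEh (0 : 'M[R]_1) kap d M).
Qed.

Lemma col_linear_sum n (f : 'cV[R]_n -> R) :
  (forall k u v, f (k *: u + v) = k * f u + f v) ->
  forall v, f v = \sum_k v k 0 * f (delta_mx k 0).
Proof.
move=> lf v; have f0 : f 0 = 0.
  by have := lf 0 0 0; rewrite scaler0 addr0 mul0r add0r => h; have := lf 1 0 0;
    rewrite scaler0 addr0 mul1r => /eqP; rewrite -subr_eq subrr eq_sym => /eqP.
rewrite [v in LHS]matrix_sum_delta; under eq_bigr do rewrite big_ord1.
elim: (index_enum _) => [|k s IH]; first by rewrite !big_nil.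
by rewrite !big_cons lf IH.
Qed.

(* The bordered determinant is alternating in (eta, d), hence orthogonal to the
   symmetric matrix c. *)
Lemma bord_det_sym_sum n (kap : 'rV[R]_n) (M : 'M[R]_(n.+1, n)) (c r r' : 'M[R]_n.+1) :
  c^T = c -> r' *m r = 1%:M -> (forall x : R, x + x = 0 -> x = 0) ->
  \sum_i bord_det (row_mx (0 : 'M[R]_1) kap : 'rV[R]_n.+1) (row i r)^T
     (row_mx (col i (c *m r')) M : 'M[R]_n.+1) = 0.
Proof.
move=> cs rr two.
pose K := col_mx kap M : 'M[R]_(n.+2, n).
pose z (v : 'cV[R]_n.+1) : 'cV[R]_n.+2 := col_mx (0 : 'M[R]_1) v.
have zl k u v : z (k *: u + v) = k *: z u + z v.
  apply/matrixP => i j; rewrite !mxE; case: fintype.split => l; rewrite !mxE//.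
  by rewrite mulr0 addr0.
pose Bm : 'M[R]_n.+1 := \matrix_(k, l) det2 K (z (delta_mx k 0)) (z (delta_mx l 0)).
have BT : Bm^T = - Bm by apply/matrixP => k l; rewrite !mxE det2_swap.
have e eta d : det2 K (z eta) (z d) = \sum_k \sum_l eta k 0 * Bm k l * d l 0.
  rewrite (@col_linear_sum _ (fun v => det2 K (z v) (z d))); last first.
    by move=> k u v; rewrite zl det2_linear.
  apply: eq_bigr => k _; rewrite det2_swap.
  rewrite (@col_linear_sum _ (fun v => det2 K (z v) (z (delta_mx k 0)))); last first.
    by move=> k' u v; rewrite zl det2_linear.
  rewrite -sumrN mulr_sumr; apply: eq_bigr => l _.
  by rewrite mxE [in RHS]det2_swap; ring.
have -> : \sum_i bord_det (row_mx (0 : 'M[R]_1) kap : 'rV[R]_n.+1) (row i r)^T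
     (row_mx (col i (c *m r')) M : 'M[R]_n.+1) = \tr (r *m Bm *m (c *m r')).
  apply: eq_bigr => i _; rewrite bord_det_row_mx e mxE exchange_big /=.
  by apply: eq_bigr => l _; rewrite !mxE mulr_suml; apply: eq_bigr => k _; rewrite !mxE.
(* [r' *m r = 1] leaves the trace of a product of the symmetric [c] and the antisymmetric [Bm].
   Transposition turns it into its negative, and [two] concludes. *)
rewrite mxtrace_mulC -!mulmxA [r' *m _]mulmxA rr mul1mx.
apply: two; rewrite -{1}mxtrace_tr trmx_mul BT cs mulNmx mxtrace_mulC raddfN /=.
by rewrite addNr.
Qed.

End RankOne.

(** * The form at the base point *)

Section BasePoint.
Variable R : realType.

(** Only the first [p] coordinates are paired: those along the tangent space at Z_0. *)
Definition gram {p n m : nat} (y : 'M[R]_(p.+1, n)) (V : 'M[R]_(p, m)) : 'M[R]_(n, m) :=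
  \matrix_(a, b) \sum_(i < p) y (row_index i) a * V i b.

(** By Cauchy-Binet the sum over alpha of minors of X times values of omega_alpha collapses to a
    single determinant of pairings. *)
Lemma A0_gram p n (E : 'M[R]_p.+1) (j k : 'I_n) (X : 'M[R]_(p.+1, n))
    (vs : 'I_n.-1 -> 'cV[R]_p.+1) :
  A0 E j k X vs = (-1) ^+ k * ((invmx E *m X) ord_max j * phi0 (invmx E *m X) *
    \det (row' k (gram (invmx E *m X)
      (\matrix_(i < p, b < n.-1) (invmx E *m vs b) (row_index i) 0)))).
Proof.
rewrite /A0; set y := invmx E *m X; set V := \matrix_(_, _) _; congr (_ * _).
pose A : 'M[R]_(p, n.-1) := \matrix_(i, b) col' k y (row_index i) b.
have -> : row' k (gram y V) = A^T *m V.
  by apply/matrixP => a b; rewrite !mxE; apply: eq_bigr => i _; rewrite !mxE.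
rewrite Cauchy_Binet mulr_sumr; apply: eq_bigr => al _.
rewrite -!mulrA; congr (_ * _); rewrite mulrCA; congr (_ * (_ * _)).
  by congr (\det _); apply/matrixP => a b; rewrite !mxE.
by congr (\det _); apply/matrixP => a b; rewrite !mxE.
Qed.

Lemma det_row_mx_expand n (d : 'cV[R]_n.+1) (M : 'M[R]_(n.+1, n)) :
  \det (row_mx d M : 'M[R]_n.+1) = \sum_k d k 0 * ((-1) ^+ k * \det (row' k M)).
Proof.
rewrite (expand_det_col _ (lshift n (0 : 'I_1))); apply: eq_bigr => k _.
have -> : (row_mx d M : 'M[R]_n.+1) k (lshift n (0 : 'I_1)) = d k 0.
  exact: row_mxEl.
rewrite /cofactor /= addn0; congr (_ * (_ * \det _)).
apply/matrixP => a b; rewrite !mxE.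
case: splitP => [l h|l h].
  by exfalso; have := ltn_ord l; rewrite -h /= /bump.
by congr (M _ _); apply: val_inj; move: h; rewrite /= /bump /= => -[].
Qed.

(** * Symmetric combinations of the A_jk as divergences *)

Section Psi.
Variables (p n : nat) (V : 'M[R]_(p.+1, n)) (c : 'M[R]_n.+1).
Let MT := 'M[R]_(p.+2, n.+1).

(** The combination of the A_jk with coefficients [c j k], in coordinates: for fixed [j] the signed
    minors over [k] are the expansion of a determinant along a first column holding the [j]-th row
    of [c]. *)
Definition psi_real (y : MT) : R :=
  phi0 y * \sum_j y ord_max j * \det (row_mx (row j c)^T (gram y V) : 'M[R]_n.+1).

Lemma gram_row_mx_tame (d : 'cV[R]_n.+1) a b :
  tame (fun y : MT => 1 + n1 y) (fun y => (row_mx d (gram y V) : 'M[R]_n.+1) a b).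
Proof.
case: (@split_ordP 1 n b) => b' ->.
  apply: (@tame_ext _ _ _ (fun=> d a b')); last exact: tame_cst.
  by move=> y; symmetry; exact: row_mxEl.
apply: (@tame_ext _ _ _ (fun y : MT => \sum_(i < p.+1) y (row_index i) a * V i b')).
  by move=> y; symmetry; etransitivity; [exact: row_mxEr|rewrite mxE].
apply: tame_sum => [y|i]; first exact: ge1_1Dn1.
by apply: tameM; [exact: tame_entry|exact: tame_cst].
Qed.

Lemma psi_real_decay l : exists2 C : R, 0 <= C &
  forall y : MT, `|psi_real y| <= C * (1 + n1 y) ^- l.
Proof.
pose s (y : MT) : R := 1 + n1 y.
have s1 y : 1 <= s y by exact: ge1_1Dn1.
have [C [K [C0 hC]]] : tame s (fun y : MT =>
    \sum_j y ord_max j * \det (row_mx (row j c)^T (gram y V) : 'M[R]_n.+1)).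
  apply: tame_sum => // j; apply: tameM; first exact: tame_entry.
  by apply: tame_det => // a b; exact: gram_row_mx_tame.
have [C' C'0 h'] := phi0_decay R p.+1 n.+1 (K + l).
exists (C' * C); first exact: mulr_ge0.
move=> y; have s0 : 0 < s y by exact: lt_le_trans (s1 y).
rewrite /psi_real normrM ger0_norm ?expR_ge0// ler_pdivlMr ?exprn_gt0//.
apply: (@le_trans _ _ (phi0 y * (C * s y ^+ K) * s y ^+ l)).
  by rewrite ler_wpM2r ?exprn_ge0 ?(ltW s0)// ler_wpM2l ?expR_ge0.
rewrite -mulrA -mulrA -exprD mulrCA [leRHS]mulrC ler_wpM2l//; exact: h'.
Qed.

Variables (r r' : 'M[R]_n.+1).
Hypothesis c_sym : c^T = c.
Hypothesis rr' : r' *m r = 1%:M.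

(* E^-1 u0 = (e_1 + e_m) / 2 times the i-th row of r. *)
Definition cusp_dir (i : 'I_n.+1) : MT :=
  \matrix_(a, b) ((2^-1 * ((a == ord0)%:R + (a == ord_max)%:R)) * r i b).

(** Translations move [y] along the rows of [r], so [c] is written as [(c *m r') *m r]; column [i]
    of [c *m r'] is the coefficient belonging to the direction [cusp_dir i]. *)
Definition line_det (i : 'I_n.+1) (y : MT) : R :=
  \det (row_mx (col i (c *m r')) (gram y V) : 'M[R]_n.+1).

Definition line_slope (i : 'I_n.+1) (y : MT) : R :=
  - bord_det (row_mx (0 : 'M[R]_1) (2^-1 *: row ord0 V) : 'rV[R]_n.+1) (row i r)^T
      (row_mx (col i (c *m r')) (gram y V) : 'M[R]_n.+1).

Lemma gram_shift i y x : gram (y + x *: cusp_dir i) V =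
  gram y V + x *: ((row i r)^T *m (2^-1 *: row ord0 V)).
Proof.
apply/matrixP => a b; rewrite !mxE big_ord1 !mxE.
transitivity (\sum_(k < p.+1) (y (row_index k) a * V k b +
    (if k == ord0 then x * (r i a * (2^-1 * V ord0 b)) else 0))).
  apply: eq_bigr => k _; rewrite !mxE.
  have -> : (row_index k == ord_max) = false.
    by apply/negbTE/eqP => /(congr1 val) /= h; have := ltn_ord k; rewrite h ltnn.
  have -> : (row_index k == ord0) = (k == ord0).
    by apply/eqP/eqP => [/(congr1 val) /= h|->]; apply: val_inj.
  by case: eqP => [->|_] /=; ring.
by rewrite big_split /= -big_mkcond big_pred1_eq.
Qed.

Lemma row_mx_shift i y x :
  (row_mx (col i (c *m r')) (gram (y + x *: cusp_dir i) V) : 'M[R]_n.+1) =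
  (row_mx (col i (c *m r')) (gram y V) : 'M[R]_n.+1) +
  x *: ((row i r)^T *m (row_mx (0 : 'M[R]_1) (2^-1 *: row ord0 V) : 'rV[R]_n.+1)).
Proof.
rewrite gram_shift; move: (gram y V) (2^-1 *: row ord0 V) => M k.
apply/matrixP => a b; rewrite !mxE big_ord1 !mxE.
by case: fintype.split => l; rewrite !mxE ?mulr0 ?addr0// big_ord1 !mxE.
Qed.

Lemma line_det_shift i y x :
  line_det i (y + x *: cusp_dir i) = line_det i y + x * line_slope i y.
Proof. by rewrite /line_det row_mx_shift det_rank1 /line_slope mulrN. Qed.

Lemma line_slope_shift i y x :
  line_slope i (y + x *: cusp_dir i) = line_slope i y.
Proof. by rewrite /line_slope row_mx_shift bord_det_rank1. Qed.

Lemma line_det_tame i : tame (fun y : MT => 1 + n1 y) (line_det i).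
Proof.
have s1 (y : MT) := ge1_1Dn1 y.
by apply: tame_det => // a b; exact: gram_row_mx_tame.
Qed.

Lemma line_slope_tame i : tame (fun y : MT => 1 + n1 y) (line_slope i).
Proof.
have s1 (y : MT) := ge1_1Dn1 y.
(* The slope of an affine function is a difference of two values, so it inherits their growth. *)
apply: (@tame_ext _ _ _ (fun y => line_det i (y + 1 *: cusp_dir i) - line_det i y)).
  by move=> y; rewrite line_det_shift mul1r addrC addKr.
apply: tameD => //; last first.
  by have [C [K [C0 h]]] := line_det_tame i; exists C, K; split => // y; rewrite normrN.
have [C [K [C0 h]]] := line_det_tame i.
pose d : R := 1 + n1 (cusp_dir i).
have d0 : 0 <= d by rewrite addr_ge0// n1_ge0.
exists (C * d ^+ K), K; split; first by rewrite mulr_ge0// exprn_ge0.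
move=> y; rewrite (le_trans (h _))// -mulrA ler_wpM2l// -exprMn lerXn2r// ?nnegrE.
- by rewrite addr_ge0// n1_ge0.
- by rewrite mulr_ge0// addr_ge0// n1_ge0.
rewrite scale1r /d; have := n1D y (cusp_dir i).
have := mulr_ge0 (n1_ge0 y) (n1_ge0 (cusp_dir i)); lra.
Qed.

(* On the hyperplane y_1 = y_m the form is a divergence along the directions
   cusp_dir i: the slopes of the determinants cancel because c is symmetric. *)
Lemma psi_real_deriv (y : MT) : (forall j, y ord0 j = y ord_max j) ->
  psi_real y = - (2 * pi)^-1 *
    \sum_i gauss_deriv (cusp_dir i) (line_det i) (line_slope i) 1 y 0.
Proof.
move=> y0.
(* Differentiating the Gaussian brings down the pairing of [y] with [cusp_dir i], which averages the
   first and last rows of [y]. On the hyperplane this is the last row alone, and so produces the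
   factor x_mj of A_jk. *)
have hD i : \sum_a \sum_b y a b * cusp_dir i a b = \sum_b y ord_max b * r i b.
  have e (a : 'I_p.+2) : \sum_b y a b * cusp_dir i a b =
    (if a == ord0 then \sum_b y ord_max b * r i b / 2 else 0) +
    (if a == ord_max then \sum_b y ord_max b * r i b / 2 else 0).
    case: (eqVneq a ord0) => [->|a0]; case: eqVneq => [e|am].
    - by have /= := congr1 val e.
    - rewrite addr0; apply: eq_bigr => b _; rewrite y0 mxE eqxx /=.
      by ring.
    - rewrite add0r; apply: eq_bigr => b _; rewrite e mxE eqxx /=.
      by ring.
    - rewrite addr0 big1// => b _; rewrite mxE (negbTE a0) (negbTE am) /=.
      by rewrite addr0 mulr0 mul0r mulr0.
  rewrite (eq_bigr _ (fun a _ => e a)) big_split /= -!big_mkcond !big_pred1_eq.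
  by rewrite -big_split; apply: eq_bigr => b _ /=; lra.
have slope0 : \sum_i line_slope i y = 0.
  rewrite /line_slope sumrN (bord_det_sym_sum _ _ c_sym rr') ?oppr0// => x; lra.
have pi0 : (pi : R) != 0 by rewrite gt_eqF// pi_gt0.
have -> : \sum_i gauss_deriv (cusp_dir i) (line_det i) (line_slope i) 1 y 0 =
   - (2 * pi) * phi0 y * \sum_i line_det i y * \sum_b y ord_max b * r i b.
  transitivity (\sum_i (line_slope i y * phi0 y +
      - (2 * pi) * phi0 y * (line_det i y * \sum_b y ord_max b * r i b))).
    by apply: eq_bigr => i _; rewrite gauss_deriv1_0 hD; ring.
  by rewrite big_split /= -mulr_suml slope0 mul0r add0r -mulr_sumr.
have -> : \sum_i line_det i y * \sum_b y ord_max b * r i b =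
   \sum_j y ord_max j * \det (row_mx (row j c)^T (gram y V) : 'M[R]_n.+1).
  under eq_bigr => i _ do rewrite mulr_sumr.
  rewrite exchange_big; apply: eq_bigr => b _ /=.
  rewrite det_row_mx_expand.
  under eq_bigr => i _ do rewrite mulrCA /line_det det_row_mx_expand.
  rewrite -mulr_sumr; congr (_ * _).
  under eq_bigr => i _ do rewrite mulr_suml.
  rewrite exchange_big; apply: eq_bigr => k _ /=.
  have -> : (row b c)^T k 0 = \sum_i (c *m r') k i * r i b.
    have -> : \sum_i (c *m r') k i * r i b = (c *m r' *m r) k b by rewrite mxE.
    by rewrite -mulmxA rr' mulmx1 !mxE -[in LHS]c_sym mxE.
  rewrite mulr_suml; apply: eq_bigr => i _; rewrite mxE; ring.
rewrite /psi_real -[- (2 * pi) * _ * _]mulrA mulNr mulNr mulrN opprK mulrA mulVf ?mul1r//.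
by rewrite mulf_neq0// pnatr_eq0.
Qed.

Variables (T : choiceType) (D : set T) (w : T -> R).
Hypothesis w_ge0 : forall x, 0 <= w x.
Hypothesis w_sum : (\esum_(x in D) (w x)%:E < +oo)%E.

(** The cusp estimate in abstract form: [b0] marks the terms orthogonal to the isotropic vector, and
    [rho] stands for the cosine or sine of the phase. *)
Lemma psi_sum_decay (N l : nat) (Cw Cb : R) : 0 <= Cw -> 0 <= Cb ->
  exists2 C : R, 0 <= C &
  forall (t : R) (y : T -> MT) (S : 'I_n.+1 -> T -> T) (b0 : T -> bool) (rho : T -> R),
    1 <= t -> (forall i, set_bij D D (S i)) ->
    (forall X, D X -> (1 + n1 (y X)) ^- l <= Cw * t ^+ l * w X) ->
    (forall i X, D X -> y (S i X) = y X + t^-1 *: cusp_dir i) ->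
    (forall X, D X -> `|rho X| <= 1) ->
    (forall i X, D X -> b0 (S i X) = b0 X) ->
    (forall i X, D X -> b0 X -> rho (S i X) = rho X) ->
    (forall X j, D X -> b0 X -> y X ord0 j = y X ord_max j) ->
    (forall X, D X -> ~~ b0 X -> t <= Cb * (1 + n1 (y X))) ->
    `|rsum D (fun X => rho X * psi_real (y X))| <= C * t ^- N.
Proof.
move=> Cw0 Cb0.
have per i := periodic_sum_decay (line_det_shift i) (line_slope_shift i)
  (line_det_tame i) (line_slope_tame i) w_ge0 w_sum N l Cw0.
have dec i := gauss_deriv_decay (cusp_dir i) (line_det_tame i) (line_slope_tame i) 1 l.
have [C1 C10 h1] : exists2 C1, 0 <= C1 & forall i, s2val (cid2 (per i)) <= C1.
  exists (\sum_i `|s2val (cid2 (per i))|) => [|i]; first exact: sumr_ge0.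
  by rewrite (bigD1 i)//= (le_trans (ler_norm _))// lerDl sumr_ge0.
have [C2 C20 h2] : exists2 C2, 0 <= C2 & forall i, s2val (cid2 (dec i)) <= C2.
  exists (\sum_i `|s2val (cid2 (dec i))|) => [|i]; first exact: sumr_ge0.
  by rewrite (bigD1 i)//= (le_trans (ler_norm _))// lerDl sumr_ge0.
(* For unmarked terms, [l] powers of [1 + n1 y] yield the weight at the price of [t ^+ l]; the other
   [N + l] become [t ^- (N + l)] through [t <= Cb (1 + n1 y)]. *)
have [C3 C30 h3] := psi_real_decay (l + (N + l)).
have W0 : 0 <= nnsum D w.
  by rewrite fine_ge0// esum_ge0// => x _; rewrite lee_fin.
pose K := C3 * Cw * Cb ^+ (N + l).
have K0 : 0 <= K by rewrite !mulr_ge0// exprn_ge0.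
pose k2 : R := (2 * pi)^-1.
have k20 : 0 <= k2 by rewrite invr_ge0 mulr_ge0// pi_ge0.
exists (k2 * (\sum_(i < n.+1) C1) + K * nnsum D w).
  by rewrite addr_ge0// mulr_ge0// sumr_ge0.
move=> t y S b0 rho t1 bS hw yS rho1 b0S rhoS hy0 hb.
have t0 : 0 < t by exact: lt_le_trans t1.
pose s X := 1 + n1 (y X).
have s0 X : 0 < s X by rewrite ltr_pwDl// n1_ge0.
(* Extension by zero keeps the marked sum over all of [D], where the shifts are bijections, and
   [kap] stays invariant because the shifts preserve [b0]. *)
pose kap X := if b0 X then rho X else 0.
pose g i X := gauss_deriv (cusp_dir i) (line_det i) (line_slope i) 1 (y X) 0.
have kap1 X : D X -> `|kap X| <= 1.
  by move=> DX; rewrite /kap; case: ifP; rewrite ?normr0// rho1.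
have kapS i X : D X -> kap (S i X) = kap X.
  by move=> DX; rewrite /kap b0S//; case: ifPn => // /rhoS ->.
have hg i : `|rsum D (fun X => kap X * g i X)| <= C1 * t ^- N.
  have := s2valP' (cid2 (per i)) t y (S i) kap t1 (bS i) hw (yS i) kap1 (kapS i).
  by move=> /le_trans; apply; rewrite ler_wpM2r// invr_ge0 exprn_ge0// ltW.
pose B1 := C2 * (Cw * t ^+ l).
have B10 : 0 <= B1 by rewrite !mulr_ge0// exprn_ge0// ltW.
have dg i : dominated D w (fun X => kap X * g i X) B1.
  move=> X DX; rewrite normrM -[leRHS]mul1r ler_pM//; first exact: kap1.
  have := s2valP' (cid2 (dec i)) (y X) 0; rewrite lexx ler01 => /(_ isT) /le_trans; apply.
  apply: (@le_trans _ _ (C2 * s X ^- l)).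
    rewrite ler_wpM2r// invr_ge0 exprn_ge0//; exact: ltW (s0 X).
  by rewrite /B1 -mulrA ler_wpM2l//; exact: hw.
pose rest X := if b0 X then 0 else rho X * psi_real (y X).
have Kt0 : 0 <= K * t ^- N by rewrite mulr_ge0// invr_ge0 exprn_ge0// ltW.
have drest : dominated D w rest (K * t ^- N).
  move=> X DX; rewrite /rest; case: ifPn => [_|nb].
    by rewrite normr0 mulr_ge0.
  rewrite normrM -[leRHS]mul1r ler_pM//; first exact: rho1.
  rewrite (le_trans (h3 _))// exprD invfM.
  apply: (@le_trans _ _ (C3 * ((Cw * t ^+ l * w X) * (Cb ^+ (N + l) * t ^- (N + l))))).
    rewrite ler_wpM2l// ler_pM ?invr_ge0 ?exprn_ge0 ?(ltW (s0 X))//; first exact: hw.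
    rewrite -/(s X) ler_pdivlMr ?exprn_gt0// mulrC ler_pdivrMr ?exprn_gt0//.
    rewrite -exprMn lerXn2r ?nnegrE ?(ltW t0) ?mulr_ge0 ?(ltW (s0 X))//; exact: hb.
  have tl0 : t ^+ l != 0 by rewrite expf_neq0// gt_eqF.
  have tN0 : t ^+ N != 0 by rewrite expf_neq0// gt_eqF.
  rewrite /K [t ^+ (N + l)]exprD le_eqVlt; apply/orP; left; apply/eqP.
  move: (t ^+ l) (t ^+ N) (Cb ^+ (N + l)) tl0 tN0 => x z v x0 z0.
  by field; rewrite x0 z0.
pose mainp X := - k2 * \sum_i kap X * g i X.
have dsum : dominated D w (fun X => \sum_i kap X * g i X) (\sum_(i < n.+1) B1).
  move=> X DX; rewrite (le_trans (ler_norm_sum _ _ _))// mulr_suml.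
  by apply: ler_sum => i _; exact: dg.
have sB0 : 0 <= \sum_(i < n.+1) B1 by exact: sumr_ge0.
have dmain : dominated D w mainp (k2 * \sum_(i < n.+1) B1).
  move=> X DX; rewrite /mainp normrM normrN (ger0_norm k20) -mulrA ler_wpM2l//.
  exact: dsum.
have -> : rsum D (fun X => rho X * psi_real (y X)) = rsum D mainp + rsum D rest.
  rewrite -(@rsumD _ _ _ _ w_ge0 w_sum _ _ (k2 * \sum_(i < n.+1) B1 + K * t ^- N)).
  - apply: eq_rsum => X DX; rewrite /mainp /rest /kap; case: ifPn => b0X.
      rewrite addr0 psi_real_deriv; last by move=> j; exact: hy0.
      by rewrite -mulr_sumr mulrCA.
    by rewrite big1 ?mulr0 ?add0r// => i _; rewrite mul0r.
  - by rewrite addr_ge0// mulr_ge0.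
  - by move=> X DX; rewrite (le_trans (dmain X DX))// ler_wpM2r// lerDl.
  - by move=> X DX; rewrite (le_trans (drest X DX))// ler_wpM2r// lerDr mulr_ge0.
rewrite (le_trans (ler_normD _ _))// mulrDl lerD//.
  rewrite (rsumZ w_ge0 w_sum _ sB0 dsum) normrM normrN (ger0_norm k20) -mulrA ler_wpM2l//.
  rewrite (rsum_sum w_ge0 w_sum _ B10 dg) (le_trans (ler_norm_sum _ _ _))// mulr_suml.
  by apply: ler_sum => i _; exact: hg.
by rewrite mulrAC; exact: (rsum_dom w_ge0 w_sum Kt0 drest).
Qed.

End Psi.

End BasePoint.

(** * Horospherical coordinates *)

Section Bil.
Variables (R : realType) (p : nat) (q : 'M[R]_p.+1).
Hypothesis q_sym : q^T = q.
Implicit Types (x y z : 'cV[R]_p.+1) (g : 'M[R]_p.+1).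
Local Notation B := (bil q).

Lemma bilDl x y z : B (x + y) z = B x z + B y z.
Proof. by rewrite /bil linearD /= !mulmxDl mxE. Qed.

Lemma bilZl k x y : B (k *: x) y = k * B x y.
Proof. by rewrite /bil linearZ /= -!scalemxAl mxE. Qed.

Lemma bilC x y : B x y = B y x.
Proof.
have e : (x^T *m q *m y)^T = y^T *m q *m x by rewrite !trmx_mul trmxK q_sym mulmxA.
by rewrite /bil -e [RHS]mxE.
Qed.

Lemma bilDr x y z : B x (y + z) = B x y + B x z.
Proof. by rewrite /bil mulmxDr mxE. Qed.

Lemma bilZr k x y : B x (k *: y) = k * B x y.
Proof. by rewrite /bil -scalemxAr mxE. Qed.

Lemma bilNl x y : B (- x) y = - B x y.
Proof. by rewrite -scaleN1r bilZl mulN1r. Qed.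

Lemma bilNr x y : B x (- y) = - B x y.
Proof. by rewrite -scaleN1r bilZr mulN1r. Qed.

Definition bilE := (bilDl, bilDr, bilZl, bilZr, bilNl, bilNr).

Lemma rank1_act (v w x : 'cV[R]_p.+1) : v *m (w^T *m q) *m x = B w x *: v.
Proof.
by rewrite -mulmxA [w^T *m q *m x]mx11_scalar mul_mx_scalar.
Qed.

Lemma mx_eq_act g g' : (forall x, g *m x = g' *m x) -> g = g'.
Proof.
move=> h; apply/matrixP => i j; have := h (delta_mx j 0); rewrite -!colE.
by move=> /colP/(_ i); rewrite !mxE.
Qed.

Definition orth g := g^T *m q *m g = q.

Lemma orth_bil g : (forall x y, B (g *m x) (g *m y) = B x y) -> orth g.
Proof.
move=> h; apply/matrixP => i j.
have e (A : 'M[R]_p.+1) : A i j =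
    ((delta_mx i 0 : 'cV_p.+1)^T *m A *m (delta_mx j 0 : 'cV_p.+1)) 0 0.
  by rewrite trmx_delta -rowE -colE !mxE.
rewrite e [RHS]e -[RHS]/(B _ _) -h /bil trmx_mul; congr (_ 0 0).
by rewrite !mulmxA.
Qed.

Lemma orthE g x y : orth g -> B (g *m x) (g *m y) = B x y.
Proof. by move=> h; rewrite /bil trmx_mul -[in RHS]h !mulmxA. Qed.

Lemma orthM g g' : orth g -> orth g' -> orth (g *m g').
Proof. by move=> h h'; apply: orth_bil => x y; rewrite -!mulmxA !orthE. Qed.

Hypothesis q_unit : q \in unitmx.

Lemma orth_det2 g : orth g -> \det g ^+ 2 = 1.
Proof.
move=> /(congr1 determinant); rewrite !det_mulmx det_tr => h.
have d0 : \det q != 0 by rewrite -unitfE -unitmxE.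
by apply: (mulfI d0); rewrite mulr1 -[RHS]h expr2; ring.
Qed.

Lemma orth_unit g : orth g -> g \in unitmx.
Proof.
by move=> /orth_det2 h; rewrite unitmxE unitfE; apply: contra_eq_neq h => ->;
  rewrite expr0n /= eq_sym oner_eq0.
Qed.

Lemma orth_inv g : orth g -> orth (invmx g).
Proof.
move=> h; have gu := orth_unit h; apply: orth_bil => x y.
by rewrite -(orthE _ _ h) !mulKVmx.
Qed.

Variables (u u' : 'cV[R]_p.+1).
Hypothesis uu : B u u = 0.
Hypothesis u'u' : B u' u' = 0.
Hypothesis uu' : B u u' = - 2^-1.

Let u'u : B u' u = - 2^-1. Proof. by rewrite bilC. Qed.

Definition inW b := B u b = 0 /\ B u' b = 0.

(** The Eichler transformation of [b] in W: it fixes [u] and sends [u'] to [u' + b + (b,b) u]. *)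
Definition nmx b : 'M[R]_p.+1 :=
  1%:M - 2 *: ((b + B b b *: u) *m (u^T *m q)) + 2 *: (u *m (b^T *m q)).

(** The torus element with [u] to [t u], [u'] to [t^-1 u'], and the identity on W. *)
Definition amx (t : R) : 'M[R]_p.+1 :=
  1%:M - (2 * (t - 1)) *: (u *m (u'^T *m q)) - (2 * (t^-1 - 1)) *: (u' *m (u^T *m q)).

Lemma nmxE b x : nmx b *m x =
  x + (- 2 * B u x) *: b + (2 * B b x - 2 * B u x * B b b) *: u.
Proof.
rewrite /nmx mulmxDl mulmxBl mul1mx -!scalemxAl !rank1_act.
by apply/colP => i; rewrite !mxE; ring.
Qed.

Lemma amxE t x : amx t *m x =
  x + (- 2 * (t - 1) * B u' x) *: u + (- 2 * (t^-1 - 1) * B u x) *: u'.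
Proof.
rewrite /amx !mulmxBl mul1mx -!scalemxAl !rank1_act.
by apply/colP => i; rewrite !mxE; ring.
Qed.

Lemma orth_nmx b : inW b -> orth (nmx b).
Proof.
move=> [b1 b2]; apply: orth_bil => x y; rewrite !nmxE !bilE uu.
by rewrite (bilC x b) (bilC x u) (bilC b u) b1; ring.
Qed.

Lemma orth_amx t : t != 0 -> orth (amx t).
Proof.
move=> t0; apply: orth_bil => x y; rewrite !amxE !bilE uu u'u' u'u uu'.
by rewrite (bilC x u) (bilC x u'); field.
Qed.

Lemma inWZ k b : inW b -> inW (k *: b).
Proof. by move=> [h1 h2]; split; rewrite bilZr ?h1 ?h2 mulr0. Qed.

Lemma nmxD b b' : inW b -> inW b' -> nmx b *m nmx b' = nmx (b + b').
Proof.
move=> [b1 b2] [c1 c2]; apply: mx_eq_act => x; rewrite -mulmxA !nmxE !bilE.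
rewrite (bilC b' b) (bilC b u) uu ?b1 ?c1; apply/colP => i; rewrite !mxE; ring.
Qed.

Lemma amxM t t' : t != 0 -> t' != 0 -> amx t *m amx t' = amx (t * t').
Proof.
move=> t0 t0'; apply: mx_eq_act => x; rewrite -mulmxA !amxE !bilE uu u'u' uu' u'u.
by apply/colP => i; rewrite !mxE; field; rewrite t0 t0'.
Qed.

(** An isometry has determinant of square 1, and [nmx b] is itself a square, that of [nmx (b / 2)].
    The same device with [Num.sqrt t] serves for [amx]. *)
Lemma det_nmx b : inW b -> \det (nmx b) = 1.
Proof.
move=> Wb; have Wh := inWZ 2^-1 Wb.
have -> : b = 2^-1 *: b + 2^-1 *: b by rewrite -scalerDl -[2^-1]mul1r -splitr scale1r.
by rewrite -nmxD// det_mulmx -expr2 orth_det2//; exact: orth_nmx.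
Qed.

Lemma det_amx t : 0 < t -> \det (amx t) = 1.
Proof.
move=> t0; have s0 : Num.sqrt t != 0 by rewrite gt_eqF// sqrtr_gt0.
have -> : t = Num.sqrt t * Num.sqrt t by rewrite -expr2 sqr_sqrtr// ltW.
by rewrite -amxM// det_mulmx -expr2 orth_det2//; exact: orth_amx.
Qed.

Definition Zc (t : R) b := (t + t^-1 * B b b) *: u + t^-1 *: b + t^-1 *: u'.

Lemma nmx_amx_u t b : t != 0 -> inW b -> nmx b *m (amx t *m u) = t *: u.
Proof.
move=> t0 [b1 b2]; rewrite amxE nmxE !bilE uu uu' u'u (bilC b u) b1 (bilC b u') b2.
by apply/colP => i; rewrite !mxE; field.
Qed.

Lemma nmx_amx_Z0 t b : t != 0 -> inW b -> nmx b *m (amx t *m (u + u')) = Zc t b.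
Proof.
move=> t0 [b1 b2]; rewrite amxE nmxE !bilE uu u'u' uu' u'u (bilC b u) b1 (bilC b u') b2.
by apply/colP => i; rewrite !mxE; field.
Qed.

Lemma nmx_amx_e1 t b : t != 0 -> inW b -> nmx b *m (amx t *m (u - u')) =
  (t - t^-1 * B b b) *: u - t^-1 *: (b + u').
Proof.
move=> t0 [b1 b2]; rewrite amxE nmxE !bilE uu u'u' uu' u'u (bilC b u) b1 (bilC b u') b2.
by apply/colP => i; rewrite !mxE; field.
Qed.

Lemma nmx_amx_W t b f : inW f ->
  nmx b *m (amx t *m f) = f + (2 * B b f) *: u.
Proof.
move=> [f1 f2]; rewrite amxE f1 f2 !mulr0 !scale0r !addr0 nmxE f1.
by rewrite !(mulr0, mul0r) scale0r addr0 subr0.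
Qed.

Lemma hyperboloid_Zc Z : B Z Z = -1 -> B u Z < 0 ->
  exists t b, [/\ 0 < t, inW b & Z = Zc t b].
Proof.
(* [c] has to be [t^-1], since [u] pairs with [Zc t b] to [- t^-1 / 2]; then [b] is [t] times the
   component of [Z] in W. *)
move=> ZZ uZ; have [c cE] : exists c, B u Z = - 2^-1 * c.
  by exists (- 2 * B u Z); field.
have c0 : 0 < c by lra.
have cn0 : c != 0 by rewrite gt_eqF.
pose b := c^-1 *: (Z + (2 * B u' Z) *: u + (- c) *: u').
have ub : B u b = 0 by rewrite /b !bilE uu uu' cE; field.
have u'b : B u' b = 0 by rewrite /b !bilE u'u' u'u; field.
exists c^-1, b; split => //; first by rewrite invr_gt0.
have bb : B b b = c^-1 ^+ 2 * (-1 + (- 2 * B u' Z) * c).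
  by rewrite /b !bilE uu u'u' uu' u'u ZZ (bilC Z u) (bilC Z u') cE; field.
rewrite /Zc bb invrK /b scalerA divff// scale1r; apply/colP => i; rewrite !mxE.
by field.
Qed.

Lemma n1_nmx_le (K : R) : exists2 C, 0 <= C &
  forall b, n1 b <= K -> n1 (nmx b) <= C.
Proof.
pose k := `|K|; have k0 : 0 <= k by exact: normr_ge0.
pose U := n1 u; pose Q1 := n1 q; pose I1 := n1 (1%:M : 'M[R]_p.+1).
have U0 : 0 <= U by exact: n1_ge0.
have Q0 : 0 <= Q1 by exact: n1_ge0.
have n1T m n (A : 'M[R]_(m, n)) : n1 A^T = n1 A.
  rewrite /n1 exchange_big; apply: eq_bigr => i _; apply: eq_bigr => j _.
  by rewrite mxE.
exists (I1 + 2 * ((k + k * Q1 * k * U) * (U * Q1)) + 2 * (U * (k * Q1))).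
  by rewrite !(addr_ge0, mulr_ge0, n1_ge0).
move=> b bK; have bk : n1 b <= k by rewrite (le_trans bK)// ler_norm.
have b0 := n1_ge0 b.
have bb : `|B b b| <= k * Q1 * k.
  rewrite /bil (le_trans (n1_entry _ 0 0))// (le_trans (n1_mul _ _))//.
  rewrite ler_pM ?n1_ge0// (le_trans (n1_mul _ _))// n1T ler_pM// n1_ge0.
rewrite (le_trans (n1D _ _))// lerD//.
  rewrite (le_trans (n1D _ _))// lerD// -scaleN1r n1Z normrN1 mul1r n1Z ger0_norm//.
  rewrite ler_pM2l// (le_trans (n1_mul _ _))// ler_pM ?n1_ge0//.
    rewrite (le_trans (n1D _ _))// lerD// n1Z ler_pM// n1_ge0.
  by rewrite (le_trans (n1_mul _ _))// n1T.
rewrite n1Z ger0_norm// ler_pM2l// (le_trans (n1_mul _ _))// ler_pM ?n1_ge0//.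
by rewrite (le_trans (n1_mul _ _))// n1T ler_pM// n1_ge0.
Qed.

Lemma n1_amx_le : exists2 C, 0 <= C & forall t, 1 <= t -> n1 (amx t) <= C * t.
Proof.
pose A1 := n1 (u *m (u'^T *m q)); pose A2 := n1 (u' *m (u^T *m q)).
pose I1 := n1 (1%:M : 'M[R]_p.+1).
have A10 : 0 <= A1 by exact: n1_ge0.
have A20 : 0 <= A2 by exact: n1_ge0.
have I10 : 0 <= I1 by exact: n1_ge0.
exists (I1 + 2 * A1 + 2 * A2); first by rewrite !addr_ge0// mulr_ge0.
move=> t t1; have t0 : 0 < t by exact: lt_le_trans t1.
have ti : 0 <= t^-1 <= 1 by rewrite invr_ge0 (ltW t0) invf_le1.
rewrite (le_trans (n1D _ _))// [leRHS]mulrDl lerD//.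
  rewrite (le_trans (n1D _ _))// [leRHS]mulrDl lerD//; first by rewrite ler_peMr.
  rewrite -scaleN1r n1Z normrN1 mul1r n1Z -/A1 normrM ger0_norm//.
  by rewrite ger0_norm; [nra|lra].
rewrite -scaleN1r n1Z normrN1 mul1r n1Z -/A2 normrM ger0_norm//.
by rewrite ler0_norm; [nra|lra].
Qed.

End Bil.

(** * The identity component *)

Section Component.
Variables (R : realType) (p : nat) (Q : 'M[rat]_p.+1).

Lemma SO0_path (gam : R -> 'M[R]_p.+1) :
  {in `[0, 1]%classic, forall s, {for s, continuous gam}} ->
  (forall s, 0 <= s <= 1 -> SO Q (gam s)) ->
  SO0 Q (gam 0) -> SO0 Q (gam 1).
Proof.
move=> cg hS h0; apply: connected_component_trans h0 _.
have I0 : `[0, 1]%classic (0 : R) by rewrite /= in_itv /= lexx ler01.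
have I1 : `[0, 1]%classic (1 : R) by rewrite /= in_itv /= lexx ler01.
apply: (@connected_component_max _ _ (gam @` `[0, 1]%classic)).
- by exists 0.
- by move=> _ [s sI <-]; apply: hS; move: sI; rewrite /= in_itv.
- apply: connected_continuous_connected; first exact: segment_connected.
  exact: continuous_in_subspaceT.
- by exists 1.
Qed.

Hypothesis Q_sym : Q^T = Q.
Hypothesis Q_unit : Q \in unitmx.
Let q : 'M[R]_p.+1 := toR Q.
Let q_sym : q^T = q. Proof. by rewrite /q /toR map_trmx Q_sym. Qed.
Let q_unit : q \in unitmx. Proof. by rewrite /q /toR map_unitmx. Qed.

Variables (u u' : 'cV[R]_p.+1).
Hypothesis uu : bil q u u = 0.
Hypothesis u'u' : bil q u' u' = 0.
Hypothesis uu' : bil q u u' = - 2^-1.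

Lemma SO0_orth (g : 'M[R]_p.+1) : SO0 Q g -> orth q g /\ \det g = 1.
Proof. by move=> /connected_component_sub. Qed.

Lemma SO0_nmx (g : 'M[R]_p.+1) b : SO0 Q g -> inW q u u' b -> SO0 Q (g *m nmx q u b).
Proof.
move=> hg Wb; have [og dg] := SO0_orth hg.
pose gam (s : R) := g *m nmx q u (s *: b).
have e1 : g *m nmx q u b = gam 1 by rewrite /gam scale1r.
have e0 : gam 0 = g.
  rewrite -[RHS]mulmx1; congr (_ *m _); apply: mx_eq_act => x.
  by rewrite nmxE scale0r mul1mx; apply/colP => i; rewrite !mxE -(scale0r 0) !bilE; ring.
rewrite e1; apply: (@SO0_path gam); [|clear e1|by rewrite e0]; last first.
  move=> s _; have Ws : inW q u u' (s *: b) by exact: inWZ.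
  split; first by apply: orthM => //; exact: (orth_nmx q_sym uu Ws).
  by rewrite det_mulmx dg (det_nmx q_sym q_unit uu Ws) mulr1.
move=> s _.
have [A1 [A2 key]] : exists A1 A2, forall x,
    nmx q u (x *: b) = 1%:M + x *: A1 + x ^+ 2 *: A2.
  exists (2 *: (u *m (b^T *m q)) - 2 *: (b *m (u^T *m q))).
  exists ((- (2 * bil q b b)) *: (u *m (u^T *m q))) => x.
  apply: mx_eq_act => y; rewrite nmxE !mulmxDl mul1mx -!scalemxAl.
  rewrite mulmxBl -!scalemxAl !rank1_act !bilE.
  by apply/colP => i; rewrite !mxE; ring.
have -> : gam = (fun s => g + s *: (g *m A1) + s ^+ 2 *: (g *m A2)).
  by apply/funext => x; rewrite /gam key !mulmxDr mulmx1 -!scalemxAr.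
apply: continuousD; first apply: continuousD.
- exact: cst_continuous.
- by apply: continuousZr_tmp => //; exact: cvg_id.
- apply: continuousZr_tmp; exact: exprn_continuous.
Qed.

Lemma SO0_amx (g : 'M[R]_p.+1) t : SO0 Q g -> 0 < t -> SO0 Q (g *m amx q u u' t).
Proof.
move=> hg t0; have [og dg] := SO0_orth hg.
(* The segment from 1 to [t] stays positive, so inversion is continuous along it and [det_amx]
   applies. *)
pose f (s : R) := 1 + s * (t - 1).
have f0 s : 0 <= s <= 1 -> 0 < f s by rewrite /f; nra.
pose gam (s : R) := g *m amx q u u' (f s).
have e1 : g *m amx q u u' t = gam 1 by rewrite /gam /f mul1r addrC subrK.
have e0 : gam 0 = g.
  rewrite -[RHS]mulmx1; congr (_ *m _); apply: mx_eq_act => x.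
  rewrite amxE /f mul0r addr0 invr1 subrr mul1mx; apply/colP => i; rewrite !mxE; ring.
rewrite e1; apply: (@SO0_path gam); [|clear e1|by rewrite e0]; last first.
  move=> s /f0 fs; split.
    by apply: orthM => //; apply: (orth_amx q_sym uu u'u' uu'); rewrite gt_eqF.
  by rewrite det_mulmx dg (det_amx q_sym q_unit uu u'u' uu' fs) mulr1.
move=> s; rewrite inE /= in_itv /= => sI.
have -> : gam = (fun s => g - (2 * (f s - 1)) *: (g *m (u *m (u'^T *m q))) -
    (2 * ((f s)^-1 - 1)) *: (g *m (u' *m (u^T *m q)))).
  by apply/funext => x; rewrite /gam /amx !mulmxBr mulmx1 -!scalemxAr.
have fc : {for s, continuous f}.
  apply: continuousD; first exact: cst_continuous.
  by apply: continuousM; [exact: cvg_id|exact: cst_continuous].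
apply: continuousB; first apply: continuousB.
- exact: cst_continuous.
- apply: continuousZr_tmp; apply: continuousM; first exact: cst_continuous.
  by apply: continuousB => //; exact: cst_continuous.
- apply: continuousZr_tmp; apply: continuousM; first exact: cst_continuous.
  apply: continuousB; last exact: cst_continuous.
  by apply: continuousV => //; rewrite gt_eqF// f0.
Qed.

End Component.

(** * Cusp frames and transporters *)

Section Frames.
Variable R : realType.

Lemma derive1_mx m n (M : R -> 'M[R]_(m.+1, n.+1)) (t : R) (D : 'M[R]_(m.+1, n.+1)) :
  (forall i j, is_derive t 1 (fun s => M s i j) (D i j)) -> derive1 M t = D.
Proof.
move=> h; rewrite derive1E derive_mx.
  by apply/matrixP => i j; rewrite mxE; exact: derive_val.
by apply/derivable_mxP => i j; exact: ex_derive.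
Qed.

Variables (p : nat) (Q : 'M[rat]_p.+1) (u0 u0' : 'cV[rat]_p.+1).
Hypothesis Q_sym : Q^T = Q.
Let q : 'M[R]_p.+1 := toR Q.
Let u : 'cV[R]_p.+1 := toR u0.
Let u' : 'cV[R]_p.+1 := toR u0'.
Let q_sym : q^T = q. Proof. by rewrite /q /toR map_trmx Q_sym. Qed.
Hypothesis uu : bil q u u = 0.
Hypothesis u'u' : bil q u' u' = 0.
Hypothesis uu' : bil q u u' = - 2^-1.

Lemma cusp_frame_None f g t b : t != 0 -> inW q u u' b ->
  cusp_frame Q u0 u0' f g t b None = g *m (nmx q u b *m (amx q u u' t *m (u - u'))).
Proof.
move=> t0 Wb; rewrite nmx_amx_e1// /cusp_frame.
suff -> : (fun s : R => g *m Zcusp Q u0 u0' s b)^`()%classic t =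
    (1 - t ^- 2 * bil q b b) *: (g *m u) - t ^- 2 *: (g *m (b + u')).
  rewrite mulmxBr -!scalemxAr; move: (g *m u) (g *m (b + u')) => x y.
  by apply/matrixP => i j; rewrite !mxE; field.
apply: derive1_mx => i j.
pose a : R := (g *m u) i j; pose d : R := (g *m (b + u')) i j.
have -> : (fun s : R => (g *m Zcusp Q u0 u0' s b) i j) =
   (fun s : R => s * a + s^-1 * (bil q b b * a + d)).
  apply/funext => s; rewrite /Zcusp -/q -/u -/u' /a /d.
  by rewrite !mulmxDr -!scalemxAr !mxE; ring.
have d1 : is_derive t 1 (id * cst a) (a : R).
  apply: is_derive_eq; rewrite /= /cst /GRing.scale /=; ring.
have d2 : is_derive t 1 ((fun s : R => s^-1) * cst (bil q b b * a + d))
    (- t ^- 2 * (bil q b b * a + d)).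
  have dV : is_derive t 1 (fun s : R => s^-1) (- t ^- 2).
    apply: is_derive_eq; first exact: is_deriveV.
    by rewrite /GRing.scale /= mulr1.
  apply: is_derive_eq; rewrite /= /cst /GRing.scale /=; ring.
apply: (@is_derive_eq _ _ _ _ _ _ _ _ (is_deriveD d1 d2)).
rewrite /a /d; move: (g *m u) (g *m (b + u')) => x y.
by rewrite !mxE; ring.
Qed.

Lemma cusp_frame_Some f g t b i : t != 0 -> inW q u u' b -> inW q u u' (col i f) ->
  cusp_frame Q u0 u0' f g t b (Some i) =
  g *m (nmx q u b *m (amx q u u' t *m col i f)).
Proof.
move=> t0 Wb Wf; rewrite nmx_amx_W// /cusp_frame; set v := col i f.
pose a := g *m u; pose d := g *m v.
suff -> : (fun s : R => g *m Zcusp Q u0 u0' t (b + s *: v))^`()%classic 0 =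
    t^-1 *: (d + (2 * bil q b v) *: a).
  by rewrite scalerA divff// scale1r /a /d mulmxDr -scalemxAr.
apply: derive1_mx => k j.
pose P : {poly R} := ((g *m Zcusp Q u0 u0' t b) k j)%:P +
   (t^-1 * (d k j + 2 * bil q b v * a k j)) *: 'X + (t^-1 * bil q v v * a k j) *: 'X^2.
have -> : (fun s : R => (g *m Zcusp Q u0 u0' t (b + s *: v)) k j) = horner P.
  apply/funext => s; rewrite /P !(hornerD, hornerC, hornerZ, hornerX, hornerXn).
  rewrite /Zcusp -/q -/u -/u' /a /d !bilE (bilC q_sym v b).
  rewrite !mulmxDr -!scalemxAr !mulmxDr -!scalemxAr.
  move: (g *m u) (g *m b) (g *m v) (g *m u') => x1 x2 x3 x4.
  by rewrite !mxE; ring.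
have := is_derive_poly P (0 : R); congr is_derive.
rewrite /P !derivD derivC !derivZ derivX derivXn !hornerE /= !mxE.
by ring.
Qed.

End Frames.

(** * Independence of the isometry carrying Z_0 to Z *)

Section Transport.
Variables (R : realType) (p n : nat) (q E : 'M[R]_p.+1).
Hypothesis q_sym : q^T = q.
Hypothesis q_unit : q \in unitmx.

Definition Jsign : 'M[R]_p.+1 :=
  diag_mx (\row_(j < p.+1) (if j == ord_max then -1 else 1)).

Hypothesis EJ : E^T *m q *m E = Jsign.

Lemma JsignE m k (y : 'M[R]_(p.+1, m)) (y' : 'M[R]_(p.+1, k)) a b :
  (y^T *m Jsign *m y') a b =
  \sum_(i < p) y (row_index i) a * y' (row_index i) b - y ord_max a * y' ord_max b.
Proof.
rewrite mul_mx_diag mxE big_ord_recr /=; congr (_ + _).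
  apply: eq_bigr => i _; rewrite !mxE.
  have -> : (widen_ord (leqnSn p) i == ord_max) = false.
    by apply/negbTE/eqP => /(congr1 val) /= h; have := ltn_ord i; rewrite h ltnn.
  by rewrite mulr1.
by rewrite !mxE eqxx mulrN1 mulNr.
Qed.

Lemma E_unit : E \in unitmx.
Proof.
have : \det (E^T *m q *m E) != 0.
  rewrite EJ det_diag prodf_seq_neq0; apply/allP => i _ /=.
  by rewrite mxE; case: ifP => _; rewrite ?oppr_eq0 oner_eq0.
by rewrite !det_mulmx !mulf_eq0 !negb_or => /andP[_ h]; rewrite unitmxE unitfE.
Qed.

Lemma coord_gram g m k (X : 'M[R]_(p.+1, m)) (Y : 'M[R]_(p.+1, k)) :
  orth q g -> (invmx E *m (invmx g *m X))^T *m Jsign *m (invmx E *m (invmx g *m Y)) =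
  X^T *m q *m Y.
Proof.
move=> og; have gu := orth_unit q_unit og.
rewrite -EJ !trmx_mul !mulmxA.
rewrite -[X^T *m (invmx g)^T *m (invmx E)^T *m E^T]mulmxA -(trmx_mul E) mulmxV ?E_unit// trmx1 mulmx1.
rewrite mulmxK ?E_unit//.
have := orth_inv q_unit og; rewrite /orth => h.
by rewrite -[X in _ = _ *m X *m _]h !mulmxA.
Qed.

(** The last basis vector is Z_0, of norm -1, so this coordinate sees [g] only through the point
    [g Z_0]. *)
Lemma coord_last g m (X : 'M[R]_(p.+1, m)) j : orth q g ->
  (invmx E *m (invmx g *m X)) ord_max j = - ((g *m col ord_max E)^T *m q *m X) 0 j.
Proof.
move=> og; have gu := orth_unit q_unit og.
rewrite -(coord_gram _ _ og) mulKmx// colE mulKmx ?E_unit// JsignE.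
rewrite big1; last first.
  move=> i _; rewrite mxE.
  have -> : (row_index i == ord_max) = false.
    by apply/negbTE/eqP => /(congr1 val) /= h; have := ltn_ord i; rewrite h ltnn.
  by rewrite mul0r.
by rewrite [delta_mx _ _ _ _]mxE !eqxx /= mul1r add0r opprK.
Qed.

(** Besides last coordinates, [A0] only involves sums over the first [p] coordinates. Each of these
    is an invariant pairing plus a product of last coordinates, hence depends on [g] only through
    [g Z_0]; in particular the Gaussian exponent is the majorant (x,x) + 2 (Z,x)^2 summed over the
    columns x. *)
Lemma A0_transport g g' (j k : 'I_n) X vs : orth q g -> orth q g' ->
  g *m col ord_max E = g' *m col ord_max E ->
  A0 E j k (invmx g *m X) (fun a => invmx g *m vs a) =
  A0 E j k (invmx g' *m X) (fun a => invmx g' *m vs a).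
Proof.
move=> og og' e; rewrite !A0_gram.
set y := invmx E *m (invmx g *m X); set y' := invmx E *m (invmx g' *m X).
have ly i : y ord_max i = y' ord_max i by rewrite /y /y' !coord_last// e.
have s m (Y : 'M[R]_(p.+1, m)) a b :
  \sum_(i < p) y (row_index i) a * (invmx E *m (invmx g *m Y)) (row_index i) b
  - y ord_max a * (invmx E *m (invmx g *m Y)) ord_max b =
  \sum_(i < p) y' (row_index i) a * (invmx E *m (invmx g' *m Y)) (row_index i) b
  - y' ord_max a * (invmx E *m (invmx g' *m Y)) ord_max b.
  by rewrite -!JsignE !coord_gram.
have ph : phi0 y = phi0 y'.
  rewrite /phi0; congr (expR (_ * _)); rewrite exchange_big [RHS]exchange_big /=.
  apply: eq_bigr => a _; have := s _ X a a; rewrite -/y -/y' ly => /addIr h.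
  rewrite !big_ord_recr /= ly; congr (_ + _).
  exact: h.
rewrite ly ph; congr (_ * (_ * \det (row' _ _))).
apply/matrixP => a b; rewrite !mxE.
have := s 1%N (vs b) a 0; rewrite ly.
have -> : (invmx E *m (invmx g *m vs b)) ord_max 0 = (invmx E *m (invmx g' *m vs b)) ord_max 0.
  by rewrite !coord_last// e.
move=> /addIr h; transitivity (\sum_(i < p) y (row_index i) a * (invmx E *m (invmx g *m vs b)) (row_index i) 0).
  by apply: eq_bigr => i _; congr (_ * _); exact: mxE.
by rewrite h; apply: eq_bigr => i _; congr (_ * _); symmetry; exact: mxE.
Qed.

End Transport.

(** * Expansion of the form *)

Section Expansion.
Variable R : realType.

Lemma ReD (x y : R[i]) : complex.Re (x + y) = complex.Re x + complex.Re y.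
Proof. by case: x; case: y. Qed.

Lemma ImD (x y : R[i]) : complex.Im (x + y) = complex.Im x + complex.Im y.
Proof. by case: x; case: y. Qed.

Lemma ReM (x y : R[i]) : complex.Re (x * y) =
  complex.Re x * complex.Re y - complex.Im x * complex.Im y.
Proof. by case: x; case: y. Qed.

Lemma ImM (x y : R[i]) : complex.Im (x * y) =
  complex.Re x * complex.Im y + complex.Im x * complex.Re y.
Proof. by case: x; case: y. Qed.

Lemma Re_sum (I : Type) (s : seq I) (F : I -> R[i]) :
  complex.Re (\sum_(i <- s) F i) = \sum_(i <- s) complex.Re (F i).
Proof. exact: (big_morph _ ReD erefl). Qed.

Lemma Im_sum (I : Type) (s : seq I) (F : I -> R[i]) :
  complex.Im (\sum_(i <- s) F i) = \sum_(i <- s) complex.Im (F i).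
Proof. exact: (big_morph _ ImD erefl). Qed.

Lemma normc_le (a b : R) : ComplexField.Normc.normc (a +i* b) <= `|a| + `|b|.
Proof.
rewrite /ComplexField.Normc.normc -[leRHS]ger0_norm ?addr_ge0//.
rewrite -sqrtr_sqr ler_wsqrtr// sqrrD -(real_normK (num_real a)) -(real_normK (num_real b)).
have := mulr_ge0 (normr_ge0 a) (normr_ge0 b); lra.
Qed.

Lemma sum_sym_split (V : zmodType) n (F : 'I_n -> 'I_n -> V) :
  \sum_(j < n) \sum_(k < n) F j k =
  \sum_(j < n) F j j + \sum_(j < n) \sum_(k < n | (j < k)%N) (F j k + F k j).
Proof.
have e (j : 'I_n) : \sum_k F j k =
    F j j + (\sum_(k < n | (j < k)%N) F j k + \sum_(k < n | (k < j)%N) F j k).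
  rewrite (bigD1 j)//=; congr (_ + _).
  rewrite (bigID (fun k : 'I_n => (j < k)%N)) /=; congr (_ + _); apply: eq_bigl => k.
    by case: (ltngtP j k) => h; rewrite ?andbF ?andbT// -(inj_eq val_inj) /= neq_ltn h ?orbT.
  by rewrite -leqNgt -(inj_eq val_inj) ltn_neqAle.
rewrite (eq_bigr _ (fun j _ => e j)) big_split /=; congr (_ + _).
rewrite !big_split /=; under [in RHS]eq_bigr => j _ do rewrite big_split /=.
rewrite big_split /=; congr (_ + _).
by rewrite (exchange_big_dep xpredT)//=.
Qed.

Variables (p n : nat).

(** A_jk and A_kj share the coefficient of nu_jk, so psi is a contraction with a symmetric matrix,
    the shape on which the divergence identity rests. *)
Definition psi_coef (tau H : 'M[R[i]]_n) : 'M[R[i]]_n :=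
  \matrix_(j, k) ('i * (2 `^ (n%:R / 2))%:C *
    (if j == k then nu_at tau j j H
     else 3 / 4 * (if (j < k)%N then nu_at tau j k H else nu_at tau k j H))).

Lemma psi_coef_sym tau H : (psi_coef tau H)^T = psi_coef tau H.
Proof.
apply/matrixP => j k; rewrite !mxE; congr (_ * _); rewrite eq_sym.
case: (eqVneq j k) => [->//|jk]; congr (_ * _).
by case: (ltngtP j k) => // /val_inj e; rewrite e eqxx in jk.
Qed.

Lemma psi_expand Q (E : 'M[R]_p.+1) tau X Z vs (H : 'M[R[i]]_n) :
  psi Q E tau X Z vs H =
  cis (pi * \tr (reM tau *m (X^T *m toR Q *m X))) *
  \sum_j \sum_k psi_coef tau H j k *
     (A_at Q E j k (X *m sqrtmx (imM tau)) Z vs)%:C.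
Proof.
rewrite sum_sym_split /psi; set ci := cis _; set k0 := 'i * _.
rewrite mulrDr [RHS]mulrDr; congr (_ + _).
  rewrite !mulr_sumr; apply: eq_bigr => j _.
  by rewrite [psi_coef _ _ _ _]mxE eqxx -/k0; ring.
rewrite !mulr_sumr; apply: eq_bigr => j _; rewrite !mulr_sumr; apply: eq_bigr => k jk.
have e1 : (j == k) = false by apply/negbTE/eqP => e; rewrite e ltnn in jk.
rewrite -[in psi_coef _ _ k j]psi_coef_sym [(psi_coef _ _)^T _ _]mxE.
by rewrite [psi_coef _ _ _ _]mxE e1 jk -/k0; ring.
Qed.

Definition reC (C : 'M[R[i]]_n) : 'M[R]_n := map_mx (@complex.Re R) C.
Definition imC (C : 'M[R[i]]_n) : 'M[R]_n := map_mx (@complex.Im R) C.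

Lemma psi_Re Q (E : 'M[R]_p.+1) tau X Z vs (H : 'M[R[i]]_n) :
  let th := pi * \tr (reM tau *m (X^T *m toR Q *m X)) in
  let S c := \sum_j \sum_k c j k * A_at Q E j k (X *m sqrtmx (imM tau)) Z vs in
  complex.Re (psi Q E tau X Z vs H) =
    cos th * S (reC (psi_coef tau H)) - sin th * S (imC (psi_coef tau H)) /\
  complex.Im (psi Q E tau X Z vs H) =
    cos th * S (imC (psi_coef tau H)) + sin th * S (reC (psi_coef tau H)).
Proof.
move=> th S; rewrite psi_expand -/th; set C := psi_coef tau H; set W := \sum_j _.
have r : complex.Re W = S (reC C).
  rewrite /W Re_sum; apply: eq_bigr => j _; rewrite Re_sum; apply: eq_bigr => k _.
  by rewrite ReM /= mulr0 subr0 [reC _ _ _]mxE.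
have i : complex.Im W = S (imC C).
  rewrite /W Im_sum; apply: eq_bigr => j _; rewrite Im_sum; apply: eq_bigr => k _.
  by rewrite ImM /= mulr0 add0r [imC _ _ _]mxE.
by rewrite ReM ImM /= r i.
Qed.

Lemma reC_sym C : C^T = C -> (reC C)^T = reC C.
Proof. by move=> h; rewrite /reC map_trmx h. Qed.

Lemma imC_sym C : C^T = C -> (imC C)^T = imC C.
Proof. by move=> h; rewrite /imC map_trmx h. Qed.

End Expansion.

Lemma sum_A0 (R : realType) p n (E : 'M[R]_p.+2) (c : 'M[R]_n.+1)
    (X : 'M[R]_(p.+2, n.+1)) (vs : 'I_n -> 'cV[R]_p.+2) :
  \sum_j \sum_k c j k * A0 E j k X vs =
  psi_real (\matrix_(i < p.+1, b < n) (invmx E *m vs b) (row_index i) 0) c (invmx E *m X).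
Proof.
rewrite /psi_real mulr_sumr; apply: eq_bigr => j _.
rewrite det_row_mx_expand !mulr_sumr; apply: eq_bigr => k _.
rewrite A0_gram /= !mxE.
set d := \det _; move: d => d; ring.
Qed.

(** [g1] witnesses that the set from which [transporter] chooses is nonempty, so the default
    identity is not returned; the chosen element may then be replaced by a convenient [g]. *)
Lemma A_at_transport (R : realType) p n (Q : 'M[rat]_p.+1) (E : 'M[R]_p.+1) (g g1 : 'M[R]_p.+1)
    (j k : 'I_n) X Z vs :
  Q^T = Q -> Q \in unitmx -> E^T *m toR Q *m E = Jsign R p ->
  SO0 Q g1 -> g1 *m col ord_max E = Z -> orth (toR Q) g -> g *m col ord_max E = Z ->
  A_at Q E j k X Z vs = A0 E j k (invmx g *m X) (fun a => invmx g *m vs a).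
Proof.
move=> Qs Qu EJ h1 e1 og e; rewrite /A_at.
have [hT eT] : [set g | SO0 Q g /\ g *m col ord_max E = Z] (transporter Q E Z).
  by apply: xgetPex; exists g1.
have [oT _] := SO0_orth hT.
apply: (@A0_transport _ _ _ (toR Q)) => //.
- by rewrite /toR map_unitmx.
- by rewrite eT e.
Qed.

Lemma adapted_gram (R : realType) p (Q : 'M[rat]_p.+2) u0 u0' (E : 'M[R]_p.+2) :
  Q^T = Q -> bil Q u0 u0 = 0 -> bil Q u0' u0' = 0 -> bil Q u0 u0' = - (1 / 2) ->
  is_adapted_basis Q u0 u0' E -> E^T *m toR Q *m E = Jsign R p.+1.
Proof.
move=> Qs h1 h2 h3 [E0 Em EW EO].
have q_sym : (toR Q : 'M[R]_p.+2)^T = toR Q by rewrite /toR map_trmx Qs.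
pose q : 'M[R]_p.+2 := toR Q; pose u : 'cV[R]_p.+2 := toR u0; pose u' : 'cV[R]_p.+2 := toR u0'.
have bR x y : bil q (toR x) (toR y) = ratr (bil Q x y).
  by rewrite /bil /q /toR map_trmx -!map_mxM mxE.
have uu : bil q u u = 0 by rewrite bR h1 rmorph0.
have u'u' : bil q u' u' = 0 by rewrite bR h2 rmorph0.
have uu' : bil q u u' = - 2^-1 by rewrite bR h3 rmorphN div1r fmorphV rmorph_nat.
have u'u : bil q u' u = - 2^-1 by rewrite bilC.
have e0 : col ord0 E = u - u' by rewrite E0 /toR map_mxB.
have em : col ord_max E = u + u' by rewrite Em /toR map_mxD.
have entry i j : (E^T *m toR Q *m E) i j = bil q (col i E) (col j E).
  have e (A : 'M[R]_p.+2) : A i j =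
      ((delta_mx 0 i : 'rV_p.+2) *m A *m (delta_mx j 0 : 'cV_p.+2)) 0 0.
    by rewrite -rowE -colE !mxE.
  by rewrite e /bil !colE trmx_mul trmx_delta !mulmxA.
have cas (i : 'I_p.+2) : [\/ i = ord0, i = ord_max | (0 < i < p.+1)%N].
  case: (eqVneq i ord0) => [->|i0]; first by constructor 1.
  case: (eqVneq i ord_max) => [->|im]; first by constructor 2.
  constructor 3; move: i0 im; rewrite -!(inj_eq val_inj) /= => i0 im.
  by rewrite lt0n i0 ltn_neqAle im -ltnS ltn_ord.
have n0 (i : 'I_p.+2) : (0 < i < p.+1)%N -> (i == ord0) = false.
  by move=> /andP[h _]; apply/negbTE/eqP => e; rewrite e in h.
have nm (i : 'I_p.+2) : (0 < i < p.+1)%N -> (i == ord_max) = false.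
  by move=> /andP[_ h]; apply/negbTE/eqP => e; rewrite e ltnn in h.
have W (i : 'I_p.+2) : (0 < i < p.+1)%N -> bil q u (col i E) = 0 /\ bil q u' (col i E) = 0.
  by move=> /EW.
have W' (i : 'I_p.+2) : (0 < i < p.+1)%N -> bil q (col i E) u = 0 /\ bil q (col i E) u' = 0.
  by move=> /W; rewrite (bilC q_sym u) (bilC q_sym u').
have om : (ord_max == ord0 :> 'I_p.+2) = false by [].
apply/matrixP => i j; rewrite entry /Jsign [RHS]mxE [in RHS]mxE.
case: (cas i) => [->|->|hi]; case: (cas j) => [->|->|hj].
- rewrite e0 !bilE uu u'u' uu' u'u; rewrite eqxx /= mulr1n; lra.
- rewrite e0 em !bilE uu u'u' uu' u'u eq_sym om mulr0n; lra.
- have [w1 w2] := W j hj; rewrite e0 !bilE w1 w2 [ord0 == j]eq_sym (n0 j hj) mulr0n; lra.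
- rewrite e0 em !bilE uu u'u' uu' u'u om mulr0n; lra.
- rewrite em !bilE uu u'u' uu' u'u !eqxx mulr1n; lra.
- have [w1 w2] := W j hj; rewrite em !bilE w1 w2 [ord_max == j]eq_sym (nm j hj) mulr0n; lra.
- have [w1 w2] := W' i hi; rewrite e0 !bilE w1 w2 (n0 i hi) mulr0n; lra.
- have [w1 w2] := W' i hi; rewrite em !bilE w1 w2 (nm i hi) mulr0n; lra.
- by rewrite EO// (nm i hi); case: (i == j).
Qed.

(** * Symmetries of the lattice coset *)

Section LatticeCoset.
Variables (R : realType) (m n : nat) (L : set 'cV[rat]_m) (h : 'M[rat]_(m, n)).
Hypothesis L_lattice : is_lattice L.

Lemma toR_inj k l : injective (@toR R k l).
Proof.
move=> A B /matrixP e; apply/matrixP => i j; have := e i j; rewrite !mxE.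
exact: fmorph_inj.
Qed.

Lemma latticeD x y : L x -> L y -> L (x + y).
Proof.
have [A _ ->] := L_lattice; move=> [c _ <-] [d _ <-]; exists (c + d) => //.
by rewrite map_mxD mulmxDr.
Qed.

Lemma latticeN x : L x -> L (- x).
Proof.
have [A _ ->] := L_lattice; move=> [c _ <-]; exists (- c) => //.
by rewrite map_mxN mulmxN.
Qed.

Lemma coset_add v i X : L v -> lattice_coset L h X ->
  lattice_coset L h (X + v *m (delta_mx 0 i : 'rV_n)).
Proof.
move=> Lv hX j; have := hX j.
have -> : col j (X + v *m (delta_mx 0 i : 'rV_n) - h) = col j (X - h) + (i == j)%:R *: v.
  apply/colP => k; rewrite !mxE big_ord1 !mxE eqxx /= eq_sym; ring.
case: eqP => _; last by rewrite scale0r addr0.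
by rewrite scale1r => hj; exact: latticeD.
Qed.

Lemma coset_shift_bij v i : L v ->
  set_bij (lattice_coset L h) (lattice_coset L h)
    (fun X => X + v *m (delta_mx 0 i : 'rV_n)).
Proof.
move=> Lv; split.
- by move=> X; exact: coset_add.
- by move=> X Y _ _ /addIr.
- move=> X hX; exists (X - v *m (delta_mx 0 i : 'rV_n)); last by rewrite subrK.
  by rewrite -mulNmx; apply: coset_add => //; exact: latticeN.
Qed.

(** A lattice basis and its image are both rational, so [g] is a quotient of rational matrices. This
    lets Gamma act on the rational index set of the theta series. *)
Lemma stab_rational (g : 'M[R]_m) :
  [set g *m x | x in [set toR y | y in L]] = [set toR y | y in L] ->
  exists2 A : 'M[rat]_m, toR A = g & forall x, L x -> L (A *m x).
Proof.
move=> st; have [A Au LA] := L_lattice.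
have img x : L x -> exists2 y, L y & g *m toR x = toR y.
  move=> Lx; have : [set toR y | y in L] (g *m toR x).
    by rewrite -st; exists (toR x) => //; exists x.
  by move=> [y Ly <-]; exists y.
have Lc j : L (col j A).
  rewrite LA; exists (delta_mx j 0) => //; rewrite colE; congr (_ *m _).
  by apply/matrixP => a b; rewrite !mxE; case: (_ && _).
pose c j := s2val (cid2 (img _ (Lc j))).
have hc j : g *m toR (col j A) = toR (c j) := s2valP' (cid2 (img _ (Lc j))).
pose C : 'M[rat]_m := \matrix_(i, j) c j i 0.
have gA : g *m toR A = toR C.
  apply/matrixP => i j; have /colP/(_ i) := hc j; rewrite !mxE => <-.
  by apply: eq_bigr => k _; rewrite !mxE.
have e : toR (C *m invmx A) = g.
  by rewrite /toR map_mxM map_invmx -/(toR C) -gA mulmxK// map_unitmx.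
exists (C *m invmx A) => // x Lx; have [y Ly] := img x Lx.
by rewrite -e /toR -map_mxM => /toR_inj ->.
Qed.

End LatticeCoset.

Lemma coset_act_bij (R : realType) p n (Q : 'M[rat]_p.+1) (L : set 'cV[rat]_p.+1)
    (h : 'M[rat]_(p.+1, n)) (Gam : set 'M[R]_p.+1) (g : 'M[R]_p.+1) :
  is_lattice L -> finite_index_subgroup Gam (lattice_stabilizer Q L) ->
  trivial_on_discriminant Q L Gam -> (forall j, dual_lattice Q L (col j h)) ->
  Gam g -> g \in unitmx ->
  exists2 A : 'M[rat]_p.+1, toR A = g &
    set_bij (lattice_coset L h) (lattice_coset L h) (fun X => A *m X).
Proof.
move=> Ll [Gsub _ _ Ginv _] triv hd.
have act g' : Gam g' -> exists2 A : 'M[rat]_p.+1, toR A = g' &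
    forall X, lattice_coset L h X -> lattice_coset L h (A *m X).
  move=> Gg; have [_ st] := Gsub _ Gg; have [A Ag LA] := stab_rational Ll st.
  exists A => // X hX j.
  (* The first summand stays in [L], and the second lies in [L] because Gamma acts trivially on the
     discriminant group. *)
  have -> : col j (A *m X - h) = A *m col j (X - h) + (A *m col j h - col j h).
    have colB (M N : 'M[rat]_(p.+1, n)) : col j (M - N) = col j M - col j N.
      by apply/colP => k; rewrite !mxE.
    by rewrite !colB mulmxBr addrA subrK !colE mulmxA.
  apply: latticeD => //; first by apply: LA; exact: hX.
  have [y Ly] := triv _ _ Gg (hd j).
  by rewrite -Ag /toR -map_mxM -map_mxB => /toR_inj ->.
move=> Gg gu; have [A Ag hA] := act _ Gg; have [A' Ag' hA'] := act _ (Ginv _ Gg).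
have AA' : A *m A' = 1%:M.
  apply: (@toR_inj R); rewrite /toR map_mxM -!/(toR _) Ag Ag' mulmxV//.
  by rewrite /toR map_mx1.
have A'A : A' *m A = 1%:M by apply: mulmx1C.
exists A => //; split => //.
- by move=> X Y _ _ e; rewrite -[X]mul1mx -[Y]mul1mx -A'A -!mulmxA e.
- move=> X hX; exists (A' *m X); first exact: hA'.
  by rewrite mulmxA AA' mul1mx.
Qed.

(** * Rapid decrease *)

Lemma posdef_unit (R : realType) n (r : 'M[R]_n) : posdef r -> r \in unitmx.
Proof.
move=> [rs rp]; rewrite -row_free_unit -kermx_eq0; apply/eqP.
apply/row_matrixP => i; rewrite row0; apply/eqP; apply/negPn/negP => k0.
have := rp (row i (kermx r))^T; rewrite trmxK trmx_eq0 => /(_ k0).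
by rewrite -row_mul mulmx_ker row0 mul0mx mxE ltxx.
Qed.

Lemma compact_n1 (R : realType) p (A : set 'cV[R]_p.+2) : compact A ->
  exists K : R, forall b, A b -> n1 b <= K.
Proof.
move=> /compact_bounded [M [_ hM]].
exists (\sum_(i < p.+2) \sum_(j < 1) (M + 1)) => b Ab.
have MM : M < M + 1 by rewrite ltrDl.
have := hM _ MM b Ab => /= hb.
apply: ler_sum => i _; apply: ler_sum => j _.
apply: le_trans hb; have -> : `|b| = \big[Num.max/0]_ij `|b ij.1 ij.2|.
  exact: mx_normrE.
exact: (le_bigmax _ (fun ij => `|b ij.1 ij.2|) (i, j)).
Qed.

(** * The theta series: convergence, invariance, decay at a cusp *)

Section Theta.
Variables (R : realType) (p n : nat) (Q : 'M[rat]_p.+2).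
Hypothesis Q_sym : Q^T = Q.
Hypothesis Q_unit : Q \in unitmx.
Variable L : set 'cV[rat]_p.+2.
Hypothesis L_lattice : is_lattice L.
Variable h : 'M[rat]_(p.+2, n.+1).
Variable E : 'M[R]_p.+2.
Hypothesis EJ : E^T *m toR Q *m E = Jsign R p.+1.
Variable tau : 'M[R[i]]_n.+1.
Local Notation r := (sqrtmx (imM tau)).
Hypothesis r_unit : r \in unitmx.

Let q : 'M[R]_p.+2 := toR Q.
Let q_sym : q^T = q. Proof. by rewrite /q /toR map_trmx Q_sym. Qed.
Let q_unit : q \in unitmx. Proof. by rewrite /q /toR map_unitmx. Qed.
Let D := lattice_coset L h.
Let l := (2 * (p.+2 * n.+1))%N.

Definition weight (X : 'M[rat]_(p.+2, n.+1)) : R := (1 + n1 (toR X : 'M[R]_(p.+2, n.+1))) ^- l.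

Definition coord (g : 'M[R]_p.+2) (X : 'M[rat]_(p.+2, n.+1)) : 'M[R]_(p.+2, n.+1) :=
  invmx E *m (invmx g *m (toR X *m r)).

Definition frame (g : 'M[R]_p.+2) (vs : 'I_n -> 'cV[R]_p.+2) : 'M[R]_(p.+1, n) :=
  \matrix_(i, b) (invmx E *m (invmx g *m vs b)) (row_index i) 0.

Lemma weight_ge0 X : 0 <= weight X.
Proof. by rewrite /weight invr_ge0 exprn_ge0// addr_ge0// n1_ge0. Qed.

Lemma weight_sum : (\esum_(X in D) (weight X)%:E < +oo)%E.
Proof. exact: esum_lattice_coset. Qed.

(** Solving for [X = g E y r^-1] bounds [1 + n1 X] by [K (1 + n1 y)], where [K >= 1] takes care of
    the summand 1. *)
Lemma n1_coord (K : R) g X : orth q g -> 1 <= K -> n1 g * n1 E * n1 (invmx r) <= K ->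
  (1 + n1 (coord g X)) ^- l <= K ^+ l * weight X.
Proof.
move=> og K1 hK; have gu := orth_unit q_unit og; have Eu := E_unit EJ.
have K0 : 0 <= K by exact: le_trans ler01 K1.
have y0 := n1_ge0 (coord g X).
have e : toR X = g *m E *m coord g X *m invmx r.
  by rewrite /coord -!mulmxA !mulKVmx// mulmxA mulmxK.
have hX : n1 (toR X : 'M[R]_(p.+2, n.+1)) <= K * n1 (coord g X).
  rewrite {1}e (le_trans (n1_mul _ _))//.
  apply: (@le_trans _ _ ((n1 g * n1 E * n1 (coord g X)) * n1 (invmx r))).
    rewrite ler_wpM2r ?n1_ge0// (le_trans (n1_mul _ _))// ler_wpM2r ?n1_ge0//.
    exact: n1_mul.
  by rewrite mulrAC ler_wpM2r.
have X0 := n1_ge0 (toR X : 'M[R]_(p.+2, n.+1)).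
rewrite /weight -[leLHS]mul1r ler_pdivrMr ?exprn_gt0 ?ltr_pwDl//.
rewrite mulrAC ler_pdivlMr ?exprn_gt0 ?ltr_pwDl// mul1r -exprMn.
rewrite lerXn2r ?nnegrE ?mulr_ge0 ?addr_ge0//; lra.
Qed.

Lemma sum_A_at (c : 'M[R]_n.+1) (g g1 : 'M[R]_p.+2) X Z vs :
  SO0 Q g1 -> g1 *m col ord_max E = Z -> orth q g -> g *m col ord_max E = Z ->
  \sum_j \sum_k c j k * A_at Q E j k (toR X *m r) Z vs =
  psi_real (frame g vs) c (coord g X).
Proof.
move=> h1 e1 og e; rewrite -[RHS]sum_A0; apply: eq_bigr => j _; apply: eq_bigr => k _.
by congr (_ * _); apply: (A_at_transport (g1 := g1)).
Qed.

Lemma psi_real_dominated g V c (rho : 'M[rat]_(p.+2, n.+1) -> R) : orth q g ->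
  (forall X, `|rho X| <= 1) -> exists2 C, 0 <= C &
  dominated D weight (fun X => rho X * psi_real V c (coord g X)) C.
Proof.
move=> og hr; have [C1 C10 h1] := psi_real_decay V c l.
pose K := 1 + n1 g * n1 E * n1 (invmx r).
have k0 : 0 <= n1 g * n1 E * n1 (invmx r) by rewrite !mulr_ge0 ?n1_ge0.
have K1 : 1 <= K by rewrite lerDl.
have hw X := @n1_coord K g X og K1 (ler_wpDl ler01 (lexx _)).
exists (C1 * K ^+ l); first by rewrite mulr_ge0 ?exprn_ge0 ?(le_trans ler01 K1).
move=> X _; rewrite normrM -[leRHS]mul1r ler_pM// (le_trans (h1 _))//.
by rewrite -mulrA ler_wpM2l.
Qed.

Definition phase (X : 'M[rat]_(p.+2, n.+1)) : R :=
  pi * \tr (reM tau *m ((toR X)^T *m q *m toR X)).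

Lemma psi_parts g g1 Z vs H :
  SO0 Q g1 -> g1 *m col ord_max E = Z -> orth q g -> g *m col ord_max E = Z ->
  let c1 := reC (psi_coef tau H) in let c2 := imC (psi_coef tau H) in
  let P c X := psi_real (frame g vs) c (coord g X) in
  (fun X => complex.Re (psi Q E tau (toR X) Z vs H)) =
    (fun X => cos (phase X) * P c1 X + - sin (phase X) * P c2 X) /\
  (fun X => complex.Im (psi Q E tau (toR X) Z vs H)) =
    (fun X => cos (phase X) * P c2 X + sin (phase X) * P c1 X).
Proof.
move=> h1 e1 og e /=; split; apply/funext => X; have [eR eI] := psi_Re Q E tau (toR X) Z vs H.
  by rewrite eR !(sum_A_at _ _ _ h1 e1 og e) mulNr.
by rewrite eI !(sum_A_at _ _ _ h1 e1 og e).
Qed.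

Lemma dominated_add F G C C' : 0 <= C -> 0 <= C' -> dominated D weight F C ->
  dominated D weight G C' -> dominated D weight (fun X => F X + G X) (C + C').
Proof.
move=> C0 C'0 hF hG X DX; rewrite (le_trans (ler_normD _ _))// mulrDl.
by rewrite lerD// ?hF ?hG.
Qed.

Lemma psi_csummable g Z vs H : SO0 Q g -> g *m col ord_max E = Z ->
  csummable D (fun X => psi Q E tau (toR X) Z vs H).
Proof.
move=> hg e; have [og _] := SO0_orth hg.
have [eR eI] := psi_parts vs H hg e og e.
have cb X : `|cos (phase X)| <= 1 by exact: cos_max.
have sb X : `|sin (phase X)| <= 1 by exact: sin_max.
have nsb X : `|- sin (phase X)| <= 1 by rewrite normrN.
split.
  rewrite -[X in summable _ X]/(fun x => ((fun X => complex.Re (psi Q E tau (toR X) Z vs H)) x)%:E) eR.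
  have [C C0 hC] := psi_real_dominated (frame g vs) (reC (psi_coef tau H)) og cb.
  have [C' C'0 hC'] := psi_real_dominated (frame g vs) (imC (psi_coef tau H)) og nsb.
  apply: (summable_dom weight_ge0 weight_sum (addr_ge0 C0 C'0)).
  exact: dominated_add.
rewrite -[X in summable _ X]/(fun x => ((fun X => complex.Im (psi Q E tau (toR X) Z vs H)) x)%:E) eI.
have [C C0 hC] := psi_real_dominated (frame g vs) (imC (psi_coef tau H)) og cb.
have [C' C'0 hC'] := psi_real_dominated (frame g vs) (reC (psi_coef tau H)) og sb.
apply: (summable_dom weight_ge0 weight_sum (addr_ge0 C0 C'0)).
exact: dominated_add.
Qed.

(** [A g1] carries Z_0 to [A Z], and with this choice the coordinates of [A X] at [A Z] are those of
    [X] at [Z]; the phase depends on (X,X) only. *)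
Lemma psi_act (A : 'M[rat]_p.+2) g1 g2 X Z vs H :
  SO0 Q (toR A : 'M[R]_p.+2) ->
  SO0 Q g1 -> g1 *m col ord_max E = Z ->
  SO0 Q g2 -> g2 *m col ord_max E = toR A *m Z ->
  psi Q E tau (toR (A *m X)) (toR A *m Z) (fun a => toR A *m vs a) H =
  psi Q E tau (toR X) Z vs H.
Proof.
move=> hA h1 e1 h2 e2; have [hoA _] := SO0_orth hA.
have [ho1 _] := SO0_orth h1.
have Au := orth_unit q_unit hoA; have g1u := orth_unit q_unit ho1.
have ph : (toR (A *m X))^T *m q *m toR (A *m X) = (toR X)^T *m q *m toR X :> 'M[R]_n.+1.
  have hoA' : (toR A)^T *m q *m toR A = q := hoA.
  by rewrite /toR map_mxM -!/(toR _) trmx_mul -[X in _ = _ *m X *m _]hoA' !mulmxA.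
have og : orth q (toR A *m g1) by apply: orthM.
have eg : toR A *m g1 *m col ord_max E = toR A *m Z by rewrite -mulmxA e1.
rewrite !psi_expand ph; congr (_ * _); apply: eq_bigr => j _; apply: eq_bigr => k _.
congr (_ * _%:C).
rewrite (A_at_transport (g := toR A *m g1) j k _ _ Q_sym Q_unit EJ h2 e2 og eg).
rewrite (A_at_transport (g := g1) j k _ _ Q_sym Q_unit EJ h1 e1 ho1 e1).
have Pu : toR A *m g1 \in unitmx by rewrite unitmx_mul Au.
have iM m (x : 'M[R]_(p.+2, m)) : invmx (toR A *m g1) *m (toR A *m x) = invmx g1 *m x.
  by rewrite -{1}[x](mulKVmx g1u) [toR A *m (g1 *m _)]mulmxA mulKmx.
have -> : (fun a => invmx (toR A *m g1) *m (toR A *m vs a)) = (fun a => invmx g1 *m vs a).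
  by apply/funext => a; rewrite iM.
by rewrite /toR map_mxM -!/(toR _) -mulmxA iM.
Qed.

Lemma csum_reindex (e : 'M[rat]_(p.+2, n.+1) -> 'M[rat]_(p.+2, n.+1))
    (F : 'M[rat]_(p.+2, n.+1) -> R[i]) :
  set_bij D D e -> csum D (fun X => F (e X)) = csum D F.
Proof.
move=> be; rewrite /csum; congr (_ +i* _).
  exact: (rsum_reindex (fun X => complex.Re (F X)) be).
exact: (rsum_reindex (fun X => complex.Im (F X)) be).
Qed.

Variables (u0 u0' : 'cV[rat]_p.+2).
Let u : 'cV[R]_p.+2 := toR u0.
Let u' : 'cV[R]_p.+2 := toR u0'.
Hypothesis u0_iso : bil Q u0 u0 = 0.
Hypothesis u0'_iso : bil Q u0' u0' = 0.
Hypothesis u0_u0' : bil Q u0 u0' = - (1 / 2).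
Hypothesis E_first : col ord0 E = toR (u0 - u0').
Hypothesis E_last : col ord_max E = toR (u0 + u0').

Lemma bil_toR x y : bil q (toR x) (toR y) = ratr (bil Q x y).
Proof. by rewrite /bil /q /toR map_trmx -!map_mxM mxE. Qed.

Let uu : bil q u u = 0. Proof. by rewrite bil_toR u0_iso rmorph0. Qed.
Let u'u' : bil q u' u' = 0. Proof. by rewrite bil_toR u0'_iso rmorph0. Qed.
Let uu' : bil q u u' = - 2^-1.
Proof. by rewrite bil_toR u0_u0' rmorphN div1r fmorphV rmorph_nat. Qed.
Let em : col ord_max E = u + u'. Proof. by rewrite E_last /toR map_mxD. Qed.
Let e0 : col ord0 E = u - u'. Proof. by rewrite E_first /toR map_mxB. Qed.

Definition cusp_elt (G : 'M[R]_p.+2) (t : R) (b : 'cV[R]_p.+2) : 'M[R]_p.+2 :=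
  G *m nmx q u b *m amx q u u' t.

Lemma SO0_cusp_elt G t b : SO0 Q G -> 0 < t -> inW q u u' b -> SO0 Q (cusp_elt G t b).
Proof.
move=> hG t0 Wb; apply: (SO0_amx Q_sym Q_unit uu u'u' uu') => //.
exact: (SO0_nmx Q_sym Q_unit uu hG Wb).
Qed.

Lemma cusp_elt_Z0 G t b : 0 < t -> inW q u u' b ->
  cusp_elt G t b *m col ord_max E = G *m Zcusp Q u0 u0' t b.
Proof.
move=> t0 Wb; rewrite /cusp_elt em -!mulmxA nmx_amx_Z0// ?gt_eqF//.
Qed.

Lemma SO0_1 : SO0 Q (1%:M : 'M[R]_p.+2).
Proof.
by apply: connected_component_refl; split; rewrite ?det1// trmx1 mul1mx mulmx1.
Qed.

(** Transitivity of the identity component on B, by explicit horospherical elements; it makes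
    [transporter] meaningful at every point. *)
Lemma hyperboloid_transporter G Z : SO0 Q G -> bil q Z Z = -1 -> bil q u Z < 0 ->
  exists2 g, SO0 Q g & g *m col ord_max E = G *m Z.
Proof.
move=> hG ZZ uZ; have [t [b [t0 Wb ->]]] := hyperboloid_Zc q_sym uu u'u' uu' ZZ uZ.
by exists (cusp_elt G t b); [exact: SO0_cusp_elt|rewrite cusp_elt_Z0].
Qed.

Lemma invmxE_u : invmx E *m u = 2^-1 *: (delta_mx ord0 0 + delta_mx ord_max 0).
Proof.
have Eu := E_unit EJ; rewrite -[RHS](mulKmx Eu); congr (_ *m _).
by rewrite -scalemxAr mulmxDr -!colE e0 em; apply/colP => i; rewrite !mxE; field.
Qed.

(** * Estimates at a single cusp *)

Variables (G : 'M[rat]_p.+2) (uj : 'cV[rat]_p.+2).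
Hypothesis G_SO0 : SO0 Q (toR G : 'M[R]_p.+2).
Hypothesis G_u : G *m u0 = uj.
Hypothesis L_uj : L uj.
Hypothesis uj_int : forall X i, D X -> (uj^T *m Q *m X) 0 i \is a Num.int.

Let uj_iso : bil Q uj uj = 0.
Proof.
have : ratr (bil Q uj uj) = 0 :> R.
  rewrite -bil_toR -G_u /toR map_mxM -!/(toR _).
  by have [hoG _] := SO0_orth G_SO0; rewrite (orthE _ _ hoG).
by move/eqP; rewrite fmorph_eq0 => /eqP.
Qed.

Let gt t b := cusp_elt (toR G) t b.

Lemma cusp_elt_u t b : t != 0 -> inW q u u' b -> gt t b *m u = t *: toR uj.
Proof.
move=> t0 Wb; rewrite /gt /cusp_elt -!mulmxA nmx_amx_u// -scalemxAr.
by rewrite -G_u /toR map_mxM.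
Qed.

Let beta (X : 'M[rat]_(p.+2, n.+1)) : 'rV[rat]_n.+1 := uj^T *m Q *m X.

(** In the coordinates, u_j becomes [(e_1 + e_m) / (2 t)], whose Lorentzian pairing with [y] is
    [(y_1 - y_m) / (2 t)]. So (u_j, X) = 0 is the hyperplane of the divergence identity, and
    otherwise [y] is at least of order [t]. *)
Lemma coord_beta t b X a : 0 < t -> inW q u u' b ->
  coord (gt t b) X ord0 a - coord (gt t b) X ord_max a =
  2 * t * (toR (beta X) *m r) 0 a.
Proof.
move=> t0 Wb; have tn0 : t != 0 by rewrite gt_eqF.
have [og _] := SO0_orth (SO0_cusp_elt G_SO0 t0 Wb); have gu := orth_unit q_unit og.
have := coord_gram q_unit EJ (toR uj) (toR X *m r) og.
pose cf : 'cV[R]_p.+2 := (t^-1 * 2^-1) *: (delta_mx ord0 0 + delta_mx ord_max 0).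
have cfE i : cf i 0 = t^-1 * 2^-1 * ((i == ord0)%:R + (i == ord_max)%:R).
  by rewrite !mxE eqxx !andbT.
have -> : invmx E *m (invmx (gt t b) *m toR uj) = cf.
  have -> : toR uj = t^-1 *: (gt t b *m u).
    by rewrite cusp_elt_u// scalerA mulVf// scale1r.
  by rewrite -!scalemxAr mulKmx// invmxE_u scalerA.
move=> /matrixP/(_ 0 a); rewrite JsignE -/(coord (gt t b) X).
have -> : \sum_(i < p.+1) cf (row_index i) 0 * coord (gt t b) X (row_index i) a =
    t^-1 * 2^-1 * coord (gt t b) X ord0 a.
  have nmax (i : 'I_p.+1) : (row_index i == ord_max) = false.
    by apply/negbTE/eqP => /(congr1 val) /= hi; have := ltn_ord i; rewrite hi ltnn.
  rewrite big_ord_recl big1 ?addr0; last first.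
    move=> i _; rewrite cfE nmax (_ : (row_index (lift ord0 i) == ord0) = false)//.
    by rewrite addr0 mulr0 mul0r.
  have -> : row_index (ord0 : 'I_p.+1) = ord0 by apply: val_inj.
  by rewrite cfE eqxx (_ : (ord0 == ord_max :> 'I_p.+2) = false)// addr0 mulr1.
rewrite cfE eqxx (_ : (ord_max == ord0 :> 'I_p.+2) = false)// add0r mulr1.
have -> : (toR uj)^T *m q *m (toR X *m r) = toR (beta X) *m r.
  by rewrite mulmxA /beta /toR !map_mxM map_trmx.
by move=> <-; field.
Qed.

Lemma beta_shift X i : beta (X + uj *m (delta_mx 0 i : 'rV_n.+1)) = beta X.
Proof.
rewrite /beta mulmxDr mulmxA [uj^T *m Q *m uj]mx11_scalar -/(bil Q uj uj) uj_iso.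
by rewrite mul_scalar_mx scale0r addr0.
Qed.

(** The change of (X,X) is made of pairings of [uj] with X and with itself, all zero. *)
Lemma phase_shift X i : beta X = 0 ->
  phase (X + uj *m (delta_mx 0 i : 'rV_n.+1)) = phase X.
Proof.
move=> b0; rewrite /phase; congr (_ * \tr (_ *m _)).
have hb Y : (toR Y)^T *m q *m toR Y = toR (Y^T *m Q *m Y) :> 'M[R]_n.+1.
  by rewrite /toR !map_mxM map_trmx.
pose e : 'rV[rat]_n.+1 := delta_mx 0 i.
rewrite !hb; congr toR; set Y := X + _.
have YT : Y^T = X^T + e^T *m uj^T by rewrite /Y -trmx_mul; apply/matrixP => x y; rewrite !mxE.
have s1 : e^T *m uj^T *m Q *m Y = 0.
  by rewrite -[e^T *m uj^T *m Q]mulmxA -mulmxA -/(beta Y) beta_shift b0 mulmx0.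
have s2 : X^T *m Q *m (uj *m e) = 0.
  have b2 : X^T *m Q *m uj = 0.
    by apply: trmx_inj; rewrite trmx0 -b0 /beta !trmx_mul trmxK Q_sym mulmxA.
  by rewrite mulmxA b2 mul0mx.
by rewrite YT mulmxDl mulmxDl s1 addr0 /Y mulmxDr s2 addr0.
Qed.

Lemma cusp_dir_shift t b X i : 0 < t -> inW q u u' b ->
  coord (gt t b) (X + uj *m (delta_mx 0 i : 'rV_n.+1)) =
  coord (gt t b) X + t^-1 *: cusp_dir p r i.
Proof.
move=> t0 Wb; have tn0 : t != 0 by rewrite gt_eqF.
have [og _] := SO0_orth (SO0_cusp_elt G_SO0 t0 Wb); have gu := orth_unit q_unit og.
rewrite /coord /toR map_mxD map_mxM -!/(toR _) mulmxDl !mulmxDr; congr (_ + _).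
have -> : toR uj = t^-1 *: (gt t b *m u).
  by rewrite cusp_elt_u// scalerA mulVf// scale1r.
move: gu; rewrite -/(gt t b); move: (gt t b) => g gu.
rewrite -!scalemxAl -!scalemxAr; congr (_ *: _); rewrite -!mulmxA mulKmx// [invmx E *m (u *m _)]mulmxA invmxE_u.
have -> : (toR (delta_mx 0 i : 'rV_n.+1) : 'rV[R]_n.+1) *m r = row i r.
  by rewrite /toR map_delta_mx -rowE.
apply/matrixP => x y; rewrite !mxE big_ord1 !mxE eqxx !andbT; ring.
Qed.

Lemma cusp_sum_decay (V : 'M[R]_(p.+1, n)) (c : 'M[R]_n.+1) (K : R) (N : nat)
    (rho : 'M[rat]_(p.+2, n.+1) -> R) : c^T = c ->
  (forall X, `|rho X| <= 1) ->
  (forall X i, beta X = 0 -> rho (X + uj *m (delta_mx 0 i : 'rV_n.+1)) = rho X) ->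
  exists2 C, 0 <= C & forall t b, 1 <= t -> inW q u u' b -> n1 b <= K ->
    `|rsum D (fun X => rho X * psi_real V c (coord (gt t b) X))| <= C * t ^- N.
Proof.
move=> c_sym rho1 rhoS.
have [Cn Cn0 hn] := n1_nmx_le q u K; have [Ca Ca0 ha] := n1_amx_le q u u'.
pose C0 := n1 (toR G : 'M[R]_p.+2) * Cn * Ca * n1 E * n1 (invmx r).
have C00 : 0 <= C0 by rewrite !mulr_ge0 ?n1_ge0.
(* [n1_coord] will be applied with [K = (1 + C0) t], which is at least 1, so that its bound is
   exactly [Cw * t ^+ l]. *)
pose Cw := (1 + C0) ^+ l.
have Cw0 : 0 <= Cw by rewrite exprn_ge0// addr_ge0.
(* By [coord_beta] each entry of [beta X *m r] times [t] is at most [n1 y]; adding [n + 1] entries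
   and undoing [r] gives this constant. *)
pose Cb : R := n.+1%:R * n1 (invmx r).
have Cb0 : 0 <= Cb by rewrite mulr_ge0 ?n1_ge0.
have rr' : invmx r *m r = 1%:M by rewrite mulVmx.
have [C Cpos hC] := psi_sum_decay V c_sym rr' weight_ge0 weight_sum N l Cw0 Cb0.
exists C => // t b t1 Wb bK; have t0 : 0 < t by exact: lt_le_trans t1.
have hg := SO0_cusp_elt G_SO0 t0 Wb; have [og _] := SO0_orth hg.
apply: (hC t (coord (gt t b)) (fun i X => X + uj *m (delta_mx 0 i : 'rV_n.+1))
  (fun X => beta X == 0)) => //.
- by move=> i; exact: coset_shift_bij.
- move=> X _; rewrite /Cw -exprMn; apply: n1_coord => //.
    by rewrite (le_trans t1)// ler_peMl ?(ltW t0)// lerDl.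
  apply: (@le_trans _ _ (C0 * t)); last by rewrite ler_wpM2r ?(ltW t0)// lerDr.
  have -> : C0 * t = n1 (toR G : 'M[R]_p.+2) * Cn * (Ca * t) * n1 E * n1 (invmx r).
    by rewrite /C0; ring.
  rewrite ler_wpM2r ?n1_ge0// ler_wpM2r ?n1_ge0//.
  rewrite (le_trans (n1_mul _ _))// ler_pM ?n1_ge0//; last exact: ha.
  by rewrite (le_trans (n1_mul _ _))// ler_wpM2l ?n1_ge0//; exact: hn.
- by move=> i X _; exact: cusp_dir_shift.
- by move=> i X _; rewrite beta_shift.
- by move=> i X _ /eqP; exact: rhoS.
- move=> X j _ /eqP b0; apply/eqP; rewrite -subr_eq0 coord_beta// b0.
  by rewrite /toR map_mx0 mul0mx mxE mulr0.
- move=> X DX nb.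
  have [a ba] : exists a, beta X 0 a != 0.
    apply/existsP; apply: contraNT nb; rewrite negb_exists => /forallP hz.
    by apply/eqP/rowP => a; have := hz a; rewrite negbK => /eqP ->; rewrite mxE.
  (* A nonzero integral vector has an entry of absolute value at least 1. *)
  have b1 : 1 <= n1 (toR (beta X) : 'rV[R]_n.+1).
    apply: le_trans (n1_entry _ 0 a); rewrite mxE -ratr_norm.
    by rewrite -[1](ratr_nat _ 1) ler_rat norm_intr_ge1// uj_int.
  set y := coord _ _.
  have hb : n1 (toR (beta X) *m r) * t <= n.+1%:R * n1 y.
    have -> : n.+1%:R * n1 y = \sum_(j < n.+1) n1 y.
      by rewrite sumr_const card_ord mulr_natl.
    rewrite {1}/n1 big_ord1 mulr_suml; apply: ler_sum => j _.
    have := coord_beta X j t0 Wb; rewrite -/y; set z := (_ *m r) 0 j => hy.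
    have : 2 * (`|z| * t) <= 2 * n1 y.
      have -> : 2 * (`|z| * t) = `|2 * t * z|.
        by rewrite !normrM (gtr0_norm t0) (ger0_norm (ler0n _ 2)); ring.
      by rewrite -hy (le_trans (ler_normB _ _))// mulr_natl mulr2n lerD// n1_entry.
    by rewrite ler_pM2l.
  apply: (@le_trans _ _ (n1 (toR (beta X) : 'rV[R]_n.+1) * t)).
    by rewrite ler_peMl// ltW.
  have -> : toR (beta X) = toR (beta X) *m r *m invmx r :> 'rV[R]_n.+1 by rewrite mulmxK.
  apply: (@le_trans _ _ (n1 (toR (beta X) *m r) * n1 (invmx r) * t)).
    by rewrite ler_wpM2r ?(ltW t0)// n1_mul.
  rewrite /Cb mulrAC [leRHS]mulrAC ler_wpM2r ?n1_ge0// (le_trans hb)//.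
  by rewrite ler_wpM2l// lerDr.
Qed.

Lemma rsum_add_dominated F F' C C' : 0 <= C -> 0 <= C' ->
  dominated D weight F C -> dominated D weight F' C' ->
  rsum D (fun X => F X + F' X) = rsum D F + rsum D F'.
Proof.
move=> C0 C'0 hF hF'; apply: (rsumD weight_ge0 weight_sum (addr_ge0 C0 C'0)) => X DX.
  by rewrite (le_trans (hF X DX))// ler_wpM2r ?weight_ge0// lerDl.
by rewrite (le_trans (hF' X DX))// ler_wpM2r ?weight_ge0// lerDr.
Qed.

Lemma theta_cusp_decay (f : 'M[R]_(p.+2, p)) (cc : 'I_n -> option 'I_p)
    (H : 'M[R[i]]_n.+1) (A : set 'cV[R]_p.+2) (N : nat) :
  (forall i, Wspace Q u0 u0' (col i f)) -> compact A -> A `<=` Wspace Q u0 u0' ->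
  exists C T : R, 0 < T /\ forall t b, T <= t -> A b ->
    ComplexField.Normc.normc (theta Q L h E tau (toR G *m Zcusp Q u0 u0' t b)
      (fun a => cusp_frame Q u0 u0' f (toR G) t b (cc a)) H) <= C * t ^- N.
Proof.
move=> fW /compact_n1 [K hK] AW.
(* The frame vectors pulled back to Z_0, namely e_1 for t d/dt and f_i for t d/db_i. [V] thus
   depends on neither [t] nor [b], so the constants below are uniform. *)
pose v a := if cc a is Some i then col i f else u - u'.
pose V : 'M[R]_(p.+1, n) := \matrix_(i, b) (invmx E *m v b) (row_index i) 0.
pose c1 := reC (psi_coef tau H); pose c2 := imC (psi_coef tau H).
have c1s : c1^T = c1 by apply: reC_sym; exact: psi_coef_sym.
have c2s : c2^T = c2 by apply: imC_sym; exact: psi_coef_sym.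
have cb X : `|cos (phase X)| <= 1 by exact: cos_max.
have sb X : `|sin (phase X)| <= 1 by exact: sin_max.
have nsb X : `|- sin (phase X)| <= 1 by rewrite normrN.
have cS X i : beta X = 0 ->
  cos (phase (X + uj *m (delta_mx 0 i : 'rV_n.+1))) = cos (phase X).
  by move=> b0; rewrite phase_shift.
have sS X i : beta X = 0 ->
  sin (phase (X + uj *m (delta_mx 0 i : 'rV_n.+1))) = sin (phase X).
  by move=> b0; rewrite phase_shift.
have nsS X i : beta X = 0 ->
  - sin (phase (X + uj *m (delta_mx 0 i : 'rV_n.+1))) = - sin (phase X).
  by move=> b0; rewrite phase_shift.
(* Four real sums: cosine and sine of the phase against real and imaginary parts of the symmetric
   coefficient matrix. *)
have [C1 C10 h1] := @cusp_sum_decay V c1 K N (fun X => cos (phase X)) c1s cb cS.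
have [C2 C20 h2] := @cusp_sum_decay V c2 K N (fun X => - sin (phase X)) c2s nsb nsS.
have [C3 C30 h3] := @cusp_sum_decay V c2 K N (fun X => cos (phase X)) c2s cb cS.
have [C4 C40 h4] := @cusp_sum_decay V c1 K N (fun X => sin (phase X)) c1s sb sS.
exists ((C1 + C2) + (C3 + C4)), 1; split => // t b t1 Ab.
have t0 : 0 < t by exact: lt_le_trans t1.
have Wb : inW q u u' b by exact: AW.
have hg := SO0_cusp_elt G_SO0 t0 Wb; have [og _] := SO0_orth hg.
have gu := orth_unit q_unit og.
have e := cusp_elt_Z0 (toR G) t0 Wb.
have bK := hK b Ab.
set Z := toR G *m Zcusp _ _ _ _ _; set vs := fun a => cusp_frame _ _ _ _ _ _ _ _.
have hV : frame (gt t b) vs = V.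
  apply/matrixP => i a; rewrite !mxE; apply: eq_bigr => k _; congr (_ * _).
  suff -> : vs a = gt t b *m v a by rewrite mulKmx.
  rewrite /vs /v /gt /cusp_elt -!mulmxA; case: (cc a) => [k'|].
    by rewrite cusp_frame_Some ?gt_eqF//; exact: fW.
  by rewrite cusp_frame_None ?gt_eqF.
have [eR eI] := psi_parts vs H hg e og e; rewrite -/c1 -/c2 hV in eR eI.
rewrite /theta /csum (le_trans (normc_le _ _))// mulrDl lerD//.
  rewrite -[X in rsum _ X]/(fun X => complex.Re (psi Q E tau (toR X) Z vs H)) eR.
  have [B1 B10 d1] := psi_real_dominated V c1 og cb.
  have [B2 B20 d2] := psi_real_dominated V c2 og nsb.
  rewrite (rsum_add_dominated B10 B20 d1 d2) (le_trans (ler_normD _ _))// mulrDl lerD//.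
    exact: h1.
  exact: h2.
rewrite -[X in rsum _ X]/(fun X => complex.Im (psi Q E tau (toR X) Z vs H)) eI.
have [B1 B10 d1] := psi_real_dominated V c2 og cb.
have [B2 B20 d2] := psi_real_dominated V c1 og sb.
rewrite (rsum_add_dominated B10 B20 d1 d2) (le_trans (ler_normD _ _))// mulrDl lerD//.
  exact: h3.
exact: h4.
Qed.

End Theta.

Lemma psi_eq0 (R : realType) p n Q (E : 'M[R]_p.+1) (tau : 'M[R[i]]_n) X Z vs H :
  sqrtmx (imM tau) = 0 -> psi Q E tau X Z vs H = 0.
Proof.
move=> r0; rewrite psi_expand big1 ?mulr0// => j _; rewrite big1// => k _.
rewrite /A_at /A0 r0 !mulmx0 big1 ?mulr0// => al _.
by rewrite mxE !mul0r.
Qed.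

(** Splitting [X = (X - h) + h], the vector [v] pairs integrally with [L], which lies in its dual,
    and with the columns of [h], which are dual vectors. *)
Lemma coset_pairing_int m n (Q : 'M[rat]_m) (L : set 'cV[rat]_m) (h X : 'M[rat]_(m, n))
    (v : 'cV[rat]_m) i :
  Q^T = Q -> L `<=` dual_lattice Q L -> (forall j, dual_lattice Q L (col j h)) ->
  L v -> lattice_coset L h X -> (v^T *m Q *m X) 0 i \is a Num.int.
Proof.
move=> Q_sym L_dual h_dual Lv hX.
have -> : (v^T *m Q *m X) 0 i = bil Q v (col i (X - h)) + bil Q (col i h) v.
  have -> : bil Q (col i h) v = bil Q v (col i h).
    have e : ((col i h)^T *m Q *m v)^T = v^T *m Q *m col i h.
      by rewrite !trmx_mul trmxK Q_sym mulmxA.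
    by rewrite /bil -e [RHS]mxE.
  have colD : col i (X - h) + col i h = col i X.
    by apply/colP => k; rewrite !mxE subrK.
  have -> : bil Q v (col i (X - h)) + bil Q v (col i h) = bil Q v (col i X).
    by rewrite /bil -colD mulmxDr [RHS]mxE.
  by rewrite /bil [in RHS]colE mulmxA -colE [RHS]mxE.
by rewrite rpredD//; [exact: (L_dual v Lv)|exact: h_dual].
Qed.

Theorem theorem5p8 (R : realType) (p n : nat) (hn : (1 <= n <= p)%N)
  (Q : 'M[rat]_p.+1) (Q_sym : Q^T = Q) (Q_nondeg : Q \in unitmx)
  (Q_sign : has_signature_p1 R Q)
  (L : set 'cV[rat]_p.+1) (L_lattice : is_lattice L)
  (L_dual : L `<=` dual_lattice Q L)
  (B : set 'cV[R]_p.+1) (B_comp : is_component (hyperboloid Q) B)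
  (Gam : set 'M[R]_p.+1)
  (Gam_index : finite_index_subgroup Gam (lattice_stabilizer Q L))
  (Gam_neat : neat Gam)
  (Gam_triv : trivial_on_discriminant Q L Gam)
  (M_volume : quotient_finite_volume Gam B)
  (M_noncompact : ~ quotient_compact Gam B)
  (h : 'M[rat]_(p.+1, n)) (h_dual : forall j, dual_lattice Q L (col j h))
  (r : nat) (u : 'I_r.+1 -> 'cV[rat]_p.+1)
  (u_cusps : cusp_representatives Q L B Gam u)
  (g : 'I_r.+1 -> 'M[rat]_p.+1)
  (g_SO0 : forall j, SO0 Q (toR (g j) : 'M[R]_p.+1))
  (g_u : forall j, g j *m u ord0 = u j) (g_0 : g ord0 = 1%:M)
  (u0' : 'cV[rat]_p.+1) (u0'_iso : bil Q u0' u0' = 0)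
  (u0_u0' : bil Q (u ord0) u0' = - (1 / 2))
  (E : 'M[R]_p.+1) (E_adapted : is_adapted_basis Q (u ord0) u0' E)
  (f : 'M[R]_(p.+1, p.-1)) (f_basis : is_W_basis Q (u ord0) u0' f)
  (tau : 'M[R[i]]_n) (tau_siegel : siegel tau) :
  [/\ forall Z vs H, B Z -> (forall a, tangent Q Z (vs a)) -> H^T = H ->
        csummable (lattice_coset L h) (fun X => psi Q E tau (toR X) Z vs H),
      quotient_form Q B Gam (theta Q L h E tau) &
      rapidly_decreasing Q (u ord0) u0' f g (theta Q L h E tau)].
Proof.
(* Successor forms turn [n.-1] and [p.-1] into the sizes of the preceding lemmas. *)
destruct n as [|n]; first by [].
destruct p as [|p]; first by case/andP: hn.
have [u_iso u_prim u_neg _] := u_cusps.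
have [E0 Em _ _] := E_adapted.
have EJ := adapted_gram Q_sym (u_iso ord0) u0'_iso u0_u0' E_adapted.
(* If v had no positive square root, sqrtmx would take its junk value 0 and psi
   would vanish, so the spectral theorem is not needed. *)
have [ex|nex] := pselect (exists s : 'M[R]_n.+1, posdef s /\ s *m s = imM tau); last first.
  have r0 : sqrtmx (imM tau) = 0 by apply: xgetPN => s hs; apply: nex; exists s.
  have th0 Z vs H : theta Q L h E tau Z vs H = 0.
    rewrite /theta /csum.
    by rewrite !(@eq_rsum _ _ _ _ (fun=> 0)) ?rsum0// => X _; rewrite psi_eq0.
  split.
  - move=> Z vs H _ _ _; split.
      by rewrite /summable esum1 ?ltry// => X _; rewrite psi_eq0// abse0.
    by rewrite /summable esum1 ?ltry// => X _; rewrite psi_eq0// abse0.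
  - by move=> g0 Z vs H _ _ _ _; rewrite !th0.
  - move=> j c H _ K _ _ N; exists 0, 1; split => // t b _ _.
    by rewrite th0 mul0r ComplexField.Normc.normc0.
have [rp _] : posdef (sqrtmx (imM tau)) /\ sqrtmx (imM tau) *m sqrtmx (imM tau) = imM tau.
  exact: (xgetPex 0 ex).
have r_unit := posdef_unit rp.
have BH Z : B Z -> bil (toR Q) Z Z = -1.
  by have [x _ ->] := B_comp; move=> /connected_component_sub.
have trans G Z : SO0 Q G -> B Z -> exists2 g1, SO0 Q g1 & g1 *m col ord_max E = G *m Z.
  move=> hG BZ.
  exact: (hyperboloid_transporter Q_sym Q_nondeg (u_iso ord0) u0'_iso u0_u0' Em hG
    (BH _ BZ) (u_neg ord0 Z BZ)).
split.
- move=> Z vs H BZ _ _; have [g1 h1] := trans 1%:M Z (SO0_1 R Q) BZ.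
  by rewrite mul1mx => e1; exact: (psi_csummable Q_sym Q_nondeg L_lattice h EJ r_unit vs H h1 e1).
- move=> g0 Z vs H Gg BZ _ _.
  have [Gsub _ _ _ _] := Gam_index; have [hg _] := Gsub _ Gg.
  have [og _] := SO0_orth hg.
  have q_unit : (toR Q : 'M[R]_p.+2) \in unitmx by rewrite /toR map_unitmx.
  have [A Ag bA] := coset_act_bij L_lattice Gam_index Gam_triv h_dual Gg (orth_unit q_unit og).
  have [g1 h1] := trans 1%:M Z (SO0_1 R Q) BZ; rewrite mul1mx => e1.
  have [g2 h2 e2] := trans g0 Z hg BZ.
  (* Multiplication by [A] permutes the coset, so it suffices to compare the term of [A X] at the
     image point with the term of [X] at [Z]. *)
  rewrite /theta -(csum_reindex _ bA); congr csum; apply/funext => X.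
  by subst g0; exact: (psi_act Q_sym Q_nondeg EJ tau X vs H hg h1 e1 h2 e2).
- move=> j c H _ K Kc KW N.
  have [Lu _ _] := u_prim j.
  apply: (theta_cusp_decay Q_sym Q_nondeg L_lattice EJ r_unit (u_iso ord0) u0'_iso u0_u0'
    E0 Em (g_SO0 j) (g_u j)) => //; last by case: f_basis.
  by move=> X i; exact: coset_pairing_int.
Qed.
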